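(* Let $T_A$ be the rearrangement group of the Airplane limit space. The abelianization of $T_A$ is an infinite cyclic group. In particular, the index of $[T_A,T_A]$ in $T_A$ is infinite.
   Context: The Airplane rearrangement group $T_A$. Graphs are finite directed multigraphs with edges coloured red or blue. The base graph $\Gamma$ has vertices $l,a,b,r$, blue edges $e_L:a\to l$ and $e_R:b\to r$, and red edges $e_U:b\to a$ and $e_D:a\to b$. Replacement rules: a red edge from $v_i$ to $v_t$ is replaced by the graph with vertices $v_i,v_t$ and two new vertices $m,w$, with red edges $\mathsf r_1:v_i\to m$, $\mathsf r_2:m\to v_t$ and a blue edge $\mathsf s:m\to w$; a blue edge from $v_i$ to $v_t$ is replaced by the graph with vertices $v_i,v_t$ and two new vertices $x,y$, with blue edges $\mathsf b_-:x\to v_i$, $\mathsf b_+:y\to v_t$ and red edges $\mathsf u:y\to x$, $\mathsf d:x\to y$. An expansion is any graph obtained from $\Gamma$ by finitely many (possibly zero) replacements of single edges. Each edge of an expansion is named by the finite word $e_0e_1\cdots e_k$ recording the edge $e_0$ of $\Gamma$ from which it descends and the successive edges of replacement graphs. Let $\Gamma_0=\Gamma$, and let $\Gamma_{n+1}$ be obtained from $\Gamma_n$ by replacing every edge. Let $\Omega$ be the set of infinite words all of whose finite nonempty prefixes name edges (topologized as a subspace of a product of finite discrete sets). Two such words $e_0e_1\cdots$ and $f_0f_1\cdots$ are equivalent if for every $n$ the edges $e_0\cdots e_n$ and $f_0\cdots f_n$ of $\Gamma_n$ share at least one vertex; this is an equivalence relation, and the Airplane limit space $A$ is the quotient of $\Omega$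 by it, with the quotient topology. The cell $\chi(e)$ of an edge $e$ is the set of points of $A$ represented by words beginning with $e$. A cellular partition is a cover of $A$ by finitely many cells with pairwise disjoint interiors. If $e,e'$ are edges of the same colour, the canonical homeomorphism $\chi(e)\to\chi(e')$ sends the class of $ew$ to the class of $e'w$. A rearrangement is a homeomorphism $f:A\to A$ for which there is a cellular partition such that $f$ restricts on each of its cells to a canonical homeomorphism onto some cell. Rearrangements form a group $T_A$ under composition. *)

(* Defs.v *)
From HB Require Import structures.
From mathcomp Require Import all_boot ssralg ssrint all_classical topology.

Set Implicit Arguments.
Unset Strict Implicit.
Unset Printing Implicit Defensive.

Local Open Scope classical_set_scope.
Local Open Scope quotient_scope.

Inductive colour := Red | Blue.

(** The edges of the base graph and of the two replacement graphs: [r_1], [r_2],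
    [r_s] in the red one, [b_m] (b_-), [b_p] (b_+), [b_u], [b_d] in the blue one. *)
Inductive letter := e_L | e_R | e_U | e_D | r_1 | r_2 | r_s | b_m | b_p | b_u | b_d.

Definition letter_code (x : letter) : nat :=
  match x with
  | e_L => 0 | e_R => 1 | e_U => 2 | e_D => 3 | r_1 => 4 | r_2 => 5 | r_s => 6
  | b_m => 7 | b_p => 8 | b_u => 9 | b_d => 10
  end.
Definition letter_decode (n : nat) : letter :=
  nth e_L [:: e_L; e_R; e_U; e_D; r_1; r_2; r_s; b_m; b_p; b_u; b_d] n.
Lemma letter_codeK : cancel letter_code letter_decode. Proof. by case. Qed.
HB.instance Definition _ := Countable.copy letter (can_type letter_codeK).

(** The vertices created by replacing an edge are tagged by its name. *)
Inductive vertex :=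
  | v_l | v_a | v_b | v_r
  | v_m of seq letter | v_w of seq letter | v_x of seq letter | v_y of seq letter.
HB.instance Definition _ := gen_eqMixin vertex.

Record edge := Edge {
  ename : seq letter; ecolour : colour; esrc : vertex; etgt : vertex }.
HB.instance Definition _ := gen_eqMixin edge.

(** No graph below has isolated vertices, so that a graph is given by its list
    of edges. *)
Definition base_graph : seq edge :=
  [:: Edge [:: e_L] Blue v_a v_l; Edge [:: e_R] Blue v_b v_r;
      Edge [:: e_U] Red v_b v_a; Edge [:: e_D] Red v_a v_b].

Definition replacement (e : edge) : seq edge :=
  let: Edge w c vi vt := e in
  match c with
  | Red => [:: Edge (rcons w r_1) Red vi (v_m w);
               Edge (rcons w r_2) Red (v_m w) vt;
               Edge (rcons w r_s) Blue (v_m w) (v_w w)]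
  | Blue => [:: Edge (rcons w b_m) Blue (v_x w) vi;
                Edge (rcons w b_p) Blue (v_y w) vt;
                Edge (rcons w b_u) Red (v_y w) (v_x w);
                Edge (rcons w b_d) Red (v_x w) (v_y w)]
  end.

Inductive expansion : seq edge -> Prop :=
  | expansion_base : expansion base_graph
  | expansion_step G1 e G2 :
      expansion (G1 ++ e :: G2) -> expansion (G1 ++ replacement e ++ G2).

Definition is_edge (e : edge) : Prop := exists2 G, expansion G & e \in G.

Definition full_expansion (n : nat) : seq edge :=
  iter n (fun G => flatten (map replacement G)) base_graph.

Definition ends (e : edge) : seq vertex := [:: esrc e; etgt e].

Definition share_vertex (e f : edge) : Prop :=
  exists2 v, v \in ends e & v \in ends f.

(** All the levels share one finite alphabet; this induces the same topology as
    the product of the edge sets. *)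
Definition Omega : set (prod_topology (fun _ : nat => discrete_topology letter))
  := [set w | forall n, exists2 e, is_edge e & ename e = mkseq w n.+1].

Definition glued (x y : Omega) : Prop :=
  forall n, exists e f,
    [/\ e \in full_expansion n /\ ename e = mkseq (val x) n.+1,
        f \in full_expansion n /\ ename f = mkseq (val y) n.+1
      & share_vertex e f].

Lemma is_edge_ind_gen (P : edge -> Prop) :
  (forall e, e \in base_graph -> P e) ->
  (forall p e, is_edge p -> P p -> e \in replacement p -> P e) ->
  forall e, is_edge e -> P e.
Proof.
move=> P0 PS e0 [G0 expG0]; elim: expG0 e0 => [|G1 p G2 expG IH] e.
  exact: P0.
rewrite !mem_cat => /or3P[e1|ep|e2].
- by apply: IH; rewrite mem_cat e1.
- apply: PS ep; last by apply: IH; rewrite mem_cat mem_head orbT.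
  by exists (G1 ++ p :: G2) => //; rewrite mem_cat mem_head orbT.
- by apply: IH; rewrite mem_cat inE e2 !orbT.
Qed.

Lemma is_edge_base e : e \in base_graph -> is_edge e.
Proof. by move=> eG; exists base_graph => //; constructor. Qed.

Definition letter_colour (x : letter) : colour :=
  match x with e_L | e_R | r_s | b_m | b_p => Blue | _ => Red end.

(** [follows x y]: [y] is an edge of the graph replacing an edge of the same
    colour as [x]. *)
Definition follows (x y : letter) : bool :=
  match letter_colour x, y with
  | Red, (r_1 | r_2 | r_s) => true
  | Blue, (b_m | b_p | b_u | b_d) => true
  | _, _ => false
  end.

Definition wf (w : seq letter) : bool :=
  match w with
  | (e_L | e_R | e_U | e_D) as x :: w' => path follows x w'
  | _ => false
  end.

Lemma base_graph_name x : wf [:: x] ->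
  exists2 e, e \in base_graph & ename e = [:: x].
Proof.
move=> H; have P i : i < 4 ->
    exists2 e, e \in base_graph & ename e = ename (nth (Edge [::] Red v_l v_l) base_graph i).
  by move=> i4; exists (nth (Edge [::] Red v_l v_l) base_graph i) => //; exact: mem_nth.
by case: x H => // _; [exact: (P 0)|exact: (P 1)|exact: (P 2)|exact: (P 3)].
Qed.

Lemma is_edge_step p e : is_edge p -> e \in replacement p -> is_edge e.
Proof.
move=> [G expG pG] ep; move: expG; case/path.splitPr: pG => G1 G2 expG.
exists (G1 ++ replacement p ++ G2); first exact: expansion_step.
by rewrite !mem_cat ep orbT.
Qed.

Lemma wf_rcons w x : w != [::] -> wf (rcons w x) = wf w && follows (last e_L w) x.
Proof. by case: w => [//|[] w _] //=; rewrite rcons_path. Qed.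

Lemma is_edge_wf e :
  is_edge e -> [/\ ename e != [::], wf (ename e) & ecolour e = letter_colour (last e_L (ename e))].
Proof.
move: e; apply: is_edge_ind_gen => [e|p e _ [p0 wfp colp]].
  by rewrite !inE => /or4P[] /eqP->.
case: p p0 wfp colp => w c vi vt /= w0 wfw; case: c => cw.
all: rewrite !inE => H.
  case/or3P: H => /eqP->; rewrite /= wf_rcons// wfw last_rcons /follows -cw;
    by split=> //; case: (w).
case/or4P: H => /eqP->; rewrite /= wf_rcons// wfw last_rcons /follows -cw;
  by split=> //; case: (w).
Qed.

Lemma follows_child p x : is_edge p -> follows (last e_L (ename p)) x ->
  exists2 e, e \in replacement p & ename e = rcons (ename p) x.
Proof.
move=> /is_edge_wf[_ _]; case: p => w c vi vt /= cw; rewrite /follows -cw.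
set p := Edge w c vi vt; have P i : i < size (replacement p) ->
  exists2 e, e \in replacement p & ename e = ename (nth p (replacement p) i).
  by move=> ip; exists (nth p (replacement p) i) => //; exact: mem_nth.
rewrite /p {p} in P *; case: c P {cw} => P; case: x => // _;
  by [exact: (P 0)|exact: (P 1)|exact: (P 2)|exact: (P 3)].
Qed.

Lemma wf_is_edge w : wf w -> exists2 e, is_edge e & ename e = w.
Proof.
elim/last_ind: w => [//|w x IH]; case: (eqVneq w [::]) => [->|w0].
  by move=> /base_graph_name[e eG ne]; exists e => //; exact: is_edge_base.
rewrite wf_rcons// => /andP[/IH[p ep <-]] /(follows_child ep)[e /(is_edge_step ep)].
by exists e.
Qed.

Lemma OmegaP w : Omega w <-> forall n, wf (mkseq w n.+1).
Proof.
split=> Ow n; last exact: wf_is_edge.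
by have [e /is_edge_wf[_ + _] <-] := Ow n.
Qed.

Lemma full_expansionS n e :
  e \in full_expansion n.+1 <-> exists2 p, p \in full_expansion n & e \in replacement p.
Proof. by split=> [/flatten_mapP|H]; [|apply/flatten_mapP]. Qed.

Lemma name_child p e : e \in replacement p -> exists x, ename e = rcons (ename p) x.
Proof.
case: p => w c vi vt; case: c; rewrite !inE /=.
  by move=> /or3P[] /eqP->; eexists.
by move=> /or4P[] /eqP->; eexists.
Qed.

Lemma full_expansion_edge n e :
  e \in full_expansion n -> is_edge e /\ size (ename e) = n.+1.
Proof.
elim: n e => [|n IH] e.
  move=> eG; split; first exact: is_edge_base.
  by move: eG; rewrite !inE => /or4P[] /eqP->.
move=> /full_expansionS[p /IH[ep sp] ee]; split; first exact: is_edge_step ee.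
by have [x ->] := name_child ee; rewrite size_rcons sp.
Qed.

Lemma full_expansion_inj n e f : e \in full_expansion n -> f \in full_expansion n ->
  ename e = ename f -> e = f.
Proof.
elim: n e f => [|n IH] e f.
  by rewrite !inE => /or4P[] /eqP-> /or4P[] /eqP->.
move=> /full_expansionS[p pn ep] /full_expansionS[q qn fq] ef.
have pq : p = q.
  apply: IH => //; have [x ex] := name_child ep; have [y fy] := name_child fq.
  by move: ef; rewrite ex fy => /rcons_inj[].
move: ep fq ef; rewrite -pq; case: p {pn pq} => w c vi vt.
case: c; rewrite !inE.
  by move=> /or3P[] /eqP-> /or3P[] /eqP-> //= /rcons_inj[].
by move=> /or4P[] /eqP-> /or4P[] /eqP-> //= /rcons_inj[].
Qed.

Lemma prefix_edge (x : Omega) n :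
  exists2 e, e \in full_expansion n & ename e = mkseq (val x) n.+1.
Proof.
have Ox : Omega (val x) by apply: set_mem; exact: valP.
move/OmegaP: Ox => Ox.
elim: n => [|n [p pn np]].
  exact: base_graph_name (Ox 0).
have [ep _] := full_expansion_edge pn.
have xS m : mkseq (val x) m.+1 = rcons (mkseq (val x) m) (val x m).
  by rewrite /mkseq -addn1 iotaD map_cat /= cats1.
have := Ox n.+1; rewrite xS -np wf_rcons; last by rewrite np xS; case: mkseq.
move=> /andP[_ /(follows_child ep)[e ee ne]].
by exists e; [apply/full_expansionS; exists p|rewrite ne np -xS].
Qed.

Definition old_vertex (n : nat) (v : vertex) : bool :=
  match v with
  | v_l | v_a | v_b | v_r => true
  | v_m w | v_w w | v_x w | v_y w => size w <= n
  end.

Definition new_vertex (w : seq letter) (v : vertex) : bool :=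
  v \in [:: v_m w; v_w w; v_x w; v_y w].

Lemma ends_child p e v : e \in replacement p -> v \in ends e ->
  v \in ends p \/ new_vertex (ename p) v.
Proof.
case: p => w c vi vt; case: c; rewrite !inE /new_vertex /ends /=.
  by move=> /or3P[] /eqP-> /=; rewrite !inE => /orP[] /eqP->; rewrite eqxx ?orbT; auto.
by move=> /or4P[] /eqP-> /=; rewrite !inE => /orP[] /eqP->; rewrite eqxx ?orbT; auto.
Qed.

Lemma new_old w n v : n < size w -> new_vertex w v -> old_vertex n v = false.
Proof.
by move=> nw; rewrite /new_vertex !inE => /or4P[] /eqP-> /=; rewrite leqNgt nw.
Qed.

Lemma ends_old n e v : e \in full_expansion n -> v \in ends e -> old_vertex n v.
Proof.
elim: n e v => [|n IH] e v.
  by rewrite !inE => /or4P[] /eqP-> /orP[] /eqP->.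
move=> /full_expansionS[p pn ep] /(ends_child ep)[/(IH _ _ pn)|].
  by case: v => //= w wn; exact: leqW.
rewrite /new_vertex; have [_ sp] := full_expansion_edge pn.
by rewrite !inE => /or4P[] /eqP-> /=; rewrite sp.
Qed.

Lemma new_inj w w' v : new_vertex w v -> new_vertex w' v -> w = w'.
Proof.
by rewrite /new_vertex !inE => /or4P[] /eqP->; move=> /or4P[] /eqP[].
Qed.

Lemma share_child n p q e f v :
  p \in full_expansion n -> q \in full_expansion n -> p != q ->
  e \in replacement p -> f \in replacement q -> v \in ends e -> v \in ends f ->
  v \in ends p /\ v \in ends q.
Proof.
move=> pn qn pq ep fq ve vf.
have [_ sp] := full_expansion_edge pn; have [_ sq] := full_expansion_edge qn.
case: (ends_child ep ve) => vp; case: (ends_child fq vf) => vq //.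
- by have := ends_old pn vp; rewrite (new_old _ vq)// sq.
- by have := ends_old qn vq; rewrite (new_old _ vp)// sp.
- by move: pq; rewrite (full_expansion_inj pn qn (new_inj vp vq)) eqxx.
Qed.

Lemma child_new p e : e \in replacement p ->
  new_vertex (ename p) (esrc e) \/ new_vertex (ename p) (etgt e).
Proof.
case: p => w c vi vt; case: c; rewrite !inE /new_vertex /=.
  by move=> /or3P[] /eqP-> /=; rewrite !inE eqxx ?orbT; auto.
by move=> /or4P[] /eqP-> /=; rewrite !inE eqxx ?orbT; auto.
Qed.

Lemma child_old_uniq n p e v v' : p \in full_expansion n -> e \in replacement p ->
  v \in ends p -> v' \in ends p -> v \in ends e -> v' \in ends e -> v = v'.
Proof.
move=> pn ep /(ends_old pn) vp /(ends_old pn) v'p.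
have [_ sp] := full_expansion_edge pn.
have nn v0 : new_vertex (ename p) v0 -> old_vertex n v0 = false by apply: new_old; rewrite sp.
rewrite !inE => /orP[]/eqP ve /orP[]/eqP v'e; rewrite ?ve ?v'e //;
  by case: (child_new ep) => /nn; rewrite -?ve -?v'e ?vp ?v'p.
Qed.

Lemma glued_child (x y : Omega) n e e' f f' : glued x y ->
  e \in full_expansion n -> ename e = mkseq (val x) n.+1 ->
  f \in full_expansion n -> ename f = mkseq (val y) n.+1 ->
  e' \in replacement e -> ename e' = mkseq (val x) n.+2 ->
  f' \in replacement f -> ename f' = mkseq (val y) n.+2 ->
  e != f -> exists v, [/\ v \in ends e, v \in ends f, v \in ends e' & v \in ends f'].
Proof.
move=> xy en ne fn nf ee ne' ff nf' ef.
have [e1 [f1 [[e1n ne1] [f1n nf1] [v ve vf]]]] := xy n.+1.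
have eS : e' \in full_expansion n.+1 by apply/full_expansionS; exists e.
have fS : f' \in full_expansion n.+1 by apply/full_expansionS; exists f.
rewrite (full_expansion_inj e1n eS) ?ne1 ?ne' // in ve.
rewrite (full_expansion_inj f1n fS) ?nf1 ?nf' // in vf.
by have [? ?] := share_child en fn ef ee ff ve vf; exists v.
Qed.

Lemma prefix_edgeS (x : Omega) n : exists e e',
  [/\ e \in full_expansion n, ename e = mkseq (val x) n.+1,
      e' \in replacement e & ename e' = mkseq (val x) n.+2].
Proof.
have [e' /full_expansionS[e en ee] ne'] := prefix_edge x n.+1.
exists e, e'; split=> //; have [z ez] := name_child ee.
have xS : mkseq (val x) n.+2 = rcons (mkseq (val x) n.+1) (val x n.+1).
  by rewrite /mkseq -addn1 iotaD map_cat /= cats1.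
by move: ne'; rewrite ez xS => /rcons_inj[].
Qed.

Lemma glued_refl x : glued x x.
Proof.
move=> n; have [e en ne] := prefix_edge x n; exists e, e; split=> //.
by exists (esrc e); rewrite mem_head.
Qed.

Lemma glued_sym x y : glued x y -> glued y x.
Proof. by move=> xy n; have [e [f [? ? [v ? ?]]]] := xy n; exists f, e; split=> //; exists v. Qed.

Lemma glued_trans x y z : glued x y -> glued y z -> glued x z.
Proof.
move=> xy yz n.
have [e [e' [en ne ee ne']]] := prefix_edgeS x n.
have [f [f' [fn nf ff nf']]] := prefix_edgeS y n.
have [g [g' [gn ng gg ng']]] := prefix_edgeS z n.
exists e, g; split=> //.
have [ef|ef] := eqVneq e f.
  have [f1 [g1 [[f1n nf1] [g1n ng1] sh]]] := yz n.
  rewrite ef -(full_expansion_inj f1n fn) ?nf1//.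
  by rewrite -(full_expansion_inj g1n gn) ?ng1.
have [fg|fg] := eqVneq f g.
  have [e1 [f1 [[e1n ne1] [f1n nf1] sh]]] := xy n.
  rewrite -fg -(full_expansion_inj f1n fn) ?nf1//.
  by rewrite -(full_expansion_inj e1n en) ?ne1.
have [v [ve vf _ vf']] := glued_child xy en ne fn nf ee ne' ff nf' ef.
have [v1 [v1f v1g v1f' _]] := glued_child yz fn nf gn ng ff nf' gg ng' fg.
by exists v => //; rewrite (child_old_uniq fn ff vf v1f vf' v1f').
Qed.

Definition gluedb (x y : Omega) : bool := `[< glued x y >].

Lemma gluedb_refl : reflexive gluedb.
Proof. by move=> x; apply/asboolP; exact: glued_refl. Qed.
Lemma gluedb_sym : symmetric gluedb.
Proof. by move=> x y; apply/asboolP/asboolP; exact: glued_sym. Qed.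
Lemma gluedb_trans : transitive gluedb.
Proof.
by move=> y x z /asboolP xy /asboolP yz; apply/asboolP; exact: glued_trans yz.
Qed.

Canonical glued_equiv := EquivRel gluedb gluedb_refl gluedb_sym gluedb_trans.

Definition airplane : topologicalType :=
  quotient_topology {eq_quot glued_equiv}.

Definition to_airplane (x : Omega) : airplane := \pi_{eq_quot glued_equiv} x.

Definition wcat (v : seq letter) (t : nat -> letter) : nat -> letter :=
  fun n => if n < size v then nth e_L v n else t (n - size v).

Definition cell (e : edge) : set airplane :=
  [set to_airplane x | x in [set x : Omega | exists t, val x = wcat (ename e) t]].

Definition cellular_partition (P : seq edge) : Prop :=
  [/\ {in P, forall e, is_edge e},
      \bigcup_(e in [set` P]) cell e = [set: airplane] &
      {in P &, forall e e', e != e' -> (cell e)^° `&` (cell e')^° = set0}].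

(** [f] restricts on the cell of [e] to the canonical map to the cell of [e']. *)
Definition canonical_on (f : airplane -> airplane) (e e' : edge) : Prop :=
  forall t (x : Omega), val x = wcat (ename e) t ->
    exists2 y : Omega, val y = wcat (ename e') t & f (to_airplane x) = to_airplane y.

Definition homeomorphism (f : airplane -> airplane) : Prop :=
  exists g : airplane -> airplane,
    [/\ continuous f, continuous g, cancel f g & cancel g f].

Definition is_rearrangement (f : airplane -> airplane) : Prop :=
  homeomorphism f /\
  exists2 P, cellular_partition P &
    {in P, forall e, exists e',
      [/\ is_edge e', ecolour e' = ecolour e & canonical_on f e e']}.

Lemma mkseqS T (x : nat -> T) n : mkseq x n.+1 = rcons (mkseq x n) (x n).
Proof. by rewrite /mkseq -addn1 iotaD map_cat /= cats1. Qed.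

Lemma mkseq_wcat v t n : mkseq (wcat v t) (size v + n) = v ++ mkseq t n.
Proof.
apply: (@eq_from_nth _ e_L) => [|i]; first by rewrite size_cat !size_mkseq.
rewrite size_mkseq => iv; rewrite nth_mkseq// /wcat nth_cat.
by case: ltnP => // vi; rewrite nth_mkseq// ltn_subLR.
Qed.

Lemma mkseq_wcat0 v t : mkseq (wcat v t) (size v) = v.
Proof. by rewrite -[X in mkseq _ X]addn0 mkseq_wcat cats0. Qed.

Lemma wcat_cat v w t : wcat (v ++ w) t = wcat v (wcat w t).
Proof.
apply/funext => n; rewrite /wcat size_cat nth_cat.
case: (ltnP n (size v)) => nv; first by rewrite ltn_addr.
by rewrite ltn_subLR// subnDA.
Qed.

Lemma wcat_mkseq x n : x = wcat (mkseq x n) (fun i => x (n + i)).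
Proof.
apply/funext => i; rewrite /wcat size_mkseq; case: ltnP => ni.
  by rewrite nth_mkseq.
by rewrite subnKC.
Qed.

Lemma mkseq_take T (x : nat -> T) m n : m <= n -> mkseq x m = take m (mkseq x n).
Proof. by move=> mn; rewrite /mkseq -map_take take_iota (minn_idPl mn). Qed.

Lemma wf_cat v w : v != [::] -> wf (v ++ w) = wf v && path follows (last e_L v) w.
Proof. by case: v => [//|[] v _] //=; rewrite cat_path. Qed.

Lemma OmegaE (x : Omega) : Omega (val x).
Proof. by apply: set_mem; exact: valP. Qed.

Definition mkOmega (x : nat -> letter) (Ox : Omega x) : Omega :=
  exist _ x (mem_set Ox).

Lemma Omega_inj (x y : Omega) : val x = val y -> x = y.
Proof. exact: val_inj. Qed.

Lemma wcat_Omega v t : v != [::] ->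
  Omega (wcat v t) <-> wf v /\ forall n, path follows (last e_L v) (mkseq t n).
Proof.
move=> v0; have v1 : 0 < size v by case: v v0.
split=> [/OmegaP Ox|[wfv tP]].
  have H n : wf (v ++ mkseq t n).
    by rewrite -mkseq_wcat -(prednK v1) addSn.
  split; first by have := H 0; rewrite cats0.
  by move=> n; have := H n; rewrite wf_cat// => /andP[].
apply/OmegaP => n; rewrite (@mkseq_take _ _ n.+1 (size v + n.+1)) ?leq_addl//.
have : wf (v ++ mkseq t n.+1) by rewrite wf_cat// wfv tP.
rewrite -mkseq_wcat; set w := mkseq _ _; move=> wfw.
have : take n.+1 w != [::] by rewrite -size_eq0 size_takel// size_mkseq leq_addl.
by move/wf_cat => /(_ (drop n.+1 w)); rewrite cat_take_drop wfw => /esym/andP[].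
Qed.

Lemma path_follows a b w : letter_colour a = letter_colour b ->
  path follows a w = path follows b w.
Proof. by case: w => [//|x w] /= ab; rewrite /follows ab. Qed.

Definition fill (c : colour) (n : nat) : letter :=
  match c with
  | Red => if odd n then b_u else r_s
  | Blue => if odd n then r_s else b_u
  end.

Lemma fill_path a n : path follows a (mkseq (fill (letter_colour a)) n).
Proof.
elim: n => [//|n IH]; rewrite mkseqS rcons_path IH andTb.
case: n {IH} => [|n].
  by rewrite /mkseq /=; case: a.
by rewrite mkseqS last_rcons /fill oddS; case: letter_colour; case: (odd n).
Qed.

Definition regular (x : nat -> letter) : Prop :=
  exists N, forall n, N <= n -> x n \in [:: r_s; b_u].

Lemma regular_extension v : wf v ->
  exists x : Omega, regular (val x) /\ exists t, val x = wcat v t.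
Proof.
move=> wfv; have v0 : v != [::] by case: v wfv.
set t := fill (letter_colour (last e_L v)).
have Ox : Omega (wcat v t).
  by apply/(wcat_Omega _ v0); split=> // n; exact: fill_path.
exists (mkOmega Ox); split; last by exists t.
exists (size v) => n vn; rewrite /= /wcat ltnNge vn /= /t /fill.
by case: letter_colour; case: odd; rewrite !inE eqxx ?orbT.
Qed.

Lemma child_regular p e v x : e \in replacement p -> ename e = rcons (ename p) x ->
  x \in [:: r_s; b_u] -> v \in ends e -> new_vertex (ename p) v.
Proof.
case: p => w c vi vt; case: c; rewrite [in e \in _]/= !inE /new_vertex /ends.
  move=> /or3P[] /eqP-> /= /rcons_inj[<-] //= _;
  by rewrite !inE => /orP[] /eqP->; rewrite eqxx ?orbT.
move=> /or4P[] /eqP-> /= /rcons_inj[<-] //= _;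
by rewrite !inE => /orP[] /eqP->; rewrite eqxx ?orbT.
Qed.

Lemma regular_glued x y : regular (val x) -> glued x y -> x = y.
Proof.
move=> [N rx] xy; apply: Omega_inj; apply/funext => k; apply/eqP.
apply: contraT => xyk; set n := maxn k N.
have [e [e' [en ne ee ne']]] := prefix_edgeS x n.
have [f [f' [fn nf ff nf']]] := prefix_edgeS y n.
have ef : e != f.
  apply: contra xyk => /eqP ef; move: ne; rewrite ef nf => /(congr1 (nth e_L ^~ k)).
  by rewrite !nth_mkseq ?ltnS ?leq_maxl// => ->.
have [v [ve _ ve' _]] := glued_child xy en ne fn nf ee ne' ff nf' ef.
have [_ se] := full_expansion_edge en.
have := ends_old en ve; rewrite (@new_old (ename e)) ?se//.
apply: (child_regular ee _ _ ve'); first by rewrite ne' mkseqS -ne.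
by apply: rx; rewrite (leq_trans (leq_maxr k N)).
Qed.

Lemma to_airplane_glued x y : to_airplane x = to_airplane y <-> glued x y.
Proof.
split=> [xy|xy]; first by apply/asboolP; exact/(@eqmodP _ glued_equiv).
by apply/(@eqmodP _ glued_equiv)/asboolP.
Qed.

Lemma to_airplane_surj p : exists x, p = to_airplane x.
Proof. by exists (repr p); rewrite /to_airplane reprK. Qed.

Lemma regular_cell x e : regular (val x) -> cell e (to_airplane x) ->
  mkseq (val x) (size (ename e)) = ename e.
Proof.
move=> rx [y [t yt] /esym /to_airplane_glued/(regular_glued rx) xy].
by rewrite xy yt mkseq_wcat0.
Qed.

Lemma Omega_cvg (y : nat -> Omega) (x : Omega) :
  (forall n, mkseq (val (y n)) n.+1 = mkseq (val x) n.+1) -> y @ \oo --> x.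
Proof.
move=> yx A [_ [[W oW <-] Wx sWA]].
suff : (fun n => set_val (y n)) @ \oo --> set_val x.
  move=> /(_ W) yW; have /yW : nbhs (set_val x) W by exact: open_nbhs_nbhs.
  by move=> [N _ NW]; exists N => // n /NW Wn; exact: sWA.
apply/cvg_sup => i B [_ [[C oC <-] Cx sCB]].
exists i => // n /= i_n; apply: sCB; rewrite /= set_valE /proj.
have /(congr1 (nth e_L ^~ i)) := yx n; rewrite !nth_mkseq ?ltnS// => E.
by move: Cx; rewrite /= set_valE /proj E.
Qed.

Lemma open_regular (U : set airplane) p : open U -> U p ->
  exists2 x, regular (val x) & U (to_airplane x).
Proof.
have [x ->] := to_airplane_surj p => oU Ux.
have wfx n : wf (mkseq (val x) n.+1) by exact: (OmegaP _).1 (OmegaE x) n.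
have /(_ _)/cid-/all_sig[y yP] n := regular_extension (wfx n).
have yx : y @ \oo --> x.
  apply: Omega_cvg => n; have [_ [t ->]] := yP n.
  by rewrite -[X in mkseq (wcat _ _) X](size_mkseq (val x)) mkseq_wcat0.
have : \forall z \near x, (to_airplane @^-1` U) z.
  by apply: open_nbhs_nbhs; split=> //; apply: open_comp => // z _;
    exact: pi_continuous.
by move=> /yx [n _ /(_ n (leqnn n)) /= Uy]; exists (y n) => //; case: (yP n).
Qed.

Lemma full_expansion_partition n : cellular_partition (full_expansion n).
Proof.
split=> [e /full_expansion_edge[]//||e e' en e'n].
  apply/seteqP; split=> // p _; have [x ->] := to_airplane_surj p.
  have [e en ne] := prefix_edge x n; exists e => //; exists x => //.
  by rewrite /= ne; eexists; exact: wcat_mkseq.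
apply: contraNeq => /set0P[p [pe pe']].
have [|//|x rx [/interior_subset xe /interior_subset xe']] :=
  @open_regular ((cell e)^° `&` (cell e')^°) p.
  by apply: openI; exact: open_interior.
apply/eqP/(full_expansion_inj en e'n).
have [_ se] := full_expansion_edge en; have [_ se'] := full_expansion_edge e'n.
by rewrite -(regular_cell rx xe) -(regular_cell rx xe') se se'.
Qed.

Lemma canonical_cat f a a' e w : is_edge a' -> ecolour a' = ecolour a ->
  is_edge a -> is_edge e -> ename e = ename a ++ w -> canonical_on f a a' ->
  exists e', [/\ is_edge e', ecolour e' = ecolour e, ename e' = ename a' ++ w
               & canonical_on f e e'].
Proof.
move=> /is_edge_wf[a'0 wfa' ca'] aa' /is_edge_wf[a0 wfa ca] /is_edge_wf[e0 wfe ce] ew fa.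
have laa' : letter_colour (last e_L (ename a')) = letter_colour (last e_L (ename a)).
  by rewrite -ca' -ca.
have [|e' ee' ne'] := @wf_is_edge (ename a' ++ w).
  move: wfe; rewrite ew !wf_cat// => /andP[_].
  by rewrite wfa' (path_follows _ laa').
exists e'; split=> // [|t x xt].
  have [_ _ ->] := is_edge_wf ee'; rewrite ce ne' ew !last_cat.
  by case: (w).
have [|y yt fxy] := fa (wcat w t) x; first by rewrite xt ew wcat_cat.
by exists y => //; rewrite yt ne' wcat_cat.
Qed.

Lemma rearrangement_deep f : is_rearrangement f ->
  exists k, forall e, is_edge e -> k <= size (ename e) ->
    exists e', [/\ is_edge e', ecolour e' = ecolour e,
      size (ename e) <= size (ename e') + k & canonical_on f e e'].
Proof.
move=> [_ [P [Pe Pcov _] Pf]]; pose k := \max_(a <- P) size (ename a).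
exists k => e ee ke; have [_ wfe _] := is_edge_wf ee.
have [x [rx [t xt]]] := regular_extension wfe.
have : [set: airplane] (to_airplane x) by [].
rewrite -Pcov => -[a /= aP /(regular_cell rx) xa].
have ak : size (ename a) <= k by rewrite /k; exact: leq_bigmax_seq.
have ea : ename e = ename a ++ drop (size (ename a)) (ename e).
  rewrite -[LHS](cat_take_drop (size (ename a))); congr (_ ++ _).
  rewrite -[in LHS](mkseq_wcat0 (ename e) t) -xt -mkseq_take ?xa//.
  exact: leq_trans ke.
have [a' [a'e ca' fa]] := Pf _ aP.
have [e' [ee' ce' ne' fe]] := canonical_cat a'e ca' (Pe _ aP) ee ea fa.
exists e'; split=> //; rewrite ne' size_cat size_drop -addnA.
apply: leq_trans (leq_addl _ _).
by rewrite addnC -leq_subLR leq_sub2l.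
Qed.

Lemma homeomorphism_comp f g : homeomorphism f -> homeomorphism g ->
  homeomorphism (f \o g).
Proof.
move=> [f' [cf cf' ff' f'f]] [g' [cg cg' gg' g'g]]; exists (g' \o f'); split.
- by move=> x; apply: continuous_comp; [exact: cg|exact: cf].
- by move=> x; apply: continuous_comp; [exact: cf'|exact: cg'].
- exact: can_comp.
- exact: can_comp.
Qed.

Lemma rearrangement_id : is_rearrangement id.
Proof.
split; first by exists id; split=> // x; exact: cvg_id.
exists (full_expansion 0); first exact: full_expansion_partition.
move=> e /full_expansion_edge[ee _]; exists e; split=> // t x xt.
by exists x.
Qed.

Lemma rearrangement_comp f g : is_rearrangement f -> is_rearrangement g ->
  is_rearrangement (f \o g).
Proof.
move=> rf rg; have [hf _] := rf; have [hg _] := rg.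
split; first exact: homeomorphism_comp.
have [k kP] := rearrangement_deep rf; have [l lP] := rearrangement_deep rg.
exists (full_expansion (k + l)); first exact: full_expansion_partition.
move=> e /full_expansion_edge[ee se].
have [||e1 [ee1 ce1 se1 ge]] := lP e => //.
  by rewrite se leqW// leq_addl.
have [||e2 [ee2 ce2 se2 fe]] := kP e1 => //.
  by move: se1; rewrite se -addSn leq_add2r; exact: ltnW.
exists e2; split=> //; first by rewrite ce2.
by move=> t x /ge[y yt gx] /=; rewrite gx; exact: fe yt.
Qed.

Lemma rearrangement_inv f g : is_rearrangement f -> cancel f g -> cancel g f ->
  is_rearrangement g.
Proof.
move=> [[g' [cf cg' fg' g'f]] [P [Pe Pcov Pdis] Pf]] fg gf.
have gg' : g = g' by apply/funext => x; rewrite -{1}[x]g'f fg.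
subst g'; split; first by exists f.
have /choice[sel selP] e : exists e', e \in P ->
    [/\ is_edge e', ecolour e' = ecolour e & canonical_on f e e'].
  by case: (boolP (e \in P)) => [/Pf[e' He']|_]; [exists e'|exists e].
have canV e : e \in P -> canonical_on g (sel e) e.
  move=> eP t y yt; have [/is_edge_wf[s0 _ cs] ce fe] := selP _ eP.
  have [e0 wfe cce] := is_edge_wf (Pe _ eP).
  have Ox : Omega (wcat (ename e) t).
    apply/(wcat_Omega _ e0); split=> // n.
    have := OmegaE y; rewrite yt => /(wcat_Omega _ s0)[_ /(_ n)].
    by rewrite (@path_follows _ (last e_L (ename e)))// -cs -cce.
  exists (mkOmega Ox) => //; have [y' y't fx] := fe t (mkOmega Ox) erefl.
  by rewrite (_ : y = y') -?fx ?fg//; apply: Omega_inj; rewrite yt y't.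
have celV e : e \in P -> cell (sel e) `<=` g @^-1` (cell e).
  by move=> eP _ [y [t yt] <-] /=; have [x xt ->] := canV _ eP t y yt; exists x => //; exists t.
have intV e : e \in P -> (cell (sel e))^° `<=` g @^-1` ((cell e)^°).
  move=> eP p; rewrite /interior /= => pe.
  have : nbhs (g p) (f @^-1` (cell (sel e))) by apply: cf; rewrite gf.
  by apply: filterS => q /(celV _ eP); rewrite /= fg.
exists (map sel P); last first.
  move=> _ /mapP[e eP ->]; exists e; have [_ ce _] := selP _ eP.
  by split=> //; [exact: Pe|exact: canV].
split.
- by move=> _ /mapP[e /selP[] ? _ _ ->].
- apply/seteqP; split=> // p _; have : [set: airplane] (g p) by [].
  rewrite -Pcov => -[e /= eP [x [t xt] xp]].
  exists (sel e); first exact: map_f.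
  have [_ _ /(_ t x xt)[y yt fx]] := selP _ eP.
  by exists y; [exists t|rewrite -fx xp gf].
- move=> _ _ /mapP[e eP ->] /mapP[e' e'P ->] ee'.
  apply/seteqP; split=> // p [/(intV _ eP) pe /(intV _ e'P) pe'].
  have : e != e' by apply: contraNneq ee' => ->.
  by move=> /(Pdis _ _ eP e'P) E; have : set0 (g p) by rewrite -E.
Qed.

Definition rearrangement : Type :=
  {f : airplane -> airplane | `[< is_rearrangement f >]}.

HB.instance Definition _ := SubType.on rearrangement.
HB.instance Definition _ := Choice.on rearrangement.

Lemma rearrangementP (f : rearrangement) : is_rearrangement (val f).
Proof. by case: f => f /= /asboolP. Qed.

Definition mkRearrangement f (rf : is_rearrangement f) : rearrangement :=
  exist _ f (asboolT rf).

Definition rearrangement_one := mkRearrangement rearrangement_id.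

Definition rearrangement_mul (f g : rearrangement) : rearrangement :=
  mkRearrangement (rearrangement_comp (rearrangementP f) (rearrangementP g)).

Lemma rearrangement_inverse (f : rearrangement) :
  {g : rearrangement | cancel (val f) (val g) /\ cancel (val g) (val f)}.
Proof.
apply: cid; have rf := rearrangementP f.
have [[g [_ _ fg gf]] _] := rf.
by exists (mkRearrangement (rearrangement_inv rf fg gf)).
Qed.

Definition rearrangement_invg (f : rearrangement) : rearrangement :=
  projT1 (rearrangement_inverse f).

Lemma rearrangement_mulA : associative rearrangement_mul.
Proof. by move=> f g h; apply: val_inj. Qed.
Lemma rearrangement_mul1 : left_id rearrangement_one rearrangement_mul.
Proof. by move=> f; apply: val_inj. Qed.
Lemma rearrangement_1mul : right_id rearrangement_one rearrangement_mul.
Proof. by move=> f; apply: val_inj. Qed.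
Lemma rearrangement_mulV :
  left_inverse rearrangement_one rearrangement_invg rearrangement_mul.
Proof.
move=> f; apply: val_inj; apply/funext => x.
by case: (projT2 (rearrangement_inverse f)) => /(_ x).
Qed.
Lemma rearrangement_Vmul :
  right_inverse rearrangement_one rearrangement_invg rearrangement_mul.
Proof.
move=> f; apply: val_inj; apply/funext => x.
by case: (projT2 (rearrangement_inverse f)) => _ /(_ x).
Qed.

HB.instance Definition _ := isGroup.Build rearrangement
  rearrangement_mulA rearrangement_mul1 rearrangement_1mul
  rearrangement_mulV rearrangement_Vmul.

Definition T_A : groupType := rearrangement.

Local Open Scope group_scope.

Definition subgroup (G : groupType) (H : set G) : Prop :=
  [/\ H 1, forall x y, H x -> H y -> H (x * y) & forall x, H x -> H x^-1].

Definition derived (G : groupType) : set G :=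
  [set x | forall H : set G, subgroup H -> (forall a b, H [~ a, b]) -> H x].

Definition left_cosets (G : groupType) (H : set G) : set (set G) :=
  [set [set x * h | h in H] | x in [set: G]].

Section Abelianization.
Variable G : groupType.
Implicit Types x y z : G.

Lemma derived_subgroup : subgroup (@derived G).
Proof.
split=> [H []//|x y Dx Dy H sH cH|x Dx H sH cH].
  by case: (sH) => _ + _; apply; [exact: Dx|exact: Dy].
by case: (sH) => _ _; apply; exact: Dx.
Qed.

Lemma derived_comm x y : derived [~ x, y].
Proof. by move=> H _; apply. Qed.

Lemma derived1 : derived (1 : G). Proof. by case: derived_subgroup. Qed.
Lemma derivedM x y : derived x -> derived y -> derived (x * y).
Proof. by case: derived_subgroup => _ + _; apply. Qed.
Lemma derivedV x : derived x -> derived x^-1.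
Proof. by case: derived_subgroup => _ _; apply. Qed.

Lemma derivedJ x y : derived x -> derived (x ^ y).
Proof.
move=> Dx; have -> : x ^ y = x * [~ x, y] by rewrite commgEl mulVKg.
exact: derivedM (derived_comm _ _).
Qed.

Definition same_coset x y : bool := `[< derived (x^-1 * y) >].

Lemma same_coset_refl : reflexive same_coset.
Proof. by move=> x; apply/asboolP; rewrite mulVg; exact: derived1. Qed.
Lemma same_coset_sym : symmetric same_coset.
Proof.
by move=> x y; apply/asboolP/asboolP => /derivedV; rewrite invgM invgK.
Qed.
Lemma same_coset_trans : transitive same_coset.
Proof.
move=> y x z /asboolP xy /asboolP yz; apply/asboolP.
by rewrite -[z](mulVKg y) mulgA; exact: derivedM.
Qed.

Canonical same_coset_equiv :=
  EquivRel same_coset same_coset_refl same_coset_sym same_coset_trans.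

Definition abelianization : Type := {eq_quot same_coset_equiv}.

HB.instance Definition _ := Choice.on abelianization.
HB.instance Definition _ := Quotient.on abelianization.

Definition to_ab (x : G) : abelianization := \pi_{eq_quot same_coset_equiv} x.

Lemma to_abP x y : to_ab x = to_ab y <-> derived (x^-1 * y).
Proof.
split=> [xy|xy]; first by apply/asboolP; exact/(@eqmodP _ same_coset_equiv).
by apply/(@eqmodP _ same_coset_equiv)/asboolP.
Qed.

Definition ab_one : abelianization := to_ab 1.
Definition ab_mul (a b : abelianization) : abelianization :=
  to_ab (repr a * repr b).
Definition ab_inv (a : abelianization) : abelianization := to_ab (repr a)^-1.

Lemma reprK_ab a : to_ab (repr a) = a. Proof. exact: reprK. Qed.

Lemma repr_to_ab x : derived ((repr (to_ab x))^-1 * x).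
Proof. by apply/to_abP; rewrite reprK_ab. Qed.

Lemma to_abM x y : to_ab (x * y) = ab_mul (to_ab x) (to_ab y).
Proof.
rewrite /ab_mul; apply/esym/to_abP.
have Dx := repr_to_ab x; have Dy := repr_to_ab y.
set x' := repr (to_ab x) in Dx *; set y' := repr (to_ab y) in Dy *.
have -> : (x' * y')^-1 * (x * y) = (x'^-1 * x) ^ y' * (y'^-1 * y).
  by rewrite /conjg invgM !mulgA mulgK.
by apply: derivedM => //; exact: derivedJ.
Qed.

Lemma to_abV x : to_ab x^-1 = ab_inv (to_ab x).
Proof.
rewrite /ab_inv; apply/to_abP; rewrite invgK.
have /derivedJ - /(_ x^-1) := repr_to_ab x.
by rewrite /conjg invgK mulgK.
Qed.

Lemma ab_ind (P : abelianization -> Prop) : (forall x, P (to_ab x)) -> forall a, P a.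
Proof. by move=> H a; rewrite -[a]reprK_ab. Qed.

Lemma ab_mulA : associative ab_mul.
Proof.
elim/ab_ind => x; elim/ab_ind => y; elim/ab_ind => z.
by rewrite -!to_abM mulgA.
Qed.
Lemma ab_mul1 : left_id ab_one ab_mul.
Proof. by elim/ab_ind => x; rewrite -to_abM mul1g. Qed.
Lemma ab_1mul : right_id ab_one ab_mul.
Proof. by elim/ab_ind => x; rewrite -to_abM mulg1. Qed.
Lemma ab_mulV : left_inverse ab_one ab_inv ab_mul.
Proof. by elim/ab_ind => x; rewrite -to_abV -to_abM mulVg. Qed.
Lemma ab_Vmul : right_inverse ab_one ab_inv ab_mul.
Proof. by elim/ab_ind => x; rewrite -to_abV -to_abM mulgV. Qed.

HB.instance Definition _ := isGroup.Build abelianization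
  ab_mulA ab_mul1 ab_1mul ab_mulV ab_Vmul.

End Abelianization.

Definition infinite_cyclic (G : groupType) : Prop :=
  exists2 phi : int -> G, bijective phi &
    {morph phi : m n / (m + n)%R >-> m * n}.

(* Main.v *)
Require Import Defs.
From mathcomp Require Import all_boot ssralg ssrint all_classical topology.

Set Implicit Arguments.
Unset Strict Implicit.
Unset Printing Implicit Defensive.

(** Call a point of the airplane extremal if it is an end of only one edge, as
    [v_l], [v_r] and the vertices [v_w _] are. Near an extremal point a
    rearrangement is a canonical map from the cell of a word [q b_p ... b_p] to
    that of a word [q' b_p ... b_p], where [q] and [q'] name the largest blue edges
    ending at the point and at its image. The difference of the two numbers of
    letters [b_p] depends on the point only: it is the logarithm of a derivative.
    It obeys the chain rule, and it is zero at all but finitely many extremal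
    points, so its sum over all of them ([total_slope]) is a homomorphism to the
    integers, with value 1 on a suitable rearrangement [y]
    ([total_slope_segment_p]). The theorem follows once its kernel is known to be
    the derived subgroup, and this is the case because a subgroup [N] containing
    [y] and all commutators is everything ([generation]).

    Thompson's group F acts on every red edge, on the path between the ends of
    every blue edge, and, for a blue edge with an extremal end, on its circle cut
    open at the vertex opposite to that end.
    Write [x_e], [y_e], [z_e] for the standard generator of F in these actions
    ([arc_table], [segment_table], [circle_table]). A rearrangement carrying the
    cell of [e] canonically to that of [e'] conjugates [x_e] to [x_e'], and up to
    such maps there is one red edge and there are three blue ones, the whole
    airplane included ([similar_words]). The pentagon relation in F says that the
    square of a generator at an interval is the product of the generators at its
    second half, at the interval and at its first half. For red edges the three
    are conjugate, so that the relation reads 2x = 3x modulo commutators, whence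
    [x_e] is in [N]. The halves of a circle are red edges, which gives
    z + z = x + z + x and puts [z_e] in [N]. For a blue edge the first half is
    traversed backwards, so the relation is 2y = y'' + y - y', and it reduces the
    three classes of the [y_e] to [y]. Finally the reversal of the airplane, rho,
    satisfies rho^2 = 1 = (rho z)^3.

    Given these elements, any rearrangement [f] can be simplified until it is the
    identity or rho. On some finite list of cells forming a subdivision of the
    airplane, [f] is canonical. Such a subdivision contains all the children of some
    edge [p]. As [f] preserves adjacency, the images of these children meet each
    other in the same pattern, and the words that name edges at a given vertex can
    be listed ([red_tgt], [red_src], [blue_src], [blue_tgt]); one sees that finitely
    many moves by the [x_e], [y_e], [z_e] make the images the children of one edge
    [q] ([red_caret], [blue_caret]). Then [f] is canonical on the cell of [p], and
    the subdivision can be replaced by a shorter one. *)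

(** * Words and their end vertices *)

Notation word := (seq letter).
Notation stream := (nat -> letter).

(** Words are relative to a virtual blue edge, the empty word, whose
    replacement is the base graph: [e_L], [e_R], [e_U], [e_D] are its four
    children [b_m], [b_p], [b_u], [b_d], and [v_l], [v_r] its two ends. *)
Definition good (w : word) : bool := path follows b_p w.

Definition col (w : word) : colour := letter_colour (last b_p w).

Definition child_ends (w : word) (st : vertex * vertex) (x : letter) :=
  match x with
  | r_1 => (st.1, v_m w) | r_2 => (v_m w, st.2) | r_s => (v_m w, v_w w)
  | b_m => (v_x w, st.1) | b_p => (v_y w, st.2)
  | b_u => (v_y w, v_x w) | b_d => (v_x w, v_y w)
  | _ => st
  end.

Fixpoint ends_from (w : word) (st : vertex * vertex) (a : word) :=
  if a is x :: a' then ends_from (rcons w x) (child_ends w st x) a' else st.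

(** The source ([false]) or target ([true]) of the edge named by a word. *)
Definition vend (w : word) (al : bool) : vertex :=
  let st := ends_from [::] (v_l, v_r) w in if al then st.2 else st.1.

Arguments vend : simpl never.

Definition has_end (V : vertex) (w : word) : Prop := exists al, vend w al = V.

Lemma ends_from_cat w st a b :
  ends_from w st (a ++ b) = ends_from (w ++ a) (ends_from w st a) b.
Proof.
elim: a w st => [|x a IH] w st /=; first by rewrite cats0.
by rewrite IH cat_rcons.
Qed.

Lemma vend_rcons w x al : vend (rcons w x) al =
  let st := child_ends w (vend w false, vend w true) x in
  if al then st.2 else st.1.
Proof. by rewrite /vend -cats1 ends_from_cat /= -surjective_pairing. Qed.

Lemma good_rcons w x : good (rcons w x) = good w && follows (last b_p w) x.
Proof. by rewrite /good rcons_path. Qed.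

Lemma good_cat u a : good (u ++ a) = good u && path follows (last b_p u) a.
Proof. by rewrite /good cat_path. Qed.

Lemma good_catl u a : good (u ++ a) -> good u.
Proof. by rewrite good_cat => /andP[]. Qed.

Lemma good_cat_col u v a : good u -> good v -> col u = col v ->
  good (u ++ a) -> good (v ++ a).
Proof.
by move=> _ gv uv; rewrite !good_cat gv => /andP[_]; rewrite (path_follows _ uv).
Qed.

Lemma col_cat_cons u x a : col (u ++ x :: a) = letter_colour (last x a).
Proof. by rewrite /col last_cat. Qed.

(** The edge whose replacement introduced the vertex; none for the ends of the virtual edge. *)
Definition creator (V : vertex) : option word :=
  match V with v_m w | v_w w | v_x w | v_y w => Some w | _ => None end.

(** The vertices of an edge are older than the edge. *)
Lemma vend_creator w al q : creator (vend w al) = Some q -> size q < size w.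
Proof.
elim/last_ind: w al q => [|w x IH] al q; first by case: al.
rewrite vend_rcons size_rcons ltnS.
have old be : creator (vend w be) = Some q -> size q <= size w by move=> /IH H; exact: ltnW.
by case: x; case: al => /=; try exact: old; move=> [<-].
Qed.

Lemma vend_neq w : vend w false <> vend w true.
Proof.
elim/last_ind: w => [|w x IH] //; rewrite !vend_rcons.
have new V al : creator V = Some w -> V <> vend w al.
  by move=> Vw E; have := @vend_creator w al w; rewrite -E Vw ltnn => /(_ erefl).
have new' V al : creator V = Some w -> vend w al <> V by move=> /new H /esym /H.
by case: x => //=; try exact: new; exact: new'.
Qed.

Lemma vend_inj w al be : vend w al = vend w be -> al = be.
Proof. by have := @vend_neq w; case: al; case: be => // H E; case: H. Qed.

(** The only child of an edge of colour [c] that keeps its end [al]; that end is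
    the end [kept_end c al] of the child. *)
Definition kept_letter (c : colour) (al : bool) : letter :=
  match c with Red => if al then r_2 else r_1 | Blue => if al then b_p else b_m end.
Definition kept_end (c : colour) (al : bool) : bool :=
  match c with Red => al | Blue => true end.

Lemma kept_letter_colour c al : letter_colour (kept_letter c al) = c.
Proof. by case: c; case: al. Qed.

Lemma follows_kept_letter x al : follows x (kept_letter (letter_colour x) al).
Proof. by rewrite /follows; case: letter_colour; case: al. Qed.

Lemma good_kept_letter w al : good w -> good (rcons w (kept_letter (col w) al)).
Proof. by move=> gw; rewrite good_rcons gw follows_kept_letter. Qed.

Lemma col_rcons w x : col (rcons w x) = letter_colour x.
Proof. by rewrite /col last_rcons. Qed.

Lemma vend_kept_letter w al : vend (rcons w (kept_letter (col w) al)) (kept_end (col w) al)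
  = vend w al.
Proof. by rewrite vend_rcons; case: (col w); case: al. Qed.

Lemma vend_new w be V : creator V = Some w -> V <> vend w be.
Proof.
by move=> Vw E; have := @vend_creator w be w; rewrite -E Vw ltnn => /(_ erefl).
Qed.

Lemma vend_child w x be : vend (rcons w x) be = vend w false \/
  vend (rcons w x) be = vend w true \/ creator (vend (rcons w x) be) = Some w.
Proof. by rewrite vend_rcons; case: x; case: be => /=; auto. Qed.

Lemma has_end_kept_letter w x al : good (rcons w x) -> has_end (vend w al) (rcons w x) ->
  x = kept_letter (col w) al.
Proof.
rewrite good_rcons => /andP[_ fx] [be].
have new V : creator V = Some w -> V = vend w al -> x = kept_letter (col w) al.
  by move=> Vw /(vend_new Vw).
have old ga : x = kept_letter (col w) ga -> vend w ga = vend w al -> x = kept_letter (col w) al.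
  by move=> -> /vend_inj ->.
rewrite vend_rcons; move: fx; rewrite /follows /kept_letter -/(col w) in old new *.
by case: (col w) old new => old new; case: x old new => //= old new _; case: be;
  try exact: new; try exact: (old true); exact: (old false).
Qed.

(** An end of an edge that is also an end of a child is the only such end: each
    child gets at least one new vertex. *)
Lemma has_end_uniq w x V V' : good (rcons w x) ->
  has_end V w -> has_end V (rcons w x) ->
  has_end V' w -> has_end V' (rcons w x) -> V = V'.
Proof.
move=> gx [al <-] /(has_end_kept_letter gx) xal [be <-] /(has_end_kept_letter gx).
by rewrite xal; case: (col w); case: al {xal}; case: be.
Qed.

(** A new vertex belongs to one parent only, so a vertex shared by children of
    different edges is old. *)
Lemma has_end_parent w w' x x' V : size w = size w' -> w <> w' ->
  has_end V (rcons w x) -> has_end V (rcons w' x') -> has_end V w /\ has_end V w'.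
Proof.
move=> sw ww' [al Va] [be Vb].
have big v be' q : creator (vend v be') = Some q -> size v = size q -> False.
  by move=> /vend_creator + E; rewrite E ltnn.
have H v y ga : vend (rcons v y) ga = V -> has_end V v \/ creator V = Some v.
  move=> <-; case: (vend_child v y ga) => [->|[->|->]]; last by right.
    by left; exists false.
  by left; exists true.
case: (H _ _ _ Va) => [[ga1 h1]|h1]; case: (H _ _ _ Vb) => [[ga2 h2]|h2].
- by split; [exists ga1|exists ga2].
- by case: (@big w ga1 w'); rewrite // h1.
- by case: (@big w' ga2 w); rewrite // h2.
- by move: h1; rewrite h2 => -[E]; case: ww'.
Qed.

(** [u] followed by [tail (col u) al] is an address of the end [al] of [u]. *)
Definition tail (c : colour) (al : bool) : stream := fun n =>
  kept_letter c (iter n (kept_end c) al).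

Lemma iter_kept_end c al n : iter n.+1 (kept_end c) al = iter n (kept_end c) (kept_end c al).
Proof. by rewrite iterSr. Qed.

Lemma tailS c al n : tail c al n.+1 = tail c (kept_end c al) n.
Proof. by rewrite /tail iter_kept_end. Qed.

Lemma mkseq_tailS c al n : mkseq (tail c al) n.+1 = kept_letter c al ::
  mkseq (tail c (kept_end c al)) n.
Proof.
rewrite /mkseq /= (iotaDl 1 0) -map_comp; congr cons.
by apply: eq_map => i /=; rewrite add1n tailS.
Qed.

Lemma good_tail_gen u al n : good u -> good (u ++ mkseq (tail (col u) al) n) /\
  vend (u ++ mkseq (tail (col u) al) n) (iter n (kept_end (col u)) al) = vend u al /\
  col (u ++ mkseq (tail (col u) al) n) = col u.
Proof.
move=> gu; elim: n => [|n [g [v c]]]; first by rewrite cats0.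
rewrite mkseqS -rcons_cat; set w := u ++ _ in g v c *.
rewrite /tail -c; split; first exact: good_kept_letter.
split; last by rewrite col_rcons kept_letter_colour.
by rewrite iterS vend_kept_letter c.
Qed.

Lemma good_tail u al n : good u -> good (u ++ mkseq (tail (col u) al) n).
Proof. by move=> /(good_tail_gen al n)[]. Qed.

Lemma has_end_tail u al n : good u ->
  has_end (vend u al) (u ++ mkseq (tail (col u) al) n).
Proof. by move=> /(good_tail_gen al n)[_ [v _]]; eexists; exact: v. Qed.

(** ** Relative ends *)

(** The ends of [u ++ a] are those of [a], read with [u] in place of the empty word. *)
Definition place (u : word) (V : vertex) : vertex :=
  match V with
  | v_l => vend u false | v_r => vend u true
  | v_m a => v_m (u ++ a) | v_w a => v_w (u ++ a)
  | v_x a => v_x (u ++ a) | v_y a => v_y (u ++ a)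
  | V => V
  end.

Lemma vend_place u a al : vend (u ++ a) al = place u (vend a al).
Proof.
elim/last_ind: a al => [|a x IH] al; first by rewrite cats0; case: al.
rewrite -rcons_cat !vend_rcons.
by case: x; case: al => /=; rewrite ?IH.
Qed.

(** The base graph is read as the replacement of the empty word, whose new vertices
    are [v_x [::]] and [v_y [::]] instead of [v_a] and [v_b]. *)
Lemma vend_ab w al : vend w al <> v_a /\ vend w al <> v_b.
Proof.
elim/last_ind: w al => [|w x IH] al; first by case: al.
by rewrite vend_rcons; case: x; case: al => /=.
Qed.

Lemma cat_inj (u a b : word) : u ++ a = u ++ b -> a = b.
Proof. by elim: u => //= x u IH [/IH]. Qed.

(** The vertices created below [u] are different from the ends of [u], which are
    different from each other. *)
Lemma place_inj u a b al be :
  place u (vend a al) = place u (vend b be) -> vend a al = vend b be.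
Proof.
have big ga c : v_m (u ++ c) <> vend u ga /\ v_w (u ++ c) <> vend u ga /\
    v_x (u ++ c) <> vend u ga /\ v_y (u ++ c) <> vend u ga.
  have H V : creator V = Some (u ++ c) -> V <> vend u ga.
    move=> Vt E; have := @vend_creator u ga (u ++ c); rewrite -E Vt size_cat => /(_ erefl).
    by rewrite ltnNge leq_addr.
  by do !split; apply: H.
have [a1 a2] := vend_ab a al; have [b1 b2] := vend_ab b be.
case: (vend a al) a1 a2 => [||||c|c|c|c] a1 a2 //;
 case: (vend b be) b1 b2 => [||||d|d|d|d] b1 b2 //=.
all: try by move=> /vend_inj.
all: try by move=> [/cat_inj ->].
all: try by have [? [? [? ?]]] := big true c; have [? [? [? ?]]] := big false c.
all: by have [? [? [? ?]]] := big true d; have [? [? [? ?]]] := big false d => /esym.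
Qed.

(** * Points of the airplane as infinite relative words *)

Definition children (c : colour) : seq letter :=
  match c with Red => [:: r_1; r_2; r_s] | Blue => [:: b_m; b_p; b_u; b_d] end.

Fixpoint words (n : nat) : seq word :=
  if n is n'.+1 then [seq rcons w x | w <- words n', x <- children (col w)]
  else [:: [::]].

Lemma mem_children c x : (x \in children c) = follows (kept_letter c true) x.
Proof. by case: c; case: x. Qed.

Lemma follows_col w x : follows (last b_p w) x = (x \in children (col w)).
Proof. by rewrite mem_children /follows kept_letter_colour. Qed.

Lemma mem_words n w : (w \in words n) = good w && (size w == n).
Proof.
elim: n w => [|n IH] w; first by rewrite inE andbC; case: w.
apply/allpairsPdep/andP => [[v [x [+ xv ->]]]|].
  by rewrite IH good_rcons size_rcons follows_col xv eqSS => /andP[-> ->].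
case/lastP: w => [[]//|w x]; rewrite good_rcons follows_col size_rcons eqSS.
by move=> [/andP[gw xw] sw]; exists w, x; rewrite IH gw sw.
Qed.

(** The children of the virtual edge as they are called in the base graph. *)
Definition base_letter (x : letter) : letter :=
  match x with b_m => e_L | b_p => e_R | b_u => e_U | b_d => e_D | x => x end.
Definition letter_of_base (x : letter) : letter :=
  match x with e_L => b_m | e_R => b_p | e_U => b_u | e_D => b_d | x => x end.

Definition name_of (w : word) : word := if w is x :: w' then base_letter x :: w' else [::].

Definition vertex_of (V : vertex) : vertex :=
  match V with
  | v_x [::] => v_a | v_y [::] => v_b
  | v_m w => v_m (name_of w) | v_w w => v_w (name_of w)
  | v_x w => v_x (name_of w) | v_y w => v_y (name_of w)
  | V => V
  end.

Definition edge_of (w : word) : edge :=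
  Edge (name_of w) (col w) (vertex_of (vend w false)) (vertex_of (vend w true)).

Lemma name_of_rcons w x : w != [::] -> name_of (rcons w x) = rcons (name_of w) x.
Proof. by case: w. Qed.

Lemma size_name_of w : size (name_of w) = size w. Proof. by case: w. Qed.

Lemma replacement_edge_of w : w != [::] ->
  replacement (edge_of w) = [seq edge_of (rcons w x) | x <- children (col w)].
Proof.
move=> w0; have E x : edge_of (rcons w x) = Edge (rcons (name_of w) x) (letter_colour x)
    (vertex_of (vend (rcons w x) false)) (vertex_of (vend (rcons w x) true)).
  by rewrite /edge_of name_of_rcons// col_rcons.
by rewrite [edge_of w]/edge_of; case: (col w); rewrite /= !E !vend_rcons;
  case: (w) w0.
Qed.

Lemma full_expansion_words n : full_expansion n = [seq edge_of w | w <- words n.+1].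
Proof.
elim: n => [//|n IH].
rewrite [LHS]/= -/(full_expansion n) IH.
rewrite [words n.+2]/= map_flatten -!map_comp; congr flatten.
apply/eq_in_map => w; rewrite mem_words => /andP[_ /eqP sw].
rewrite [LHS](replacement_edge_of (w := w)); last by case: w sw.
by rewrite /comp -map_comp.
Qed.

Lemma base_letter_inj x y : x \in children Blue -> y \in children Blue ->
  base_letter x = base_letter y -> x = y.
Proof. by case: x => // _; case: y. Qed.

Lemma good_cons x w : good (x :: w) = (x \in children Blue) && path follows x w.
Proof. by rewrite mem_children /good. Qed.

Lemma name_of_inj w w' : good w -> good w' -> name_of w = name_of w' -> w = w'.
Proof.
case: w => [|x w]; case: w' => [|x' w'] //.
rewrite !good_cons => /andP[x1 _] /andP[x'1 _] [E ->].
by rewrite (base_letter_inj x1 x'1 E).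
Qed.

Lemma vend_creator_good w al q : good w -> creator (vend w al) = Some q -> good q.
Proof.
elim/last_ind: w al q => [|w x IH] al q; first by case: al.
rewrite good_rcons vend_rcons => /andP[gw _].
have old be : creator (vend w be) = Some q -> good q by exact: IH.
by case: x; case: al => /=; try exact: old; move=> [<-].
Qed.

Lemma vertex_of_inj w w' al be : good w -> good w' ->
  vertex_of (vend w al) = vertex_of (vend w' be) -> vend w al = vend w' be.
Proof.
move=> gw gw'; have [a1 a2] := vend_ab w al; have [b1 b2] := vend_ab w' be.
have tg := vend_creator_good (al := al) gw; have tg' := vend_creator_good (al := be) gw'.
case: (vend w al) a1 a2 tg => [||||c|c|c|c] a1 a2 tg //;
 case: (vend w' be) b1 b2 tg' => [||||d|d|d|d] b1 b2 tg' //=.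
all: clear a1 a2 b1 b2.
all: try by case: c tg.
all: try by case: d tg'.
all: try by move=> [E]; congr (_ _); apply: name_of_inj E; [exact: tg|exact: tg'].
all: case: c d tg tg' => [|x c] [|y d] tg tg' //.
all: try by case: d {tg'}.
all: try by case: c {tg}.
all: by case=> E1 E2; congr (_ _); apply: name_of_inj; [exact: tg|exact: tg'|rewrite /= E1 E2].
Qed.

Definition address (t : stream) : Prop := forall n, good (mkseq t n).

Definition headS (f : letter -> letter) (t : stream) : stream :=
  fun n => if n == 0 then f (t n) else t n.

Lemma mkseq_headS f t n :
  mkseq (headS f t) n.+1 = f (t 0) :: behead (mkseq t n.+1).
Proof.
rewrite /mkseq /=; congr cons; rewrite (iotaDl 1 0) -!map_comp.
by apply: eq_map => i.
Qed.

Lemma mkseq_baseS t n : mkseq (headS base_letter t) n = name_of (mkseq t n).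
Proof. by case: n => [//|n]; rewrite mkseq_headS. Qed.

Lemma wf_name_of w : w != [::] -> good w -> wf (name_of w).
Proof.
case: w => [//|x w] _; rewrite good_cons => /andP[].
have xr : letter_colour x = letter_colour (base_letter x) by case: (x).
by rewrite (path_follows w xr); case: x {xr}.
Qed.

Lemma Omega_baseS t : address t -> Omega (headS base_letter t).
Proof. by move=> ot; apply/OmegaP => n; rewrite mkseq_baseS wf_name_of. Qed.

Lemma address_of_base (x : Omega) : address (headS letter_of_base (val x)) /\
  headS base_letter (headS letter_of_base (val x)) = val x.
Proof.
have /OmegaP Ox := OmegaE x; split.
  move=> [//|n]; have := Ox n; rewrite mkseq_headS good_cons.
  case: (mkseq _ _) (nth_mkseq e_L (val x) (ltn0Sn n)) => [//|y w] /= <-.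
  have xr : letter_colour y = letter_colour (letter_of_base y) by case: (y).
  by rewrite -(path_follows w xr); case: y {xr}.
apply/funext => -[|n] //; have := Ox 0; rewrite /headS /mkseq /=.
by case: (val x 0).
Qed.

Lemma address_tail u al : good u -> address (wcat u (tail (col u) al)).
Proof.
move=> gu n; have : good (u ++ mkseq (tail (col u) al) n) by exact: good_tail.
rewrite -mkseq_wcat; set t := wcat _ _ => g.
have /good_catl : good (mkseq t n ++ drop n (mkseq t (size u + n))); last by [].
by rewrite (@mkseq_take _ t n (size u + n)) ?leq_addl// cat_take_drop.
Qed.

Lemma wcat0 (t : stream) : wcat [::] t = t.
Proof. by apply/funext => n; rewrite /wcat ltn0 subn0. Qed.

(** Makes [pt] total. *)
Definition fixS (t : stream) : stream := if `[< address t >] then t else tail Blue true.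

Lemma address_fixS t : address (fixS t).
Proof.
rewrite /fixS; case: asboolP => // _.
by have := @address_tail [::] true erefl; rewrite wcat0.
Qed.

(** The point of the airplane with address [t] (junk if [t] is no address). *)
Definition pt (t : stream) : airplane :=
  to_airplane (mkOmega (Omega_baseS (address_fixS t))).

Lemma pt_to_airplane t (x : Omega) : address t -> val x = headS base_letter t ->
  pt t = to_airplane x.
Proof.
move=> ot xt; rewrite /pt; congr to_airplane; apply: Omega_inj => /=.
by rewrite xt /fixS; case: asboolP.
Qed.

Lemma pt_surj a : exists2 t, address t & a = pt t.
Proof.
have [x ->] := to_airplane_surj a; have [ot tx] := address_of_base x.
by exists (headS letter_of_base (val x)) => //; rewrite (pt_to_airplane ot (esym tx)).
Qed.

Definition shares (w w' : word) : Prop := exists2 V, has_end V w & has_end V w'.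

Lemma ends_edge_of w V : V \in ends (edge_of w) <-> exists al, V = vertex_of (vend w al).
Proof.
rewrite /ends !inE; split=> [/orP[] /eqP ->|[[] ->]]; first by exists false.
- by exists true.
- by rewrite eqxx orbT.
- by rewrite eqxx.
Qed.

Lemma share_edge_of w w' : good w -> good w' ->
  share_vertex (edge_of w) (edge_of w') <-> shares w w'.
Proof.
move=> gw gw'; split=> [[V /ends_edge_of[al ->] /ends_edge_of[be]]|[V [al <-] [be E]]].
  by move=> /vertex_of_inj => /(_ gw gw') E; exists (vend w al); [exists al|exists be].
exists (vertex_of (vend w al)); first by apply/ends_edge_of; exists al.
by apply/ends_edge_of; exists be; rewrite E.
Qed.

Lemma pt_shares t t' : address t -> address t' ->
  pt t = pt t' <-> forall n, shares (mkseq t n) (mkseq t' n).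
Proof.
move=> ot ot'; rewrite (pt_to_airplane (x := mkOmega (Omega_baseS ot)) ot erefl).
rewrite (pt_to_airplane (x := mkOmega (Omega_baseS ot')) ot' erefl).
rewrite to_airplane_glued.
have edge w n e : address w -> e \in full_expansion n ->
  ename e = mkseq (headS base_letter w) n.+1 ->
    e = edge_of (mkseq w n.+1).
  move=> ow; rewrite full_expansion_words => /mapP[v].
  rewrite mem_words => /andP[gv /eqP sv] -> /=; rewrite mkseq_baseS => /name_of_inj ->//.
have edge' w n : address w -> edge_of (mkseq w n.+1) \in full_expansion n /\
    ename (edge_of (mkseq w n.+1)) = mkseq (headS base_letter w) n.+1.
  move=> ow; split; last by rewrite mkseq_baseS.
  by rewrite full_expansion_words; apply: map_f; rewrite mem_words ow size_mkseq eqxx.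
split=> [H [|n]|H n].
- by exists v_l; exists false.
- have [e [f [[e1 e2] [f1 f2]]]] := H n.
  by rewrite (edge t n e)// (edge t' n f)// share_edge_of.
- exists (edge_of (mkseq t n.+1)), (edge_of (mkseq t' n.+1)).
  by split; [exact: edge'|exact: edge'|apply/share_edge_of].
Qed.

(** ** Points and vertices *)

Lemma shares_refl w : shares w w.
Proof. by exists (vend w false); exists false. Qed.

Lemma has_end_prefix t t' m n V : mkseq t m <> mkseq t' m -> m <= n ->
  has_end V (mkseq t n) -> has_end V (mkseq t' n) ->
  has_end V (mkseq t m) /\ has_end V (mkseq t' m).
Proof.
move=> tt'; elim: n => [|n IH]; first by rewrite leqn0 => /eqP ->.
rewrite leq_eqVlt => /orP[/eqP -> //|]; rewrite ltnS => mn.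
rewrite !mkseqS => /has_end_parent H /H [||h h']; rewrite ?size_mkseq//.
  by move=> E; apply: tt'; rewrite !(mkseq_take _ mn) E.
exact: IH.
Qed.

(** Once two addresses of a point have split, a vertex shared by their prefixes is
    also shared by the prefixes one letter shorter, and an edge has only one vertex in
    common with a child; so the shared vertex is always the same. *)
Lemma glued_vertex t t' n : address t -> address t' -> pt t = pt t' ->
  mkseq t n <> mkseq t' n ->
  exists V, forall m, n <= m -> has_end V (mkseq t m) /\ has_end V (mkseq t' m).
Proof.
move=> ot ot' /(pt_shares ot ot') sh ntt'.
have dif m : n <= m -> mkseq t m <> mkseq t' m.
  by move=> nm E; apply: ntt'; rewrite !(mkseq_take _ nm) E.
have [V Vt Vt'] := sh n.+1; exists V.
suff H m : n <= m -> has_end V (mkseq t m) /\ has_end V (mkseq t' m) /\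
    has_end V (mkseq t m.+1) by move=> m /H[? []].
elim: m => [|m IH].
  rewrite leqn0 => /eqP n0; subst n.
  by have [] := has_end_prefix (@dif 0 isT) (leqnSn 0) Vt Vt'.
rewrite leq_eqVlt => /orP[/eqP nm|].
  subst n; have [h1 h2] := has_end_prefix (@dif _ (leqnn _)) (leqnSn _) Vt Vt'.
  by [].
rewrite ltnS => nm; have [h1 [h2 h3]] := IH nm.
have [W Wt Wt'] := sh m.+2.
have [W1 W1'] := has_end_prefix (@dif _ (leqW nm)) (leqnSn _) Wt Wt'.
have [W2 W2'] := has_end_prefix (@dif _ nm) (leqW (leqnSn _)) Wt Wt'.
suff -> : V = W by [].
by apply: (@has_end_uniq (mkseq t m) (t m)) => //; rewrite -?mkseqS//; exact: ot.
Qed.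

(** Prefixes shorter than [n] either agree or share a vertex because the longer ones do. *)
Lemma vertex_glued t t' n V : address t -> address t' ->
  (forall m, n <= m -> has_end V (mkseq t m) /\ has_end V (mkseq t' m)) -> pt t = pt t'.
Proof.
move=> ot ot' H; apply/(pt_shares ot ot') => m.
have [nm|mn] := leqP n m; first by have [] := H m nm; exists V.
have [->|tt'] := eqVneq (mkseq t m) (mkseq t' m); first exact: shares_refl.
have [Vt Vt'] := H n (leqnn n).
by have [] := has_end_prefix (elimN eqP tt') (ltnW mn) Vt Vt'; exists V.
Qed.

Lemma mkseq_wcat_tail u c al m : size u <= m ->
  mkseq (wcat u (tail c al)) m = u ++ mkseq (tail c al) (m - size u).
Proof. by move=> um; rewrite -{1}(subnKC um) mkseq_wcat. Qed.

Lemma has_end_wcat_tail u al m : good u -> size u <= m ->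
  has_end (vend u al) (mkseq (wcat u (tail (col u) al)) m).
Proof. by move=> gu um; rewrite mkseq_wcat_tail//; exact: has_end_tail. Qed.

Lemma has_end_eventually_uniq t n V V' : address t ->
  (forall m, n <= m -> has_end V (mkseq t m)) ->
  (forall m, n <= m -> has_end V' (mkseq t m)) -> V = V'.
Proof.
move=> ot h h'; apply: (@has_end_uniq (mkseq t n) (t n)); rewrite -?mkseqS.
- exact: ot.
- exact: h.
- by apply: h; exact: leqnSn.
- exact: h'.
- by apply: h'; exact: leqnSn.
Qed.

Lemma stream_neq (t t' : stream) : t <> t' -> exists n, mkseq t n <> mkseq t' n.
Proof.
move=> tt'; apply: contrapT => /forallNP H; apply: tt'; apply/funext => n.
have /contrapT /(congr1 (nth e_L ^~ n)) := H n.+1.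
by rewrite !nth_mkseq.
Qed.

Definition end_pt (u : word) (al : bool) : airplane := pt (wcat u (tail (col u) al)).

(** Two addresses of one point that eventually leave through ends of [u] and [v] share
    a vertex forever, and that vertex can only be the end of each. *)
Lemma end_ptP u v al be : good u -> good v ->
  end_pt u al = end_pt v be <-> vend u al = vend v be.
Proof.
move=> gu gv; have ou := address_tail al gu; have ov := address_tail be gv.
set M := maxn (size u) (size v).
have uM : size u <= M by exact: leq_maxl.
have vM : size v <= M by exact: leq_maxr.
split=> [E|E]; last first.
  apply: (vertex_glued (n := M) (V := vend u al)) => // m Mm; split.
    by apply: has_end_wcat_tail => //; exact: leq_trans Mm.
  by rewrite E; apply: has_end_wcat_tail => //; exact: leq_trans Mm.
have Hu m : M <= m -> has_end (vend u al) (mkseq (wcat u (tail (col u) al)) m).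
  by move=> Mm; apply: has_end_wcat_tail => //; exact: leq_trans Mm.
have Hv m : M <= m -> has_end (vend v be) (mkseq (wcat v (tail (col v) be)) m).
  by move=> Mm; apply: has_end_wcat_tail => //; exact: leq_trans Mm.
have [tt|tt] := pselect (wcat u (tail (col u) al) = wcat v (tail (col v) be)).
  by apply: (has_end_eventually_uniq (n := M) ou) => // m Mm; rewrite tt; exact: Hv.
have [n nn] := stream_neq tt.
have [V HV] := glued_vertex ou ov E nn.
have h m : maxn n M <= m -> n <= m /\ M <= m by rewrite geq_max => /andP[].
rewrite (has_end_eventually_uniq (n := maxn n M) (V := vend u al) (V' := V) ou) =>
  [|m /h[_ ?]|m /h[nm _]].
- by apply: (has_end_eventually_uniq (n := maxn n M) ov) => m /h[nm Mm];
  [have [] := HV m nm|exact: Hv].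
- exact: Hu.
- by have [] := HV m nm.
Qed.

(** * Canonical maps between cells, up to reversal *)

(** Exchanging [b_m] with [b_p] and [b_u] with [b_d] in the first letter reverses a
    blue cell: this is an automorphism of the graph replacing a blue edge. *)
Definition flip (b : bool) (x : letter) : letter :=
  if b then match x with b_m => b_p | b_p => b_m | b_u => b_d | b_d => b_u | x => x end
  else x.

Definition flipw (b : bool) (w : word) : word :=
  if w is x :: w' then flip b x :: w' else [::].

Definition flipS (b : bool) (t : stream) : stream := headS (flip b) t.

Lemma flip_colour b x : letter_colour (flip b x) = letter_colour x.
Proof. by case: b; case: x. Qed.

Lemma flip_flip b b' x : flip b (flip b' x) = flip (b (+) b') x.
Proof. by case: b; case: b'; case: x. Qed.

Lemma follows_flip x y b : follows x (flip b y) = follows x y.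
Proof. by case: b; rewrite /follows; case: letter_colour; case: y. Qed.

Lemma flipS_false t : flipS false t = t.
Proof. by apply/funext => -[]. Qed.

Lemma flipS_flipS b b' t : flipS b (flipS b' t) = flipS (b (+) b') t.
Proof. by apply/funext => -[|n] //=; rewrite /flipS /headS /= flip_flip. Qed.

Lemma flipw_false w : flipw false w = w. Proof. by case: w. Qed.

Lemma flipS_wcat b a t : a != [::] -> flipS b (wcat a t) = wcat (flipw b a) t.
Proof. by case: a => // x a _; apply/funext => -[|n]. Qed.

(** Reversal exchanges the two ends of a blue cell. *)
Lemma flipS_tail (b : bool) c al : (b -> c = Blue) -> flipS b (tail c al) = tail c (al (+) b).
Proof.
case: b => [/(_ isT) ->|_]; last by rewrite flipS_false addbF.
apply/funext => -[|n]; first by case: al.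
by change (tail Blue al n.+1 = tail Blue (al (+) true) n.+1); rewrite !tailS.
Qed.

Lemma path_flipw x b a : path follows x (flipw b a) = path follows x a.
Proof.
case: a => //= y a; rewrite follows_flip (@path_follows (flip b y) y)//.
exact: flip_colour.
Qed.

Lemma mkseq_flipS b t n : mkseq (flipS b t) n = flipw b (mkseq t n).
Proof. by case: n => [//|n]; rewrite mkseq_headS. Qed.

Lemma address_wcat u t : address (wcat u t) <->
  good u /\ forall n, path follows (last b_p u) (mkseq t n).
Proof.
split=> [ot|[gu H] n].
  have H n : good (u ++ mkseq t n) by rewrite -mkseq_wcat.
  split; first by have := H 0; rewrite cats0.
  by move=> n; have := H n; rewrite good_cat => /andP[].
have : good (u ++ mkseq t n) by rewrite good_cat gu H.
rewrite -mkseq_wcat => g.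
have /good_catl : good (mkseq (wcat u t) n ++ drop n (mkseq (wcat u t) (size u + n))).
  by rewrite (@mkseq_take _ _ n (size u + n)) ?leq_addl// cat_take_drop.
by [].
Qed.

Lemma address_prefix u t : address (wcat u t) -> good u. Proof. by move=> /address_wcat[]. Qed.

Lemma address_move u v b t : good v -> col u = col v ->
  address (wcat u t) -> address (wcat v (flipS b t)).
Proof.
move=> gv uv /address_wcat[gu H]; apply/address_wcat; split=> // n.
by rewrite mkseq_flipS path_flipw -(path_follows _ uv).
Qed.

Lemma address_move0 u v t : good v -> col u = col v -> address (wcat u t) -> address (wcat v t).
Proof. by move=> gv uv /(address_move false gv uv); rewrite flipS_false. Qed.

Definition maps (f : airplane -> airplane) (u v : word) (b : bool) : Prop :=
  [/\ good u, good v, col u = col v, b -> col u = Blue &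
      forall t, address (wcat u t) -> f (pt (wcat u t)) = pt (wcat v (flipS b t))].

Lemma good_flipw u v b a : good v -> col u = col v ->
  good (u ++ a) -> good (v ++ flipw b a).
Proof.
by move=> gv uv; rewrite !good_cat gv path_flipw (path_follows _ uv) => /andP[].
Qed.

Lemma col_flipw u v b a : col u = col v -> col (u ++ a) = col (v ++ flipw b a).
Proof.
case: a => [|x a]; first by rewrite !cats0.
by rewrite !col_cat_cons; case: a => //=; rewrite flip_colour.
Qed.

(** Reversal only affects the first letter, so that it is invisible below the first
    level. *)
Lemma maps_ext f u v b a : maps f u v b -> good (u ++ a) -> a != [::] ->
  maps f (u ++ a) (v ++ flipw b a) false.
Proof.
move=> [gu gv uv bu H] ga a0; split=> //.
- exact: good_flipw uv ga.
- exact: col_flipw.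
- by move=> t; rewrite !wcat_cat flipS_false => /H ->; rewrite flipS_wcat.
Qed.

Lemma maps_ext0 f u v a : maps f u v false -> good (u ++ a) ->
  maps f (u ++ a) (v ++ a) false.
Proof.
move=> fuv ga; case: (eqVneq a [::]) => [->|a0]; first by rewrite !cats0.
by rewrite -{2}(flipw_false a); exact: maps_ext.
Qed.

Lemma maps_id u : good u -> maps id u u false.
Proof. by move=> gu; split=> // t _; rewrite flipS_false. Qed.

Lemma maps_comp f g u v w b b' : maps g u v b -> maps f v w b' ->
  maps (f \o g) u w (b (+) b').
Proof.
move=> [gu gv uv bu H] [_ gw vw bv H']; split=> //; first by rewrite uv.
  by case: b bu {H} => [/(_ isT)|_ /= /bv]; rewrite ?uv.
move=> t ot /=; rewrite H// H' ?flipS_flipS 1?addbC//.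
exact: address_move uv ot.
Qed.

Lemma maps_inv f g u v b : maps f u v b -> cancel f g -> maps g v u b.
Proof.
move=> [gu gv uv bu H] fg; split=> //; first by rewrite -uv.
move=> t ot; have := H (flipS b t); rewrite flipS_flipS addbb flipS_false => E.
by rewrite -E ?fg//; exact: address_move ot.
Qed.

Lemma maps_end f u v b al : maps f u v b -> f (end_pt u al) = end_pt v (al (+) b).
Proof.
move=> [gu gv uv bu H]; rewrite /end_pt H; last exact: address_tail.
by rewrite flipS_tail// uv.
Qed.

(** ** Addresses that are the only ones of their point *)

(** The letters [r_s] and [b_u] keep no vertex of the parent, while glued addresses
    keep one forever. *)
Lemma regular_pt t t' : address t -> address t' -> regular t -> pt t = pt t' -> t = t'.
Proof.
move=> ot ot' [N rt] tt'; apply/funext => n; apply: contrapT => ntt'.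
have dif : mkseq t n.+1 <> mkseq t' n.+1.
  by move=> /(congr1 (nth e_L ^~ n)); rewrite !nth_mkseq.
have [V HV] := glued_vertex ot ot' tt' dif; set m := maxn n.+1 N.
have [[al Va] _] := HV m (leq_maxl _ _).
have [Vm _] := HV m.+1 (leq_trans (leq_maxl _ _) (leqnSn _)).
have := rt m (leq_maxr _ _); rewrite (@has_end_kept_letter (mkseq t m) (t m) al).
- by case: (col _); case: al {Va}.
- by rewrite -mkseqS; exact: ot.
- by rewrite -mkseqS Va.
Qed.

Lemma address_fill u : good u -> address (wcat u (fill (col u))).
Proof. by move=> gu; apply/address_wcat; split=> // n; exact: fill_path. Qed.

Lemma regular_fill u c : regular (wcat u (fill c)).
Proof.
exists (size u) => n un; rewrite /wcat ltnNge un /= /fill.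
by case: c; case: odd; rewrite !inE eqxx ?orbT.
Qed.

Lemma regular_flip u t b : regular t -> regular (wcat u (flipS b t)).
Proof.
move=> [N rN]; exists (size u + N.+1) => n un; rewrite /wcat.
have un' : size u <= n by apply: leq_trans un; exact: leq_addr.
rewrite ltnNge un' /= /flipS /headS.
have Nn : N < n - size u by rewrite ltn_subRL -addnS.
by move: (rN _ (ltnW Nn)); case: (n - size u) Nn.
Qed.

Lemma wcat_inj u (t t' : stream) : wcat u t = wcat u t' -> t = t'.
Proof.
move=> E; apply/funext => n; have := congr1 (fun s => s (size u + n)) E.
by rewrite /wcat ltnNge leq_addr addKn.
Qed.

Lemma prefix_wcat u u' s s' : wcat u s = wcat u' s' -> size u <= size u' -> prefix u u'.
Proof.
move=> E uu'; rewrite prefixE -[X in take _ X](mkseq_wcat0 u' s').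
by rewrite -mkseq_take// -E mkseq_wcat0.
Qed.

Lemma comparable_wcat u u' s s' : wcat u s = wcat u' s' -> prefix u u' || prefix u' u.
Proof.
move=> E; have [uu'|/ltnW u'u] := leqP (size u) (size u').
  by rewrite (prefix_wcat E).
by rewrite (prefix_wcat (esym E)) ?orbT.
Qed.

(** A regular address in the cell of [u'] is mapped to one in the cell of [v'], hence of
    [v], and by injectivity it also lies in the cell of [u]. *)
Lemma maps_comparable f u v b u' v' b' : injective f ->
  maps f u v b -> maps f u' v' b' -> prefix v v' -> prefix u u' || prefix u' u.
Proof.
move=> injf [gu gv uv bu H] [gu' gv' uv' bu' H'] /prefixP[a va].
have ot' := address_fill gu'; set t' := fill _ in ot'.
have := H' _ ot'; rewrite va wcat_cat => E.
have ov : address (wcat v (wcat a (flipS b' t'))).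
  by rewrite -wcat_cat -va; exact: address_move uv' ot'.
have ou := address_move b gu (esym uv) ov.
rewrite -[X in wcat v X]flipS_false -(addbb b) -flipS_flipS -H// in E.
move/injf: E => /(regular_pt ot' ou (regular_fill _ _))/comparable_wcat.
by rewrite orbC.
Qed.

(** Regular addresses below [u] determine the image word: if it could be lengthened, all
    of them would have to start with the same letter. *)
Lemma maps_uniq f u v b v' b' : maps f u v b -> maps f u v' b' -> v = v' /\ b = b'.
Proof.
wlog : v b v' b' / size v <= size v' => [W H H'|].
  have [vv'|/ltnW vv'] := leqP (size v) (size v'); first exact: W.
  by have [-> ->] := W _ _ _ _ vv' H' H.
move=> vv' [gu gv uv bu H] [_ gv' uv' bu' H'].
have P t : address (wcat u t) -> regular t ->
    wcat v (flipS b t) = wcat v' (flipS b' t).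
  move=> ot rt; apply: regular_pt; [exact: address_move ot|exact: address_move ot| |].
    exact: regular_flip.
  by rewrite -H// -H'.
pose t0 := fill (col u).
have rt0 : regular t0 by rewrite -[t0]wcat0; exact: regular_fill.
have P0 := P t0 (address_fill gu) rt0.
set x := kept_letter (col u) true; pose t1 := wcat [:: x] (fill (col u)).
have P1 : wcat v (flipS b t1) = wcat v' (flipS b' t1).
  apply: P; last exact: regular_fill.
  rewrite -wcat_cat cats1 -(kept_letter_colour (col u) true) -/x -(col_rcons u x).
  by apply: address_fill; exact: good_kept_letter.
have /prefixP[a va] := prefix_wcat P0 vv'.
rewrite va !wcat_cat in P0 P1; move/wcat_inj: P0 => P0; move/wcat_inj: P1 => P1.
case: a va P0 P1 => [|y a] va P0 P1; last first.
  have y0 : flip b (t0 0) = y := congr1 (fun s => s 0) P0.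
  have y1 : flip b (t1 0) = y := congr1 (fun s => s 0) P1.
  by move: y0; rewrite -y1 /t0 /t1 /wcat /= /x; case: (col u); case: (b).
rewrite cats0 in va; split=> //.
have E : flip b x = flip b' x := congr1 (fun s => s 0) P1.
move: E; rewrite /x; clear -bu bu'.
by case: b b' bu bu' => [] [] // => [/(_ isT)|_ /(_ isT)] ->.
Qed.

(** ** Ends that lie on one edge only *)

(** The vertices of degree one in every subdivision. *)
Definition leaf (V : vertex) : bool :=
  match V with v_l | v_r | v_w _ => true | _ => false end.

(** The words having [V] as an end: in each case a word determined by [V], lengthened
    by the letter that keeps the end. *)
Definition red_tgt_word (V : vertex) : word :=
  match V with
  | v_m q => rcons q r_1 | v_x q => rcons q b_u | v_y q => rcons q b_d | _ => [::] end.
Definition red_src_word (V : vertex) : word :=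
  match V with
  | v_m q => rcons q r_2 | v_x q => rcons q b_d | v_y q => rcons q b_u | _ => [::] end.
Definition blue_src_word (V : vertex) : word :=
  match V with
  | v_m q => rcons q r_s | v_x q => rcons q b_m | v_y q => rcons q b_p | _ => [::] end.
Definition blue_tgt_word (V : vertex) : word :=
  match V with
  | v_m q => rcons (rcons q r_s) b_m | v_w q => rcons q r_s
  | v_x q => rcons (rcons q b_m) b_m | v_y q => rcons (rcons q b_p) b_m
  | v_l => [:: b_m] | v_r => [:: b_p] | _ => [::] end.

Lemma cat_nseqS (w : word) k x : w ++ nseq k.+1 x = rcons (w ++ nseq k x) x.
Proof. by rewrite rcons_cat; congr cat; elim: k => //= k ->. Qed.

Lemma red_tgt w : good w -> col w = Red ->
  exists a, w = red_tgt_word (vend w true) ++ nseq a r_2.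
Proof.
elim/last_ind: w => [//|w x IH]; rewrite good_rcons col_rcons vend_rcons.
move=> /andP[gw]; rewrite follows_col.
case: x => //= fx _; try by exists 0; rewrite cats0.
all: move: fx; case cw: (col w) => // _.
by have [a wa] := IH gw cw; exists a.+1; rewrite cat_nseqS -wa.
Qed.

Lemma red_src w : good w -> col w = Red ->
  exists a, w = red_src_word (vend w false) ++ nseq a r_1.
Proof.
elim/last_ind: w => [//|w x IH]; rewrite good_rcons col_rcons vend_rcons.
move=> /andP[gw]; rewrite follows_col.
case: x => //= fx _; try by exists 0; rewrite cats0.
all: move: fx; case cw: (col w) => // _.
by have [a wa] := IH gw cw; exists a.+1; rewrite cat_nseqS -wa.
Qed.

Lemma blue_src w : good w -> col w = Blue -> w != [::] ->
  w = blue_src_word (vend w false).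
Proof.
case/lastP: w => [//|w x]; rewrite good_rcons col_rcons vend_rcons.
by move=> /andP[gw]; rewrite follows_col; case: x; case: (col w).
Qed.

Lemma blue_tgt w : good w -> col w = Blue -> w != [::] ->
  exists a, w = blue_tgt_word (vend w true) ++ nseq a b_p.
Proof.
elim/last_ind: w => [//|w x IH]; rewrite good_rcons col_rcons vend_rcons.
move=> /andP[gw]; rewrite follows_col => fx cx _.
case: (eqVneq w [::]) fx cx => [-> | w0].
  by case: x => // _ _; exists 0.
case: x => //=; case cw: (col w) => // _ _.
- by exists 0; rewrite cats0.
- exists 0; rewrite cats0 [in LHS](blue_src gw cw w0).
  case/lastP: w {IH w0} gw cw => // w y; rewrite vend_rcons good_rcons follows_col.
  by rewrite col_rcons => /andP[_]; case: y; case: (col w).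
- by have [a wa] := IH gw cw w0; exists a.+1; rewrite cat_nseqS -wa.
Qed.

Lemma leaf_end w al : good w -> w != [::] -> leaf (vend w al) ->
  [/\ al = true, col w = Blue & exists k, w = blue_tgt_word (vend w al) ++ nseq k b_p].
Proof.
move=> gw w0 lw; have [al1 cw] : al = true /\ col w = Blue.
  elim/last_ind: w al gw w0 lw => [//|w x IH] al; rewrite good_rcons follows_col.
  move=> /andP[gw fx] _; rewrite vend_rcons col_rcons.
  case: (eqVneq w [::]) fx => [->|w0]; first by case: x => //; case: al.
  case: x => //=; case cw: (col w) => // _; case: al => //= /(IH _ gw w0) [] //.
  by rewrite cw.
by split=> //; rewrite al1; exact: blue_tgt.
Qed.

(** Other addresses of the point would name a second edge at the vertex. *)
Lemma leaf_pt u al y : good u -> u != [::] -> leaf (vend u al) -> address y ->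
  pt y = end_pt u al -> y = wcat u (tail (col u) al).
Proof.
move=> gu u0 lu oy E; set z := wcat _ _; have oz : address z by exact: address_tail.
apply: contrapT => /stream_neq[n nn]; have [V HV] := glued_vertex oy oz E nn.
set m := (maxn n (size u)).+1.
have nm : n <= m by rewrite leqW// leq_maxl.
have VU : V = vend u al.
  apply: (has_end_eventually_uniq (n := maxn n (size u)) oz) => k;
    rewrite geq_max => /andP[nk uk].
    by have [] := HV k nk.
  exact: has_end_wcat_tail.
have [[be Vb] [ga Vg]] := HV m nm; rewrite -VU in lu.
have nz t : mkseq t m != [::] :> word by rewrite -size_eq0 size_mkseq.
have [|_ _ [k yk]] := leaf_end (al := be) (oy m) (nz y); first by rewrite Vb.
have [|_ _ [j zj]] := leaf_end (al := ga) (oz m) (nz z); first by rewrite Vg.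
rewrite Vb in yk; rewrite Vg in zj; apply: nn; rewrite !(mkseq_take _ nm) yk zj.
have : size (mkseq y m) = size (mkseq z m) by rewrite !size_mkseq.
by rewrite yk zj !size_cat !size_nseq => /addnI ->.
Qed.

Lemma nonleaf_words v al : good v -> ~~ leaf (vend v al) -> exists q x y be ga,
  [/\ x <> y, good (rcons q x), good (rcons q y),
      vend (rcons q x) be = vend v al & vend (rcons q y) ga = vend v al].
Proof.
elim/last_ind: v al => [|v x IH] al; first by case: al.
rewrite good_rcons follows_col vend_rcons => /andP[gv fx].
have new q y be ga z : z <> y -> good q -> y \in children (col q) -> z \in children (col q) ->
    vend (rcons q z) be = vend (rcons q y) ga ->
    forall V, vend (rcons q z) be = V -> exists q x y be ga,
    [/\ x <> y, good (rcons q x), good (rcons q y),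
      vend (rcons q x) be = V & vend (rcons q y) ga = V].
  move=> zy gq yq zq E V Ez; exists q, z, y, be, ga.
  by rewrite !good_rcons !follows_col gq; split=> //; rewrite -E.
case: x fx => /=; case cv : (col v) => // _; case: al => //= lf; try exact: IH.
all: try by apply: (@new v r_1 false true r_2); rewrite ?cv// !vend_rcons.
all: try by apply: (@new v b_d false false b_m); rewrite ?cv// !vend_rcons.
all: by apply: (@new v b_d false true b_p); rewrite ?cv// !vend_rcons.
Qed.

(** A vertex that is not a leaf lies on two incomparable edges. *)
Lemma nonleaf_pt v al : good v -> ~~ leaf (vend v al) ->
  exists y, [/\ address y, pt y = end_pt v al & y <> wcat v (tail (col v) al)].
Proof.
move=> gv lv; have [q [x [y [be [ga [xy gx gy Ex Ey]]]]]] := nonleaf_words gv lv.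
have [/esym E|E] := pselect (wcat (rcons q x) (tail (col (rcons q x)) be)
  = wcat v (tail (col v) al)).
  exists (wcat (rcons q y) (tail (col (rcons q y)) ga)); split.
  - exact: address_tail.
  - exact/end_ptP.
  - rewrite E => /(congr1 (fun s => s (size q))).
    by rewrite /wcat !size_rcons leqnn !nth_rcons ltnn eqxx => /esym.
by exists (wcat (rcons q x) (tail (col (rcons q x)) be)); split=> //;
  [exact: address_tail|exact/end_ptP].
Qed.

(** ** Rearrangements act on long words *)

Lemma name_of_surj w : wf w -> exists2 v, name_of v = w &
  [/\ good v, v != [::] & letter_colour (last e_L w) = col v].
Proof.
case: w => [//|y w] wfw; exists (letter_of_base y :: w).
  by case: y wfw.
have yr : letter_colour y = letter_colour (letter_of_base y) by case: (y).
split=> //; first by rewrite good_cons -(path_follows w yr); case: y wfw {yr}.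
by rewrite /col /=; case: w {wfw}.
Qed.

Lemma wcat_base u t : u != [::] -> headS base_letter (wcat u t) = wcat (name_of u) t.
Proof. by case: u => // x u _; apply/funext => -[|n]. Qed.

Lemma canonical_maps f u v : good u -> good v -> u != [::] -> v != [::] -> col u = col v ->
  canonical_on f (edge_of u) (edge_of v) -> maps f u v false.
Proof.
move=> gu gv u0 v0 uv H; split=> // t ot; rewrite flipS_false.
have [|y yt fy] := H t (mkOmega (Omega_baseS ot)); first by rewrite /= wcat_base.
rewrite (pt_to_airplane (x := mkOmega (Omega_baseS ot)))// fy.
apply/esym; apply: pt_to_airplane; last by rewrite wcat_base.
exact: (address_move0 gv uv ot).
Qed.

Lemma is_edge_edge_of u : u != [::] -> good u -> is_edge (edge_of u).
Proof.
move=> u0 gu; have [] // := @full_expansion_edge (size u).-1 (edge_of u).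
rewrite full_expansion_words prednK ?lt0n ?size_eq0//.
by apply: map_f; rewrite mem_words gu eqxx.
Qed.

Lemma rearrangement_maps f : is_rearrangement f ->
  exists k, forall u, good u -> k <= size u -> exists v, maps f u v false.
Proof.
move=> /rearrangement_deep[k H]; exists k.+1 => u gu ku.
have u0 : u != [::] by case: u ku {gu}.
have [||e [ee ce _ fe]] := H (edge_of u).
- exact: is_edge_edge_of.
- by rewrite /= size_name_of ltnW.
have [_ we ce'] := is_edge_wf ee; have [v nv [gv v0 cv]] := name_of_surj we.
exists v; apply: canonical_maps => //; first by rewrite -cv -ce' ce.
by move=> t x xt; have [y yt ->] := fe t x xt; exists y => //; rewrite yt -nv.
Qed.

(** Otherwise the image of the end has two addresses. The inverse of [f] is canonical
    on a long prefix of the second one and carries it to the only address of the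
    end of [u]; as [f] is canonical near this end, the second address would be the
    expected one. *)
Lemma maps_leaf f g u v b al : is_rearrangement g -> cancel f g -> cancel g f ->
  u != [::] -> maps f u v b -> leaf (vend u al) -> leaf (vend v (al (+) b)).
Proof.
move=> /rearrangement_maps[k Hk] fg gf u0 fuv lu; apply: contraT => lv.
have [gu gv uv bu _] := fuv.
have [y [oy yv yne]] := nonleaf_pt gv lv; case: yne.
set z := wcat u (tail (col u) al).
have gy : g (pt y) = pt z by rewrite yv -(maps_end al fuv) fg.
have [a ga] := Hk _ (oy k) (eq_leq (esym (size_mkseq _ _))).
have := wcat_mkseq y k; set s := fun _ => _ => ys.
have fa : maps f a (mkseq y k) false by exact: maps_inv ga gf.
have oa : address (wcat a s).
  have [_ ? ? _ _] := ga; by apply: (@address_move0 (mkseq y k)); rewrite -?ys.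
have az : wcat a s = z.
  apply: leaf_pt => //; rewrite -/z.
  have [_ _ _ _ H] := ga; have := H s; rewrite -ys flipS_false => <-//.
(* a common extension of [a] and [u], strictly longer than [u] *)
set n := (size u).+1; pose a' := a ++ mkseq s n.
have a'z : mkseq z (size a + n) = a' by rewrite -az mkseq_wcat.
set j := size a + n - size u.
have j0 : 0 < j by rewrite subn_gt0 addnS ltnS leq_addl.
have a'u : a' = u ++ mkseq (tail (col u) al) j.
  by rewrite -a'z mkseq_wcat_tail// (leq_trans _ (leq_addl _ _)).
have fa1 : maps f a' (mkseq y k ++ mkseq s n) false.
  by apply: maps_ext0 => //; rewrite -mkseq_wcat; exact: oa.
have fa2 : maps f a' (v ++ flipw b (mkseq (tail (col u) al) j)) false.
  rewrite a'u; apply: maps_ext => //; first exact: good_tail.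
  by rewrite -size_eq0 size_mkseq -lt0n.
have [E _] := maps_uniq fa1 fa2.
rewrite ys (wcat_mkseq s n) -wcat_cat E -mkseq_flipS wcat_cat flipS_tail//.
congr wcat.
have -> : (fun i => s (n + i)) = (fun i => tail (col u) al (j + i)).
  apply/funext => i; have := congr1 (fun w => w (size a + n + i)) az.
  rewrite /z /wcat -addnA ltnNge leq_addr /= addKn => ->.
  rewrite ltnNge (leq_trans _ (leq_addl _ _)) ?(leq_trans _ (leq_addr _ _))//=.
  by congr tail; rewrite /j addnA addnBAC// (leq_trans _ (leq_addl _ _)).
rewrite -uv; apply/funext => i; rewrite /wcat size_mkseq; case: ltnP => ij.
  by rewrite nth_mkseq.
rewrite subnKC// -(flipS_tail al bu) /flipS /headS.
by case: i ij => //; rewrite leqNgt j0.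
Qed.

Local Open Scope classical_set_scope.

(** * Rearrangements from tables of words *)

Lemma Omega_cvg_filter (F : set_system Omega) (x : Omega) : Filter F ->
  (forall n, \forall y \near F, mkseq (val y) n = mkseq (val x) n) -> F --> x.
Proof.
move=> FF yx A [_ [[W oW <-] Wx sWA]].
suff : set_val @ F --> set_val x.
  move=> /(_ W) FW; have /FW : nbhs (set_val x) W by exact: open_nbhs_nbhs.
  exact: (@filterS _ F FF _ _ sWA).
apply/cvg_sup => i B [_ [[C oC <-] Cx sCB]].
apply: (@filterS _ F FF _ _ _ (yx i.+1)) => y E; apply: sCB; move: Cx;
  rewrite /= set_valE /proj.
by have := congr1 (nth e_L ^~ i) E; rewrite !nth_mkseq// => ->.
Qed.

Lemma nbhs_cylinder (x : Omega) n :
  \forall y \near x, mkseq (val y) n = mkseq (val x) n.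
Proof.
have FF := nbhs_filter x; elim: n => [|n IH]; first by apply: filterE => y.
have xn : \forall y \near x, val y n = val x n.
  pose C : set (discrete_topology letter) := [set val x n].
  have : nbhs x ((fun y : Omega => (val y : prod_topology (fun _ =>
    discrete_topology letter)) n) @^-1` C).
    apply: (@continuous_comp _ _ _ (set_val : Omega -> prod_topology (fun _ =>
      discrete_topology letter))
       (@proj nat (fun _ => discrete_topology letter) n) x).
    - exact: initial_continuous.
    - exact: proj_continuous.
    - exact: discrete_set1.
  exact.
by apply: (@filterS2 _ _ FF _ _ _ _ IH xn) => y E1 E2; rewrite !mkseqS E1 E2.
Qed.

(** A map determining each letter by a bounded number of letters is continuous. *)
Lemma Omega_continuous (h : Omega -> Omega) N :
  (forall x y : Omega, forall n, mkseq (val x) (n + N) = mkseq (val y) (n + N) ->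
     mkseq (val (h x)) n = mkseq (val (h y)) n) -> continuous h.
Proof.
move=> H x; have FF := nbhs_filter x.
apply: (@Omega_cvg_filter (h @ x)) => n.
by apply: (@filterS _ _ FF _ _ _ (nbhs_cylinder x (n + N))) => y /H.
Qed.

Lemma airplane_continuous (f : airplane -> airplane) (h : Omega -> Omega) :
  continuous h -> (forall x, f (to_airplane x) = to_airplane (h x)) -> continuous f.
Proof.
move=> ch fh; apply/quotient_continuous.
have -> : f \o \pi_{eq_quot glued_equiv}%qT = to_airplane \o h by apply/funext => x; exact: fh.
by move=> x; apply: continuous_comp; [exact: ch|exact: pi_continuous].
Qed.

(** ** Gluing inside a cell *)

(** At each step only one child keeps the vertex, so the address is forced. *)
Lemma has_end_always_tail u s V : address (wcat u s) ->
  (forall m, size u <= m -> has_end V (mkseq (wcat u s) m)) ->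
  exists2 al, V = vend u al & s = tail (col u) al.
Proof.
move=> ou H; have gu := address_prefix ou.
have [al Va] := H _ (leqnn _); rewrite mkseq_wcat0 in Va.
exists al => //; have E n : mkseq s n = mkseq (tail (col u) al) n.
  elim: n => [//|n IH]; rewrite !mkseqS IH; congr rcons.
  have [gw [vw cw]] := good_tail_gen al n gu.
  have := @has_end_kept_letter (u ++ mkseq (tail (col u) al) n) (s n) (iter n (kept_end
    (col u)) al).
  rewrite cw vw Va -IH rcons_cat -mkseqS -mkseq_wcat; apply; first exact: ou.
  by apply: H; exact: leq_addr.
apply/funext => n; have := congr1 (nth e_L ^~ n) (E n.+1).
by rewrite !nth_mkseq.
Qed.

(** The effect of reversal on the vertices of a blue cell. *)
Definition flipV (V : vertex) : vertex :=
  match V with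
  | v_l => v_r | v_r => v_l
  | v_m a => v_m (flipw true a) | v_w a => v_w (flipw true a)
  | v_x [::] => v_y [::] | v_y [::] => v_x [::]
  | v_x a => v_x (flipw true a) | v_y a => v_y (flipw true a)
  | V => V
  end.

Lemma flipw_rcons b a x : a != [::] -> flipw b (rcons a x) = rcons (flipw b a) x.
Proof. by case: a. Qed.

Lemma vend_flipw a al : good a -> a != [::] ->
  vend (flipw true a) al = flipV (vend a al).
Proof.
elim/last_ind: a al => [//|a x IH] al; rewrite good_rcons follows_col.
move=> /andP[ga fx] _; case: (eqVneq a [::]) fx => [->|a0 fx].
  by case: x => //; case: al.
rewrite flipw_rcons// !vend_rcons.
have xy : flipV (v_x a) = v_x (flipw true a) /\ flipV (v_y a) = v_y (flipw true a).
  by case: (a) a0.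
by case: x fx xy => _ [ex ey]; case: al => //=; rewrite -?ex -?ey//; exact: IH.
Qed.

(** The identifications inside a cell come from vertices created below it or from its
    two ends, and these depend on the colour only. *)
Lemma pt_flip u v (b : bool) s s' : good v -> col u = col v -> (b -> col u = Blue) ->
  address (wcat u s) -> address (wcat u s') -> pt (wcat u s) = pt (wcat u s') ->
  pt (wcat v (flipS b s)) = pt (wcat v (flipS b s')).
Proof.
move=> gv uv bu os os' E; have [->//|/stream_neq[n nn]] := pselect (s = s').
have ov := address_move b gv uv os; have ov' := address_move b gv uv os'.
set a := mkseq s n.+1; set a' := mkseq s' n.+1.
have aa' : mkseq (wcat u s) (size u + n.+1) <> mkseq (wcat u s') (size u + n.+1).
  by rewrite !mkseq_wcat => /cat_inj aa'; apply: nn; rewrite !(mkseq_take _ (leqnSn n)) aa'.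
have [V HV] := glued_vertex os os' E aa'.
have gua : good (u ++ a) by rewrite -mkseq_wcat; exact: os.
have gua' : good (u ++ a') by rewrite -mkseq_wcat; exact: os'.
have su t : size (u ++ mkseq t n.+1) = size u + n.+1 by rewrite size_cat size_mkseq.
have [al Va sa] : exists2 al, V = vend (u ++ a) al &
    (fun i => s (n.+1 + i)) = tail (col (u ++ a)) al.
  apply: has_end_always_tail; rewrite wcat_cat -wcat_mkseq// => m.
  by rewrite su => /HV[].
have [be Vb sb] : exists2 al, V = vend (u ++ a') al &
    (fun i => s' (n.+1 + i)) = tail (col (u ++ a')) al.
  apply: has_end_always_tail; rewrite wcat_cat -wcat_mkseq// => m.
  by rewrite su => /HV[].
have a0 : a != [::] by rewrite -size_eq0 size_mkseq.
have a'0 : a' != [::] by rewrite -size_eq0 size_mkseq.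
have Ea : wcat v (flipS b s) = wcat (v ++ flipw b a) (tail (col (v ++ flipw b a)) al).
  by rewrite -(col_flipw b a uv) -sa wcat_cat -flipS_wcat// -wcat_mkseq.
have Ea' : wcat v (flipS b s') = wcat (v ++ flipw b a') (tail (col (v ++ flipw b a')) be).
  by rewrite -(col_flipw b a' uv) -sb wcat_cat -flipS_wcat// -wcat_mkseq.
rewrite Ea Ea'; apply/end_ptP; [exact: good_flipw gua|exact: good_flipw gua'|].
rewrite !vend_place; congr place.
have Eab : vend a al = vend a' be by apply: (@place_inj u); rewrite -!vend_place -Va.
case: b bu {ov ov' Ea Ea'} => [/(_ isT) bu|_]; last by rewrite !flipw_false.
have ga t : good (u ++ t) -> good t.
  by rewrite good_cat => /andP[_]; rewrite (@path_follows _ b_p)//.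
by rewrite !vend_flipw ?Eab//; exact: ga.
Qed.

(** ** Tables *)

(** The entry [(u, v, b)] prescribes the canonical map from the cell of [u] to
    that of [v], composed with the reversal if [b]. *)
Definition entry : Type := word * word * bool.
Definition dom (k : entry) : word := k.1.1.
Definition ran (k : entry) : word := k.1.2.
Definition rev_of (k : entry) : bool := k.2.

Definition swap (k : entry) : entry := (ran k, dom k, rev_of k).

Definition vertex_eq (V W : vertex) : bool :=
  match V, W with
  | v_l, v_l | v_a, v_a | v_b, v_b | v_r, v_r => true
  | v_m a, v_m c | v_w a, v_w c | v_x a, v_x c | v_y a, v_y c => a == c
  | _, _ => false
  end.

Lemma vertex_eqP V W : reflect (V = W) (vertex_eq V W).
Proof.
apply: (iffP idP) => [|->]; last by case: W => //= w; rewrite eqxx.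
by case: V => [||||c|c|c|c]; case: W => [||||d|d|d|d] //= /eqP ->.
Qed.

Definition is_blue (c : colour) : bool := if c is Blue then true else false.

Definition same_colour (c d : colour) : bool := is_blue c == is_blue d.

Lemma same_colourP c d : same_colour c d -> c = d.
Proof. by case: c; case: d. Qed.

(** Every long word has a prefix in exactly one entry, entries respect colours, and
    ends of domain words that coincide are sent to ends that coincide. These are
    decidable conditions on a closed list. *)
Definition table_half (n : nat) (K : seq entry) : bool :=
  [&& all (fun w => count (fun k => prefix (dom k) w) K == 1) (words n),
      all (fun k => [&& size (dom k) <= n, good (dom k), good (ran k),
             same_colour (col (dom k)) (col (ran k)) &
             rev_of k ==> is_blue (col (dom k))]) K &
      all (fun k => all (fun k' => all (fun al => all (fun be =>
        vertex_eq (vend (dom k) al) (vend (dom k') be) ==>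
        vertex_eq (vend (ran k) (al (+) rev_of k)) (vend (ran k') (be (+) rev_of k')))
        [:: false; true]) [:: false; true]) K) K].

Definition is_table (n : nat) (K : seq entry) : bool :=
  table_half n K && table_half n (map swap K).

Definition apply_table (K : seq entry) (t : stream) : stream :=
  let k := nth ([::], [::], false) K
    (find (fun k => mkseq t (size (dom k)) == dom k) K) in
  wcat (ran k) (flipS (rev_of k) (fun n => t (size (dom k) + n))).

Lemma count1_uniq (T : eqType) (P : pred T) (s : seq T) x y : count P s = 1 ->
  x \in s -> y \in s -> P x -> P y -> x = y.
Proof.
rewrite -size_filter => c1 xs ys Px Py.
have : x \in seq.filter P s by rewrite mem_filter Px.
have : y \in seq.filter P s by rewrite mem_filter Py.
by case: (seq.filter P s) c1 => [|z [|]] // _; rewrite !inE => /eqP -> /eqP ->.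
Qed.

Section Table.
Variables (n : nat) (K : seq entry).
Hypothesis HK : table_half n K.

Lemma table_unique t k k' s s' : address t -> k \in K -> k' \in K ->
  t = wcat (dom k) s -> t = wcat (dom k') s' -> k = k'.
Proof.
move=> ot kK k'K tk tk'; case/and3P: HK => /allP c1 /allP w1 _.
have nt : mkseq t n \in words n by rewrite mem_words ot size_mkseq eqxx.
have pre k0 s0 : k0 \in K -> t = wcat (dom k0) s0 -> prefix (dom k0) (mkseq t n).
  move=> /w1/andP[sk _] tk0; rewrite prefixE.
  by rewrite -mkseq_take// tk0 mkseq_wcat0.
by apply: (count1_uniq (eqP (c1 _ nt))) => //; [exact: pre tk|exact: pre tk'].
Qed.

Lemma table_lookup t : address t -> exists k s, [/\ k \in K, t = wcat (dom k) s &
  apply_table K t = wcat (ran k) (flipS (rev_of k) s)].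
Proof.
move=> ot; case/and3P: HK => /allP c1 /allP w1 _.
have nt : mkseq t n \in words n by rewrite mem_words ot size_mkseq eqxx.
have hK : has (fun k => mkseq t (size (dom k)) == dom k) K.
  have : has (fun k => prefix (dom k) (mkseq t n)) K by rewrite has_count (eqP (c1 _ nt)).
  move=> /hasP[k kK]; rewrite prefixE => E; apply/hasP; exists k => //.
  by rewrite (@mkseq_take _ _ _ n)//; have /andP[] := w1 _ kK.
set k := nth ([::], [::], false) K (find (fun k => mkseq t (size (dom k)) == dom k) K).
exists k, (fun i => t (size (dom k) + i)); split => //.
  by apply: mem_nth; rewrite -has_find.
have /eqP {1}<- := nth_find ([::], [::], false) hK.
exact: wcat_mkseq.
Qed.

Lemma apply_tableE k s : k \in K -> address (wcat (dom k) s) ->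
  apply_table K (wcat (dom k) s) = wcat (ran k) (flipS (rev_of k) s).
Proof.
move=> kK ok; have [k' [s' [k'K E ->]]] := table_lookup ok.
have kk' : k = k' by apply: (table_unique ok kK k'K _ E).
by rewrite -kk' in E *; rewrite (wcat_inj E).
Qed.

Lemma entry_good k : k \in K ->
  [/\ size (dom k) <= n, good (dom k), good (ran k), col (dom k) = col (ran k) &
      rev_of k -> col (dom k) = Blue].
Proof.
move=> kK; case/and3P: HK => _ /allP/(_ _ kK)/and5P[? ? ? /same_colourP ? H] _.
by split=> // kr; move: H; rewrite kr /=; case: (col _).
Qed.

Lemma address_apply_table t : address t -> address (apply_table K t).
Proof.
move=> ot; have [k [s [kK E ->]]] := table_lookup ot; rewrite E in ot.
by have [_ _ g c _] := entry_good kK; exact: address_move c ot.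
Qed.

Lemma entry_ends k k' al be : k \in K -> k' \in K ->
  vend (dom k) al = vend (dom k') be ->
  vend (ran k) (al (+) rev_of k) = vend (ran k') (be (+) rev_of k').
Proof.
move=> kK k'K E; case/and3P: HK => _ _ /allP/(_ _ kK)/allP/(_ _ k'K).
move=> /allP/(_ al); have b2 (b : bool) : b \in [:: false; true] by case: b.
by move=> /(_ (b2 _))/allP/(_ be (b2 _))/implyP/(_ (introT (vertex_eqP _ _) E))/vertex_eqP.
Qed.

(** Glued addresses in the same cell stay glued because the cells are moved
    canonically; in different cells they are ends of the two cells, and a table
    preserves the incidence of ends. *)
Lemma pt_apply_table t t' : address t -> address t' -> pt t = pt t' ->
  pt (apply_table K t) = pt (apply_table K t').
Proof.
move=> ot ot' E; have [k [s [kK tk ->]]] := table_lookup ot.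
have [k' [s' [k'K tk' ->]]] := table_lookup ot'.
have [_ gu gv uv bu] := entry_good kK; have [_ gu' gv' uv' bu'] := entry_good k'K.
have [kk'|kk'] := pselect (k = k').
  by rewrite -kk' in tk' *; apply: pt_flip gv uv bu _ _ _; rewrite -?tk -?tk'.
set m := minn (size (dom k)) (size (dom k')).
have tt' : mkseq t m <> mkseq t' m.
  move=> Em; apply: kk'; rewrite /m in Em.
  have [le|/ltnW le] := leqP (size (dom k)) (size (dom k')).
    apply: (@table_unique t' _ _ (fun i => t' (size (dom k) + i)) s') => //.
    move: Em; rewrite (minn_idPl le) [in mkseq t _]tk mkseq_wcat0 => {1}->.
    exact: wcat_mkseq.
  apply: (@table_unique t _ _ s (fun i => t (size (dom k') + i))) => //.
  move: Em; rewrite (minn_idPr le) [in mkseq t' _]tk' mkseq_wcat0 => {1}<-.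
  exact: wcat_mkseq.
have [V HV] := glued_vertex ot ot' E tt'.
have [al Va sa] : exists2 al, V = vend (dom k) al & s = tail (col (dom k)) al.
  apply: has_end_always_tail; rewrite -tk// => i ki.
  by have [] := HV i (leq_trans (geq_minl _ _) ki).
have [be Vb sb] : exists2 be, V = vend (dom k') be & s' = tail (col (dom k')) be.
  apply: has_end_always_tail; rewrite -tk'// => i ki.
  by have [] := HV i (leq_trans (geq_minr _ _) ki).
rewrite sa sb !flipS_tail// uv uv'; apply/end_ptP => //.
by apply: entry_ends => //; rewrite -Va.
Qed.

Lemma apply_table_prefix t t' m : address t -> address t' ->
  mkseq t (m + n) = mkseq t' (m + n) ->
  mkseq (apply_table K t) m = mkseq (apply_table K t') m.
Proof.
move=> ot ot' E; have [k [s [kK tk ->]]] := table_lookup ot.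
have [kn _ _ _ _] := entry_good kK.
have E1 i : i < m + n -> t i = t' i.
  by move=> im; have := congr1 (nth e_L ^~ i) E; rewrite !nth_mkseq.
have t'k : t' = wcat (dom k) (fun i => t' (size (dom k) + i)).
  have {1}<- : mkseq t' (size (dom k)) = dom k; last exact: wcat_mkseq.
  have le : size (dom k) <= m + n by apply: leq_trans kn (leq_addl _ _).
  by rewrite (mkseq_take _ le) -E -(mkseq_take _ le) tk mkseq_wcat0.
rewrite t'k apply_tableE//; last by rewrite -t'k.
apply: (@eq_from_nth _ e_L) => [|i]; rewrite !size_mkseq// => im.
rewrite !nth_mkseq// /wcat /flipS /headS.
have -> j : j < m -> s j = t' (size (dom k) + j).
  move=> jm; rewrite -E1 ?tk /wcat; last by rewrite addnC -addSn leq_add.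
  by rewrite ltnNge leq_addr addKn.
  by [].
exact: leq_ltn_trans (leq_subr _ _) im.
Qed.

End Table.

Definition addr (a : airplane) : stream := projT1 (cid2 (pt_surj a)).

Lemma addrP a : address (addr a) /\ pt (addr a) = a.
Proof. by rewrite /addr; case: cid2 => t /= ot ->. Qed.

(** The table acts on addresses, hence on points by choosing an address. *)
Definition table_map (K : seq entry) (a : airplane) : airplane := pt (apply_table K (addr a)).

Lemma table_map_pt n K t : table_half n K -> address t ->
  table_map K (pt t) = pt (apply_table K t).
Proof.
by move=> HK ot; have [oa E] := addrP (pt t); apply: (pt_apply_table HK) => //; rewrite E.
Qed.

Lemma table_map_continuous n K : table_half n K -> continuous (table_map K).
Proof.
move=> HK; have ok (x : Omega) : address (apply_table K (headS letter_of_base (val x))).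
  by apply: (address_apply_table HK); have [] := address_of_base x.
apply: (@airplane_continuous _ (fun x => mkOmega (Omega_baseS (ok x)))).
  apply: (@Omega_continuous _ n) => x y m E.
  rewrite /= !mkseq_baseS; congr name_of; apply: (apply_table_prefix HK).
  - by have [] := address_of_base x.
  - by have [] := address_of_base y.
  - by move: E; case: (m + n) => // j E; rewrite !mkseq_headS;
      move: E; rewrite /mkseq /= => -[-> ->].
move=> x; have [ox Ex] := address_of_base x.
rewrite -(pt_to_airplane ox (esym Ex)) (table_map_pt HK)//.
exact: pt_to_airplane.
Qed.

Lemma maps_canonical f u v : u != [::] -> v != [::] -> maps f u v false ->
  canonical_on f (edge_of u) (edge_of v).
Proof.
move=> u0 v0 [gu gv uv _ H] t x xt; have [ox Ex] := address_of_base x.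
have Eu : headS letter_of_base (val x) = wcat u t.
  rewrite xt /=; case: (u) u0 (gu) => // y w _; rewrite good_cons => /andP[yB _].
  by apply/funext => -[|i] //; case: y yB.
rewrite Eu in ox Ex; have ov := address_move0 gv uv ox.
exists (mkOmega (Omega_baseS ov)); first by rewrite /= wcat_base.
rewrite -(pt_to_airplane ox (esym Ex)) H// flipS_false.
exact: pt_to_airplane.
Qed.

Lemma table_rearrangement n K : is_table n K ->
  exists h : T_A, forall k, k \in K -> maps (val h) (dom k) (ran k) (rev_of k).
Proof.
move=> /andP[HK HK']; set f := table_map K; set g := table_map (map swap K).
have inv K1 K2 : table_half n K1 -> table_half n K2 ->
    (forall k, k \in K1 -> swap k \in K2) -> cancel (table_map K1) (table_map K2).
  move=> H1 H2 sw a; have [t ot ->] := pt_surj a; rewrite (table_map_pt H1)//.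
  rewrite (table_map_pt H2); last exact: (address_apply_table H1).
  have [k [s [kK tk ->]]] := table_lookup H1 ot.
  have [_ gu gv uv bu] := entry_good H1 kK.
  rewrite -[ran k]/(dom (swap k)) (apply_tableE H2) ?sw//=; last first.
    by apply: address_move uv _ => //; rewrite -tk.
  by rewrite flipS_flipS addbb flipS_false tk.
have fg : cancel f g by apply: inv => // k; exact: map_f.
have gf : cancel g f by apply: inv => // _ /mapP[[[u v] b] kK ->].
have fk k : k \in K -> maps f (dom k) (ran k) (rev_of k).
  move=> kK; have [_ gu gv uv bu] := entry_good HK kK; split=> // t ot.
  by rewrite /f (table_map_pt HK)// (apply_tableE HK).
have rf : is_rearrangement f.
  split; first by exists g; split=> //;
    exact: table_map_continuous HK || exact: table_map_continuous HK'.
  exists (full_expansion n); first exact: full_expansion_partition.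
  rewrite full_expansion_words => _ /mapP[w + ->]; rewrite mem_words => /andP[gw /eqP sw].
  have [k [s [kK tk _]]] := table_lookup HK (address_fill gw).
  have [kn gu gv uv bu] := entry_good HK kK.
  have /prefixP[a wa] : prefix (dom k) w.
    by apply: (prefix_wcat (esym tk)); rewrite sw ltnW.
  have a0 : a != [::].
    by apply: contraTneq kn => a0; rewrite -ltnNge -sw wa a0 cats0.
  have gua : good (dom k ++ a) by rewrite -wa.
  have [_ gva cva _ _] := maps_ext (fk k kK) gua a0.
  have vn : ran k ++ flipw (rev_of k) a != [::] by case: a a0 {wa gua gva cva}; case: (ran k).
  exists (edge_of (ran k ++ flipw (rev_of k) a)); split.
  - exact: is_edge_edge_of.
  - by rewrite /= -cva -wa.
  - apply: maps_canonical => //; first by rewrite wa; case: a a0 {wa gua gva cva vn};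
    case: (dom k).
    by rewrite wa; exact: maps_ext (fk k kK) gua a0.
by exists (mkRearrangement rf) => k kK /=; exact: fk.
Qed.

(** The standard generator of Thompson's group F on a red edge: it stretches the first
    quarter to the first half, translates the second quarter, and shrinks the second half
    to the last quarter; the blue edges at the midpoints follow. *)
Definition arc_table : seq entry :=
  [:: ([:: r_1; r_1], [:: r_1], false); ([:: r_1; r_2], [:: r_2; r_1], false);
      ([:: r_1; r_s], [:: r_s], false); ([:: r_2], [:: r_2; r_2], false);
      ([:: r_s], [:: r_2; r_s], false)].

(** The same generator on the path joining the ends of a blue edge. Its first half is the
    edge [b_m], which is directed backwards, so that the quarters of this half
    appear as [b_m b_p], [b_m b_m], and the second of them has to be reversed to
    become the first quarter [b_p b_m] of the other half. *)
Definition segment_table : seq entry :=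
  [:: ([:: b_m; b_p], [:: b_m], false); ([:: b_m; b_u], [:: b_d], false);
      ([:: b_m; b_d], [:: b_u], false); ([:: b_m; b_m], [:: b_p; b_m], true);
      ([:: b_u], [:: b_p; b_u], false); ([:: b_d], [:: b_p; b_d], false);
      ([:: b_p], [:: b_p; b_p], false)].

(** The same generator on the circle of a blue edge, cut open at the vertex where [b_m]
    is attached: the halves are [b_d] and [b_u], and [b_p], which is attached at the
    midpoint, takes the role of [r_s]. *)
Definition circle_table : seq entry :=
  [:: ([:: b_d; r_1], [:: b_d], false); ([:: b_d; r_2], [:: b_u; r_1], false);
      ([:: b_d; r_s], [:: b_p], false); ([:: b_u], [:: b_u; r_2], false);
      ([:: b_p], [:: b_u; r_s], false); ([:: b_m], [:: b_m], false)].

Definition reversal_table : seq entry := [:: ([::], [::], true)].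

Definition place_entry (e : word) (k : entry) : entry := (e ++ dom k, e ++ ran k, rev_of k).

(** The cells of these words cover the complement of the cell of [e]; a table at [e] is
    extended by the identity to them. *)
Fixpoint siblings_from (w e : word) : seq word :=
  if e is x :: e' then
    [seq rcons w y | y <- children (col w) & y != x] ++ siblings_from (rcons w x) e'
  else [::].

Definition placed (K : seq entry) (e : word) : seq entry :=
  map (place_entry e) K ++ [seq (w, w, false) | w <- siblings_from [::] e].

Lemma is_table_reversal : is_table 0 (placed reversal_table [::]).
Proof. by vm_compute. Qed.
Lemma is_table_circle : is_table 2 (placed circle_table [::]).
Proof. by vm_compute. Qed.
Lemma is_table_segment : is_table 2 (placed segment_table [::]).
Proof. by vm_compute. Qed.
Lemma is_table_arc : is_table 3 (placed arc_table [:: b_d]).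
Proof. by vm_compute. Qed.
Lemma is_table_segment_p : is_table 3 (placed segment_table [:: b_p]).
Proof. by vm_compute. Qed.
Lemma is_table_segment_pm : is_table 4 (placed segment_table [:: b_p; b_m]).
Proof. by vm_compute. Qed.

Local Open Scope group_scope.
(** * Rearrangements supported in one cell *)

Lemma val_mul (f g : T_A) : val (f * g) = val f \o val g. Proof. by []. Qed.

Lemma val_invK (f : T_A) : cancel (val f) (val f^-1).
Proof. by move=> a; have := congr1 (fun h : T_A => val h a) (mulVg f). Qed.

Lemma inv_valK (f : T_A) : cancel (val f^-1) (val f).
Proof. by move=> a; have := congr1 (fun h : T_A => val h a) (mulgV f). Qed.

Lemma val_injective (f : T_A) : injective (val f).
Proof. exact: can_inj (val_invK f). Qed.

Lemma maps_mul (f g : T_A) u v w b b' : maps (val g) u v b -> maps (val f) v w b' ->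
  maps (val (f * g)) u w (b (+) b').
Proof. by rewrite val_mul; exact: maps_comp. Qed.

Lemma maps_invg (f : T_A) u v b : maps (val f) u v b -> maps (val f^-1) v u b.
Proof. by move=> /maps_inv; apply; exact: val_invK. Qed.

Definition in_cell (e : word) (a : airplane) : Prop :=
  exists2 t, address (wcat e t) & a = pt (wcat e t).

Definition acts (K : seq entry) (e : word) (h : T_A) : Prop :=
  (forall k, k \in K -> maps (val h) (e ++ dom k) (e ++ ran k) (rev_of k)) /\
  (forall a, ~ in_cell e a -> val h a = a).

Lemma placed_acts n K e : is_table n (placed K e) -> exists h, acts K e h.
Proof.
move=> HK; have [h hK] := table_rearrangement HK; exists h; split=> [k kK|a ae].
  have := hK (place_entry e k); apply.
  by rewrite mem_cat map_f.
have [t ot at_] := pt_surj a; have /andP[HK1 _] := HK.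
have [k [s [kK tk _]]] := table_lookup HK1 ot.
move: (kK); rewrite mem_cat => /orP[] /mapP[].
  move=> k' k'K E; case: ae; exists (wcat (dom k') s); last by rewrite at_ tk E -wcat_cat.
  by rewrite -wcat_cat; move: ot; rewrite tk E.
move=> w _ E; rewrite tk E in ot at_; have := hK k kK; rewrite E => -[_ _ _ _ /(_ s)].
by rewrite /= flipS_false -at_; apply.
Qed.

Lemma in_cell_maps (g : T_A) e e' a : maps (val g) e e' false ->
  in_cell e a -> in_cell e' (val g a).
Proof.
move=> [_ ge' ee' _ H] [t ot ->]; exists t; first exact: address_move0 ot.
by rewrite H// flipS_false.
Qed.

Lemma acts_inv K e (h : T_A) : acts K e h -> acts (map swap K) e h^-1.
Proof.
move=> [hK hid]; split=> [_ /mapP[k kK ->]|a ae]; first exact/maps_invg/hK.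
by rewrite -{1}(hid a ae) val_invK.
Qed.

(** Canonical maps conjugate the copy of a table in one cell to its copy in the other. *)
Lemma acts_conj K e e' (g h : T_A) : maps (val g) e e' false -> acts K e h ->
  acts K e' (g * h * g^-1).
Proof.
move=> gee' [hK hid]; split=> [k kK|a ae]; last first.
  rewrite !val_mul /= hid ?inv_valK// => /(in_cell_maps gee').
  by rewrite inv_valK.
have [gu gv uv bu _] := hK k kK.
have [ge ge' ee' _ _] := gee'.
have gu' : good (e' ++ dom k) by apply: good_cat_col gu.
rewrite -[rev_of k]addFb; apply: (@maps_mul (g * h) g^-1 _ (e ++ dom k)).
  by apply: maps_invg; exact: maps_ext0.
rewrite -[rev_of k]addbF; apply: maps_mul (hK k kK) _; exact: maps_ext0.
Qed.

(** ** Action on words *)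

Definition fixes_end (K : seq entry) (al : bool) : bool :=
  has (fun k => has (fun be =>
    vertex_eq (vend (dom k) be) (vend [::] al) &&
    vertex_eq (vend (ran k) (be (+) rev_of k)) (vend [::] al)) [:: false; true]) K.

Lemma acts_end K e h al : acts K e h -> good e -> fixes_end K al ->
  val h (end_pt e al) = end_pt e al.
Proof.
move=> [hK _] ge /hasP[k kK /hasP[be _ /andP[/vertex_eqP E1 /vertex_eqP E2]]].
have [gu gv _ _ _] := hK k kK.
have eE v ga : good (e ++ v) -> vend v ga = vend [::] al ->
    end_pt e al = end_pt (e ++ v) ga.
  by move=> gev E; apply/end_ptP => //; rewrite vend_place E -vend_place cats0.
by rewrite (eE _ _ gu E1) (maps_end be (hK k kK)) -(eE _ _ gv E2) (eE _ _ gu E1).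
Qed.

(** An end of [e] that is moved must not lie on edges outside of the cell of [e]. *)
Definition isolated_or_fixed (K : seq entry) (e : word) : Prop :=
  forall al, [\/ fixes_end K al, e = [::] | leaf (vend e al)].

(** Points outside the cell of [e] are fixed, and a point that the cell of [w] shares
    with it is an end of [e]. *)
Lemma acts_outside K e h w : acts K e h -> good e -> isolated_or_fixed K e ->
  good w -> ~~ prefix e w -> ~~ prefix w e -> maps (val h) w w false.
Proof.
move=> hK ge iso gw ew we; split=> // t ot; rewrite flipS_false.
have [[s os E]|] := pselect (in_cell e (pt (wcat w t))); last by have [_] := hK; apply.
set m := minn (size w) (size e).
have dif : mkseq (wcat w t) m <> mkseq (wcat e s) m.
  rewrite /m; have [le|/ltnW le] := leqP (size w) (size e).
    rewrite mkseq_wcat0 => Ewe; case/negP: we; rewrite prefixE.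
    by rewrite -{1}(mkseq_wcat0 e s) -mkseq_take// -Ewe.
  rewrite mkseq_wcat0 => Ewe; case/negP: ew; rewrite prefixE.
  by rewrite -{1}(mkseq_wcat0 w t) -mkseq_take// Ewe.
have [V HV] := glued_vertex ot os E dif.
have [al Va st] : exists2 al, V = vend e al & s = tail (col e) al.
  apply: has_end_always_tail => // i ei.
  by have [] := HV i (leq_trans (geq_minr _ _) ei).
have Ew : pt (wcat w t) = end_pt e al by rewrite E st.
have e0 : e != [::] by apply: contraNneq ew => ->; rewrite prefix0s.
case: (iso al) => [fx|/eqP|lf]; first by rewrite Ew (acts_end hK).
  by rewrite (negPf e0).
by have := comparable_wcat (leaf_pt ge e0 lf ot Ew); rewrite (negPf ew) (negPf we).
Qed.

(** The effect on a word of the table [K] placed at [e], if the word is long enough: the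
    image, and whether it is reached with reversal. *)
Definition step (K : seq entry) (e w : word) : option (word * bool) :=
  if prefix e w then
    let a := drop (size e) w in
    let k := nth ([::], [::], false) K (find (fun k => prefix (dom k) a) K) in
    if has (fun k => prefix (dom k) a) K then
      let c := drop (size (dom k)) a in
      Some (e ++ ran k ++ flipw (rev_of k) c, if c is [::] then rev_of k else false)
    else None
  else if prefix w e then None else Some (w, false).

Definition tracks (h : T_A) (phi : word -> option (word * bool)) : Prop :=
  forall w w' b, good w -> phi w = Some (w', b) -> maps (val h) w w' b.

Lemma acts_tracks K e h : acts K e h -> good e -> isolated_or_fixed K e ->
  tracks h (step K e).
Proof.
move=> hK ge iso w w' b gw; rewrite /step; case: ifPn => [/prefixP[a wa]|ew].
  rewrite wa drop_size_cat//; case: ifP => // hs [<- <-].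
  set k := nth _ _ _; have kK : k \in K by apply: mem_nth; rewrite -has_find.
  have := nth_find ([::], [::], false) hs; rewrite -/k => /prefixP[c ac].
  have hk := proj1 hK k kK; rewrite ac drop_size_cat// !catA.
  case: c ac => [|x c] ac; first by rewrite !cats0.
  by apply: maps_ext => //; rewrite -catA -ac -wa.
case: ifPn => // we [<- <-]; exact: (acts_outside hK).
Qed.

Definition then_step (phi psi : word -> option (word * bool)) (w : word) :=
  if psi w is Some (w', b) then
    if phi w' is Some (w'', b') then Some (w'', b (+) b') else None
  else None.

Lemma tracks_mul (f g : T_A) phi psi : tracks f phi -> tracks g psi ->
  tracks (f * g) (then_step phi psi).
Proof.
move=> tf tg w w'' b gw; rewrite /then_step.
case E : (psi w) => [[w' b']|] //; case E' : (phi w') => [[v b'']|] // [<- <-].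
have gm := tg _ _ _ gw E; have gw' : good w' by case: gm.
exact: maps_mul gm (tf _ _ _ gw' E').
Qed.

Lemma tracks_one : tracks 1 (fun w => Some (w, false)).
Proof. by move=> w w' b gw [<- <-]; exact: maps_id. Qed.

(** Identities between rearrangements given by tables are checked on the finitely many
    words of a given length. *)
Lemma tracks_eq n (f g : T_A) phi psi : tracks f phi -> tracks g psi ->
  all (fun w => (phi w == psi w) && (phi w != None)) (words n) -> f = g.
Proof.
move=> tf tg /allP H; apply: val_inj; apply/funext => a.
have [t ot ->] := pt_surj a; rewrite (wcat_mkseq t n) in ot *.
have gw : good (mkseq t n) by exact: address_prefix ot.
have := H (mkseq t n); rewrite mem_words gw size_mkseq eqxx => /(_ isT)/andP[/eqP E].
case Ew : (phi _) => [[w b]|] // _; rewrite Ew in E.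
have [_ _ _ _ ->//] := tf _ _ _ gw Ew.
by have [_ _ _ _ ->] := tg _ _ _ gw (esym E).
Qed.

Lemma isolated_of_fixed K e : fixes_end K false -> fixes_end K true -> isolated_or_fixed K e.
Proof. by move=> f0 f1 []; apply: Or31. Qed.

Lemma isolated_arc e : isolated_or_fixed arc_table e. Proof. exact: isolated_of_fixed. Qed.
Lemma isolated_arc_inv e : isolated_or_fixed (map swap arc_table) e. Proof. exact:
  isolated_of_fixed. Qed.
Lemma isolated_segment e : isolated_or_fixed segment_table e. Proof. exact:
  isolated_of_fixed. Qed.
Lemma isolated_segment_inv e : isolated_or_fixed (map swap segment_table) e. Proof. exact:
  isolated_of_fixed. Qed.

(** ** Similar words *)

Definition similar (e e' : word) : Prop := exists g : T_A, maps (val g) e e' false.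

Lemma similar_sym e e' : similar e e' -> similar e' e.
Proof. by move=> [g /maps_invg ge]; exists g^-1. Qed.

Lemma similar_trans e e' e'' : similar e e' -> similar e' e'' -> similar e e''.
Proof. by move=> [g ge] [h he]; exists (h * g); rewrite -[false]addbF; exact: maps_mul he. Qed.

Lemma similar_refl e : good e -> similar e e.
Proof. by move=> ge; exists 1; exact: maps_id. Qed.

Lemma similar_ext e e' a : similar e e' -> good (e ++ a) -> similar (e ++ a) (e' ++ a).
Proof. by move=> [g ge] ga; exists g; exact: maps_ext0. Qed.

Lemma similar_good e e' : similar e e' -> good e'.
Proof. by case=> g []. Qed.

Lemma acts_similar K e h k : acts K e h -> k \in K -> rev_of k = false ->
  similar (e ++ dom k) (e ++ ran k).
Proof. by move=> [hK _] kK k0; exists h; rewrite -k0; exact: hK. Qed.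

Lemma acts_similar_ext K e h k a : acts K e h -> k \in K ->
  good (e ++ dom k ++ a) -> a != [::] ->
  similar (e ++ dom k ++ a) (e ++ ran k ++ flipw (rev_of k) a).
Proof.
by move=> [hK _] kK ga a0; exists h; rewrite !catA in ga *; exact: maps_ext (hK k kK) ga a0.
Qed.

Lemma exists_reversal : exists h,
  acts reversal_table [::] h. Proof. exact: placed_acts is_table_reversal. Qed.
Lemma exists_circle : exists h,
  acts circle_table [::] h. Proof. exact: placed_acts is_table_circle. Qed.
Lemma exists_segment : exists h,
  acts segment_table [::] h. Proof. exact: placed_acts is_table_segment. Qed.
Lemma exists_arc : exists h, acts arc_table [:: b_d] h. Proof. exact:
  placed_acts is_table_arc. Qed.
Lemma exists_segment_p : exists h,
  acts segment_table [:: b_p] h. Proof. exact: placed_acts is_table_segment_p. Qed.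
Lemma exists_segment_pm : exists h, acts segment_table [:: b_p; b_m] h.
Proof. exact: placed_acts is_table_segment_pm. Qed.
Lemma exists_circle_p : exists h, acts circle_table [:: b_p] h.
Proof. by apply: (@placed_acts 3); vm_compute. Qed.

Lemma similar_flip a : good a -> a != [::] -> similar a (flipw true a).
Proof.
move=> ga a0; have [h hK] := exists_reversal.
exact: (@acts_similar_ext _ _ _ _ a hK (mem_head _ _)).
Qed.

(** Each line shortens a word; all lines come from the circle and segment
    generators of the whole airplane, the segment generator in the cell of [b_p],
    and the reversal. *)
Lemma similar_reductions : [/\
  [/\ similar [:: b_d; r_1] [:: b_d], similar [:: b_d; r_2] [:: b_d] &
      similar [:: b_d; r_s] [:: b_p]],
  [/\ similar [:: b_p; b_p] [:: b_p], similar [:: b_p; b_u] [:: b_d] &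
      similar [:: b_p; b_d] [:: b_d]] &
  [/\ similar [:: b_p; b_m; b_p] [:: b_p; b_m], similar [:: b_p; b_m; b_m] [:: b_p; b_m],
      similar [:: b_p; b_m; b_u] [:: b_d] & similar [:: b_p; b_m; b_d] [:: b_d]]].
Proof.
have [z zK] := exists_circle; have [y yK] := exists_segment; have [yp ypK] := exists_segment_p.
have zs k : k \in circle_table -> rev_of k = false ->
  similar (dom k) (ran k) by exact: acts_similar zK.
have ys k : k \in segment_table -> rev_of k = false ->
  similar (dom k) (ran k) by exact: acts_similar yK.
have yps k : k \in segment_table -> rev_of k = false -> similar (b_p :: dom k) (b_p :: ran k).
  exact: acts_similar ypK.
have ud : similar [:: b_u] [:: b_d] by exact: similar_flip.
have d1 : similar [:: b_d; r_1] [:: b_d] by exact: (zs ([:: b_d; r_1], [:: b_d], false)).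
have d2 : similar [:: b_d; r_2] [:: b_d].
  apply: similar_trans (zs ([:: b_d; r_2], [:: b_u; r_1], false) _ _) _ => //.
  exact: similar_trans (@similar_flip [:: b_u; r_1] _ _) d1.
have pp : similar [:: b_p; b_p] [:: b_p].
  by apply: similar_sym; exact: (ys ([:: b_p], [:: b_p; b_p], false)).
have pu : similar [:: b_p; b_u] [:: b_d].
  apply: similar_trans ud; apply: similar_sym.
  exact: (ys ([:: b_u], [:: b_p; b_u], false)).
have pd : similar [:: b_p; b_d] [:: b_d].
  by apply: similar_sym; exact: (ys ([:: b_d], [:: b_p; b_d], false)).
have pmp : similar [:: b_p; b_m; b_p] [:: b_p; b_m].
  exact: (yps ([:: b_m; b_p], [:: b_m], false)).
split; split=> //.
- exact: (zs ([:: b_d; r_s], [:: b_p], false)).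
- apply: similar_trans (@similar_flip [:: b_p; b_m; b_m] _ _) _ => //.
  by apply: similar_trans pmp;
    exact: (@acts_similar_ext _ _ _ ([:: b_m; b_m], [:: b_p; b_m], true) [:: b_m] yK).
- apply: similar_trans pd; exact: (yps ([:: b_m; b_u], [:: b_d], false)).
- apply: similar_trans pu; exact: (yps ([:: b_m; b_d], [:: b_u], false)).
Qed.

(** The reversal makes the first letter [b_d] or [b_p]; then any word but [b_d], [b_p] and
    [b_p b_m] starts with one of the longer words of [similar_reductions]. *)
Lemma similar_words w : good w -> w != [::] ->
  [\/ similar [:: b_d] w, similar [:: b_p] w | similar [:: b_p; b_m] w].
Proof.
have [[d1 d2 ds] [pp pu pd] [pmp pmm pmu pmd]] := similar_reductions.
have [n] := ubnP (size w); elim: n w => // n IH w; rewrite ltnS => wn gw w0.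
have tr u v : similar v u -> 
   [\/ similar [:: b_d] v, similar [:: b_p] v | similar [:: b_p; b_m] v] ->
   [\/ similar [:: b_d] u, similar [:: b_p] u | similar [:: b_p; b_m] u].
  move=> vu [] h; [apply: Or31|apply: Or32|apply: Or33]; exact: similar_trans vu.
have red u v a : similar u v -> v != [::] -> size v < size u -> size (u ++ a) <= n ->
    good (u ++ a) -> [\/ similar [:: b_d] (u ++ a), similar [:: b_p] (u ++ a) |
                        similar [:: b_p; b_m] (u ++ a)].
  move=> uv v0 vu un gu; have s := similar_ext uv gu; apply: tr (similar_sym s) _.
  apply: IH; [|exact: similar_good s|by case: (v) v0].
  by apply: leq_trans un; rewrite !size_cat ltn_add2r.
have first_p a : size (b_p :: a) <= n -> good (b_p :: a) ->
    [\/ similar [:: b_d] (b_p :: a), similar [:: b_p] (b_p :: a) |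
        similar [:: b_p; b_m] (b_p :: a)].
  case: a => [|[] a] // an ga; first by apply: Or32; exact: similar_refl.
  - case: a an ga => [|[] a] // an ga; first by apply: Or33; exact: similar_refl.
    + exact: (red _ _ _ pmm).
    + exact: (red _ _ _ pmp).
    + exact: (red _ _ _ pmu).
    + exact: (red _ _ _ pmd).
  - exact: (red _ _ _ pp).
  - exact: (red _ _ _ pu).
  - exact: (red _ _ _ pd).
have first_d a : size (b_d :: a) <= n -> good (b_d :: a) ->
    [\/ similar [:: b_d] (b_d :: a), similar [:: b_p] (b_d :: a) |
        similar [:: b_p; b_m] (b_d :: a)].
  case: a => [|[] a] // an ga; first by apply: Or31; exact: similar_refl.
  - exact: (red _ _ _ d1).
  - exact: (red _ _ _ d2).
  - exact: (red _ _ _ ds).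
case: w w0 wn gw => // -[] a // _ an ga.
- have fm := similar_flip ga isT; apply: tr (similar_sym fm) _.
  exact: (first_p _ an (similar_good fm)).
- exact: first_p.
- have fu := similar_flip ga isT; apply: tr (similar_sym fu) _.
  exact: (first_d _ an (similar_good fu)).
- exact: first_d.
Qed.

Lemma similar_col u v : similar u v -> col u = col v. Proof. by case=> g []. Qed.

Lemma similar_red w : good w -> col w = Red -> similar [:: b_d] w.
Proof.
move=> gw cw; have w0 : w != [::] by case: w cw {gw}.
by case: (similar_words gw w0) => // /similar_col; rewrite cw.
Qed.

Lemma similar_blue w : good w -> col w = Blue -> w != [::] ->
  similar [:: b_p] w \/ similar [:: b_p; b_m] w.
Proof.
by move=> gw cw w0; case: (similar_words gw w0); auto => /similar_col; rewrite cw.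
Qed.

(** The largest blue edge ending at the leaf is [b_m], [b_p] or hangs on a red edge, and
    these are similar to [b_p]; the smaller ones are similar to it because
    [b_p b_p] is similar to [b_p]. *)
Lemma leaf_similar w : good w -> w != [::] -> leaf (vend w true) -> similar [:: b_p] w.
Proof.
have [[_ _ ds] [pp _ _] _] := similar_reductions.
move=> gw w0 lw; have [_ _ [k wk]] := leaf_end gw w0 lw.
have powers v : similar [:: b_p] v -> similar [:: b_p] (v ++ nseq k b_p).
  move=> pv; elim: k {wk} => [|k IH]; first by rewrite cats0.
  apply: similar_trans (similar_sym pp) _; rewrite cat_nseqS -cats1.
  exact: (similar_ext (a := [:: b_p]) IH).
move: (vend w true) lw wk => V lV wk; rewrite wk in gw *.
apply: powers; move/good_catl: gw; case: V lV {wk} => //= [_ _|_ _|q _ gb].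
- exact: (@similar_flip [:: b_p]).
- exact: similar_refl.
- move: gb; rewrite good_rcons follows_col => /andP[gq fq].
  have cq : col q = Red by case: (col q) fq.
  apply: similar_trans (similar_sym ds) _; rewrite -cats1.
  exact: (similar_ext (a := [:: r_s]) (similar_red gq cq)).
Qed.

(** * Relations *)

Lemma similar_acts K e e' h : similar e e' -> acts K e h ->
  exists g : T_A, acts K e' (h ^ g).
Proof.
move=> [g ge] hK; exists g^-1; rewrite /conjg invgK mulgA; exact: acts_conj hK.
Qed.

(** In the quotient by the commutators the relations below are linear equations, which
    are solved in the quotient by [N]. *)
Section Relations.
Variable N : T_A -> Prop.
Hypotheses (N_sub : subgroup N) (N_comm : forall a b, N [~ a, b]).

Lemma N_mul a b : N a -> N b -> N (a * b). Proof. by case: N_sub => _ + _; apply. Qed.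
Lemma N_inv a : N a -> N a^-1. Proof. by case: N_sub => _ _; apply. Qed.
Lemma N_conj a b : N a -> N (a ^ b).
Proof.
by move=> Na; have -> : a ^ b = a * [~ a, b]; [rewrite commgEl mulVKg|exact: N_mul].
Qed.

Definition acts_in (K : seq entry) (e : word) : Prop := exists2 h, acts K e h & N h.

Lemma acts_in_similar K e e' : similar e e' -> acts_in K e -> acts_in K e'.
Proof.
move=> ee' [h hK Nh]; have [g gK] := similar_acts ee' hK.
by exists (h ^ g) => //; exact: N_conj.
Qed.

(** Modulo commutators this is 2a = 3a. *)
Lemma square_in (a g g' : T_A) : a * a = a ^ g * a * a ^ g' -> N a.
Proof.
move=> E; set c := [~ a, g]; set c' := [~ a, g'].
have ac : a * c = a ^ g by rewrite /c commgEl mulVKg.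
have ac' : a * c' = a ^ g' by rewrite /c' commgEl mulVKg.
have [Nc Nc'] : N c /\ N c' by split; exact: N_comm.
clearbody c c'.
have H : c * a * (a * c') = a by apply: (mulgI a);
  rewrite ac' (mulgA a (c * a)) (mulgA a c a) ac -E.
have H' : a * c' = (c * a)^-1 * a by apply: (mulgI (c * a)); rewrite mulVKg H.
have -> : a = c^-1 ^ a * c'^-1 by rewrite conjgE mulgA -invgM -H' mulgK.
by apply: N_mul; [apply: N_conj|]; exact: N_inv.
Qed.

(** The pentagon relation. *)
Lemma arc_in_base : acts_in arc_table [:: b_d].
Proof.
have [h hK] := exists_arc; exists h => //.
have [[d1 d2 _] _ _] := similar_reductions.
have [g gK] := similar_acts (similar_sym d2) hK.
have [g' g'K] := similar_acts (similar_sym d1) hK.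
have t := acts_tracks hK isT (isolated_arc _).
have t2 := acts_tracks gK isT (isolated_arc _).
have t1 := acts_tracks g'K isT (isolated_arc _).
apply: (@square_in h g g').
apply: (tracks_eq (n := 4) (tracks_mul t t) (tracks_mul (tracks_mul t2 t) t1)).
by vm_compute.
Qed.

Lemma arc_in e : good e -> col e = Red -> acts_in arc_table e.
Proof. by move=> ge ce; apply: acts_in_similar arc_in_base; exact: similar_red. Qed.

(** The pentagon relation on the circle of [e], whose halves are red edges. *)
Lemma circle_in_base e : e = [::] \/ e = [:: b_p] -> acts_in circle_table e.
Proof.
move=> ee; have [h hK] : exists h, acts circle_table e h.
  by case: ee => ->; [exact: exists_circle|exact: exists_circle_p].
exists h => //; have ge : good e by case: ee => ->.
have iz : isolated_or_fixed circle_table e.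
  case; last by apply: Or31.
  by case: ee => ->; [apply: Or32|apply: Or33].
have [xd xdK Nd] : acts_in arc_table (rcons e b_d) by apply: arc_in; case: ee => ->.
have [xu xuK Nu] : acts_in arc_table (rcons e b_u) by apply: arc_in; case: ee => ->.
have t := acts_tracks hK ge iz.
have td : tracks xd (step arc_table (rcons e b_d)) by apply:
  acts_tracks (isolated_arc _) => //; case: ee => ->.
have tu : tracks xu (step arc_table (rcons e b_u)) by apply:
  acts_tracks (isolated_arc _) => //; case: ee => ->.
have E : h * h = xu * h * xd.
  apply: (tracks_eq (n := 4) (tracks_mul t t) (tracks_mul (tracks_mul tu t) td)).
  by case: ee => ->; vm_compute.
have -> : h = xu * xd ^ h^-1 by rewrite conjgE invgK !mulgA -E mulgK.
by apply: N_mul => //; exact: N_conj.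
Qed.

Lemma circle_in e : e = [::] \/ similar [:: b_p] e -> acts_in circle_table e.
Proof.
by move=> [->|e1]; [|apply: acts_in_similar e1 _]; apply: circle_in_base; auto.
Qed.

(** Since rho^2 = 1, the relation (rho z)^3 = 1 expresses rho by conjugates of z. *)
Lemma reversal_in : acts_in reversal_table [::].
Proof.
have [r rK] := exists_reversal; exists r => //.
have [z zK Nz] : acts_in circle_table [::] by apply: circle_in; left.
have tr := acts_tracks rK isT (fun al => Or32 _ _ erefl).
have tz := acts_tracks zK isT (fun al => Or32 _ _ erefl).
have rr : r * r = 1.
  by apply: (tracks_eq (n := 1) (tracks_mul tr tr) tracks_one); vm_compute.
have trz := tracks_mul tr tz.
have rz3 : r * z * (r * z) * (r * z) = 1.
  by apply: (tracks_eq (n := 4) (tracks_mul (tracks_mul trz trz) trz) tracks_one); vm_compute.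
have r1 : r^-1 = r by apply: (mulgI r); rewrite mulgV.
have H : z ^ r * z * r * z = 1 by rewrite conjgE r1 -rz3 !mulgA.
have Nw : N (z ^ r * z) by apply: N_mul => //; exact: N_conj.
move: (z ^ r * z) H Nw => w H Nw.
have -> : r = w^-1 * z^-1.
  by apply: (mulgI w); rewrite mulVKg; apply: (mulIg z); rewrite mulVg.
by apply: N_mul; exact: N_inv.
Qed.

Variable yp : T_A.
Hypotheses (yp_acts : acts segment_table [:: b_p] yp) (N_yp : N yp).

(** The pentagon relation, where the generator in the first half appears with exponent -1
    as this half is directed backwards. *)
Lemma segment_pm_in : acts_in segment_table [:: b_p; b_m].
Proof.
have [h hK] := exists_segment_pm; exists h => //.
have [_ [pp _ _] _] := similar_reductions.
have [g gK Ng] : acts_in segment_table [:: b_p; b_p].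
  by apply: acts_in_similar (similar_sym pp) _; exists yp.
have t := acts_tracks hK isT (isolated_segment _).
have tp := acts_tracks yp_acts isT (isolated_segment _).
have tg := acts_tracks gK isT (isolated_segment _).
have E : yp * yp * h = g * yp.
  by apply: (tracks_eq (n := 5) (tracks_mul (tracks_mul tp tp) t) (tracks_mul tg tp));
    vm_compute.
have -> : h = (yp * yp)^-1 * (g * yp) by rewrite -E mulKg.
by apply: N_mul; [apply: N_inv|]; exact: N_mul.
Qed.

(** The pentagon relation for the whole airplane, both halves of which are similar to
    [b_p]. *)
Lemma segment_root_in : acts_in segment_table [::].
Proof.
have [h hK] := exists_segment; exists h => //.
have [g gK Ng] : acts_in segment_table [:: b_m].
  by apply: acts_in_similar (@similar_flip [:: b_p] isT isT) _; exists yp.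
have t := acts_tracks hK isT (isolated_segment _).
have tp := acts_tracks yp_acts isT (isolated_segment _).
have tg := acts_tracks gK isT (isolated_segment _).
have E : h * h * g = yp * h.
  by apply: (tracks_eq (n := 4) (tracks_mul (tracks_mul t t) tg) (tracks_mul tp t)); vm_compute.
have -> : h = yp * g^-1 ^ h^-1 by rewrite conjgE invgK !mulgA -E mulgK mulgK.
by apply: N_mul => //; apply: N_conj; exact: N_inv.
Qed.

Lemma segment_in e : good e -> col e = Blue -> acts_in segment_table e.
Proof.
move=> ge ce; case: (eqVneq e [::]) => [->|e0]; first exact: segment_root_in.
have [s|s] := similar_blue ge ce e0; apply: acts_in_similar s _; last exact: segment_pm_in.
by exists yp.
Qed.

End Relations.

(** * Codes and the reduction of carets *)

(** The leaves of a finite subdivision of the virtual edge. *)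
Definition code (E : seq word) : Prop :=
  [/\ {in E, forall u, good u},
      forall t, address t -> exists2 u, u \in E & exists s, t = wcat u s &
      {in E &, forall u v, prefix u v -> u = v}].

(** A code on whose cells [f] is canonical up to reversal: half of a graph pair diagram
    for [f]. *)
Definition canonical_code (f : T_A) (E : seq word) : Prop :=
  code E /\ {in E, forall u, exists v b, maps (val f) u v b}.

Lemma code_words n : code (words n).
Proof.
split=> [u|t ot|u v].
- by rewrite mem_words => /andP[].
- exists (mkseq t n); first by rewrite mem_words ot size_mkseq eqxx.
  by eexists; exact: wcat_mkseq.
- rewrite !mem_words => /andP[_ /eqP su] /andP[_ /eqP sv].
  by rewrite prefixE su -sv take_size => /eqP.
Qed.

Lemma canonical_code_exists f : exists E, canonical_code f E.
Proof.
have [k H] := rearrangement_maps (rearrangementP f).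
exists (words k); split; first exact: code_words.
move=> u; rewrite mem_words => /andP[gu /eqP su].
by have [|v fv] := H u gu; [rewrite su|exists v, false].
Qed.

Section Code.
Variables (f : T_A) (E : seq word).
Hypothesis fE : canonical_code f E.

Lemma image_free u u' v v' b b' : u \in E -> u' \in E ->
  maps (val f) u v b -> maps (val f) u' v' b' -> prefix v v' -> u = u'.
Proof.
move=> uE u'E fu fu' vv'; have [[_ _ free] _] := fE.
by case/orP: (maps_comparable (@val_injective f) fu fu' vv') => /free -> //.
Qed.

Lemma image_neq_nil u u' v b : u \in E -> u' \in E -> u <> u' ->
  maps (val f) u v b -> v != [::].
Proof.
move=> uE u'E uu' fu; have [_ /(_ _ u'E)[v' [b' fu']]] := fE.
by apply/eqP => v0; apply: uu'; apply: image_free fu fu' _; rewrite // v0 prefix0s.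
Qed.

Lemma canonical_code_mul (h : T_A) :
  (forall u v b, u \in E -> maps (val f) u v b -> exists v' b', maps (val h) v v' b') ->
  canonical_code (h * f) E.
Proof.
have [cE fE2] := fE; move=> H; split=> // u uE; have [v [b fu]] := fE2 u uE.
have [v' [b' hv]] := H _ _ _ uE fu.
by exists v', (b (+) b'); exact: maps_mul fu hv.
Qed.

End Code.

Lemma maps_merge f u v (b : bool) : good u -> good v -> col u = col v -> (b -> col u = Blue) ->
  (forall x, x \in children (col u) -> maps f (rcons u x) (rcons v (flip b x)) false) ->
  maps f u v b.
Proof.
move=> gu gv uv bu H; split=> // t ot.
have ts : t = wcat [:: t 0] (fun i => t i.+1).
  by apply/funext => -[|i]; rewrite /wcat //= subSS subn0.
have xu : t 0 \in children (col u).
  have /address_wcat[_ /(_ 1%N)] := ot; rewrite /mkseq /= andbT follows_col //.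
have := H _ xu => -[_ _ _ _ /(_ (fun i => t i.+1))].
rewrite -!cats1 !wcat_cat -ts flipS_false => -> //; congr pt; congr wcat.
by apply/funext => -[|i]; rewrite /wcat /flipS /headS //= subSS subn0.
Qed.

Lemma maps_red f u v b : maps f u v b -> col u = Red -> b = false.
Proof. by move=> [_ _ _ bu _] cu; case: b bu => // /(_ isT); rewrite cu. Qed.

Lemma prefix_cat2l (e a c : word) : prefix (e ++ a) (e ++ c) = prefix a c.
Proof. by elim: e => //= x e IH; rewrite eqxx. Qed.

Lemma code_nonempty E : code E -> exists u, u \in E.
Proof.
by move=> [_ /(_ _ (address_fixS (tail Blue true))) [u uE _] _]; exists u.
Qed.

(** Take the parent of a longest word. The word of the code covering a sibling of that word
    is not longer than the sibling, and it is not a prefix of the parent. *)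
Lemma code_caret E : code E -> [::] \notin E ->
  exists p, good p /\ {in children (col p), forall x, rcons p x \in E}.
Proof.
move=> cE E0; have [u0 u0E] := code_nonempty cE; have [gE compl free] := cE.
have [u uE um] : exists2 u, u \in E & forall v, v \in E -> size v <= size u.
  have [n] := ubnP (\max_(v <- E) size v - size u0).
  elim: n u0 u0E => // n IH u0 u0E; rewrite ltnS => le.
  have [H|] := pselect (forall v, v \in E -> size v <= size u0); first by exists u0.
  move=> /existsNP[v /not_implyP[vE /negP]]; rewrite -ltnNge => lt.
  apply: (IH v vE); apply: leq_trans le.
  have vm : size v <= \max_(v <- E) size v by exact: leq_bigmax_seq.
  by apply: ltn_sub2l => //; exact: leq_trans vm.
case/lastP: u uE um => [|p x] uE um; first by rewrite uE in E0.
have gp : good p by have := gE _ uE; rewrite good_rcons => /andP[].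
exists p; split=> // y yp.
have gy : good (rcons p y) by rewrite good_rcons gp follows_col.
have [v vE [s vs]] := compl _ (address_fill gy).
have vp : prefix v (rcons p y).
  by apply: (prefix_wcat (esym vs)); have := um _ vE; rewrite !size_rcons.
move: vp; rewrite prefixE => /eqP vp.
have : size v <= size (rcons p y) by have := um _ vE; rewrite !size_rcons.
rewrite leq_eqVlt => /orP[/eqP sv|].
  by move: vp; rewrite sv take_size => ->.
rewrite size_rcons ltnS => sv; move: vp; rewrite -cats1 takel_cat// => vp.
have E1 := free v (rcons p x) vE uE.
have /E1 vpx : prefix v (rcons p x).
  by rewrite -vp -{2}(cat_take_drop (size v) p) -cats1 -catA prefix_prefix.
by move: sv; rewrite vpx size_rcons ltnn.
Qed.

Lemma canonical_code_merge f E p q b : canonical_code f E -> good p ->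
  {in children (col p), forall x, rcons p x \in E} -> maps (val f) p q b ->
  exists E', canonical_code f E' /\ size E' < size E.
Proof.
move=> [[gE compl free] fE] gp pE fp.
pose C := [seq rcons p x | x <- children (col p)].
pose E' := p :: [seq u <- E | u \notin C]; exists E'; split; last first.
  have [x [y [xy xp yp]]] : exists x y, [/\ x != y,
    x \in children (col p) & y \in children (col p)].
    by case: (col p); [exists r_1, r_2|exists b_m, b_p].
  have C2 : 2 <= count (mem C) E.
    rewrite -size_filter; apply: (@uniq_leq_size _ [:: rcons p x; rcons p y]).
      by rewrite /= inE andbT eqseq_rcons eqxx.
    by move=> z; rewrite !inE mem_filter /= => /orP[] /eqP ->; rewrite pE// map_f.
  rewrite /= size_filter -(count_predC (mem C) E); exact: leq_add C2 (leqnn _).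
have sub u : u \in E' -> u = p \/ u \in E /\ u \notin C.
  by rewrite inE mem_filter => /orP[/eqP ->|/andP[]]; auto.
have notp u : u \in E -> u \notin C -> ~~ prefix p u /\ ~~ prefix u p.
  move=> uE uC; split; apply/negP => /prefixP[a].
    case: a => [|x a] ua.
      have [x xp] : exists x, x \in children (col p).
        by case: (col p); [exists r_1|exists b_m].
      have := free u _ uE (pE _ xp); rewrite ua cats0 prefix_rcons => /(_ isT).
      by move=> /(congr1 size); rewrite size_rcons => /eqP; rewrite ltn_eqF.
    have xp : x \in children (col p).
      by have := gE _ uE; rewrite ua good_cat /= follows_col => /and3P[].
    have := free _ u (pE _ xp) uE; rewrite ua -cat_rcons prefix_prefix => /(_ isT).
    by rewrite cat_rcons -ua => xu; case/negP: uC; rewrite -xu map_f.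
  move=> pa; have [x xp] : exists x, x \in children (col p).
    by case: (col p); [exists r_1|exists b_m].
  have xu : u = rcons p x.
    by apply: free (pE _ xp) _ => //; rewrite pa -cats1 -catA prefix_prefix.
  by case/negP: uC; rewrite xu map_f.
split; last first.
  by move=> u /sub[->|[uE _]]; [exists q, b|exact: fE].
split=> [u /sub[->//|[uE _]]|t ot|u v /sub[->|[uE uC]] /sub[->|[vE vC]]] //.
- exact: gE.
- have [u uE [s ts]] := compl t ot; case: (boolP (u \in C)) => [/mapP[x xp ux]|uC].
    by exists p; [exact: mem_head|exists (wcat [:: x] s); rewrite -wcat_cat cats1 -ux].
  by exists u; [rewrite inE mem_filter uE uC orbT|exists s].
- by have [/negP] := notp _ vE vC.
- by have [_ /negP] := notp _ uE uC.
- exact: free.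
Qed.

(** The domain of [K] is the set of leaves of a subdivision in which only the edge itself
    and [z] are subdivided; hence [K] moves every word that is not a prefix of [z]. *)
Definition covers (K : seq entry) (c : colour) (z : word) : Prop :=
  forall a, path follows (kept_letter c true) a -> ~~ prefix a z -> has (fun k =>
    prefix (dom k) a) K.

Lemma covers_arc : covers arc_table Red [:: r_1].
Proof. by case=> [|[] [|[] a]] //=; rewrite ?prefix0s ?orbT. Qed.
Lemma covers_arc_inv : covers (map swap arc_table) Red [:: r_2].
Proof. by case=> [|[] [|[] a]] //=; rewrite ?prefix0s ?orbT. Qed.
Lemma covers_segment : covers segment_table Blue [:: b_m].
Proof. by case=> [|[] [|[] a]] //=; rewrite ?prefix0s ?orbT. Qed.
Lemma covers_segment_inv : covers (map swap segment_table) Blue [:: b_p].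
Proof. by case=> [|[] [|[] a]] //=; rewrite ?prefix0s ?orbT. Qed.
Lemma covers_circle : covers circle_table Blue [:: b_d].
Proof. by case=> [|[] [|[] a]] //=; rewrite ?prefix0s ?orbT. Qed.
Lemma covers_circle_inv : covers (map swap circle_table) Blue [:: b_u].
Proof. by case=> [|[] [|[] a]] //=; rewrite ?prefix0s ?orbT. Qed.

Lemma step_some K c z e v : covers K c z -> col e = c -> good v ->
  ~~ prefix v (e ++ z) -> step K e v <> None.
Proof.
move=> cov ce gv vez; rewrite /step; case: ifPn => [/prefixP[a va]|ev].
  rewrite va drop_size_cat// cov//; last by move: vez; rewrite va prefix_cat2l.
  move: gv; rewrite va good_cat => /andP[_].
  by rewrite (@path_follows _ (kept_letter c true)) // kept_letter_colour -ce.
by case: ifPn => // ve; move: vez; rewrite (prefix_catl z ve).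
Qed.

Section Move.
Variables (f : T_A) (E : seq word).
Hypothesis fE : canonical_code f E.

(** An image word beyond [e z] shows that [e z] is subdivided in the image code, so the
    table at [e] moves all image words. *)
Lemma canonical_code_move K c z e (h : T_A) u0 c0 b0 : acts K e h -> isolated_or_fixed K e ->
  covers K c z -> col e = c -> u0 \in E -> c0 != [::] ->
  maps (val f) u0 (e ++ z ++ c0) b0 -> canonical_code (h * f) E.
Proof.
move=> hK iso cov ce u0E c00 fu0; apply: (canonical_code_mul fE) => u v b uE fu.
have [_ gv _ _ _] := fu; have [_ g0 _ _ _] := fu0.
have ge : good e := good_catl g0.
have vez : ~~ prefix v (e ++ z).
  apply/negP => vez; have uu0 : u = u0.
    by apply: (image_free fE uE u0E fu fu0); rewrite catA prefix_catl.
  subst u0; have [E1 _] := maps_uniq fu fu0.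
  move: (size_prefix vez); rewrite E1 catA size_cat -{2}[size (e ++ z)]addn0.
  by rewrite leq_add2l leqn0 size_eq0 (negPf c00).
have := step_some cov ce gv vez; case Es : (step K e v) => [[v' b']|] // _.
by exists v', b'; exact: acts_tracks Es.
Qed.

End Move.

Lemma maps_acts K e k (f h : T_A) u a b : acts K e h -> k \in K ->
  maps (val f) u (e ++ dom k ++ a) b ->
  maps (val (h * f)) u (e ++ ran k ++ flipw (rev_of k) a)
    (if a is [::] then b (+) rev_of k else b).
Proof.
move=> [hK _] kK fu; have [_ gv _ _ _] := fu; have hk := hK k kK.
case: a fu gv => [|x a] fu gv.
  by rewrite !cats0 in fu *; exact: maps_mul hk.
rewrite -[b]addbF; apply: maps_mul fu _; rewrite catA in gv *.
by rewrite [e ++ ran k ++ _]catA; exact: maps_ext gv _.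
Qed.

(** If [n] is positive, the vertex on the left is the midpoint of the word shortened by one
    letter, which remembers [x]; similarly on the right. *)
Lemma two_gon_pows w x y n m : x <> y ->
  vend (rcons w x ++ nseq n r_2) false = vend (rcons w y ++ nseq m r_1) true ->
  n = 0%N /\ m = 0%N \/ (n = 0%N /\ vend (rcons w x) false
    = v_m (rcons w y ++ nseq m.-1 r_1)) \/
  (m = 0%N /\ vend (rcons w y) true = v_m (rcons w x ++ nseq n.-1 r_2)).
Proof.
move=> xy; case: n => [|n]; case: m => [|m]; rewrite ?cats0 ?cat_nseqS ?vend_rcons /=; auto.
by move=> -[]; rewrite !cat_rcons => /cat_inj[].
Qed.

(** By the classification of the red edges at a vertex, two consecutive edges are
    [q r_1 r_2 ... r_2] and [q r_2 r_1 ... r_1], or start with the two arcs of a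
    circle. Their other ends coincide only in the second case, and only if neither
    arc is subdivided. *)
Lemma two_gon u d : good u -> good d -> col u = Red -> col d = Red ->
  vend u true = vend d false -> vend u false = vend d true ->
  exists w (b : bool), u = rcons w (flip b b_u) /\ d = rcons w (flip b b_d).
Proof.
move=> gu gd cu cd E1 E2.
have [n un] := red_tgt gu cu; have [m dm] := red_src gd cd; rewrite -E1 in dm.
have nil_red x k : good (nseq k x) -> col (nseq k x) = Red -> x \in [:: r_1; r_2] -> False.
  by case: k => [//|k]; rewrite good_cons => /andP[]; case: x.
have tooold w al v : vend w al = v_m v -> size w <= size v -> False.
  by move=> wv; have := @vend_creator w al v; rewrite wv => /(_ erefl); rewrite ltnNge => /negP.
case: (vend u true) un dm => [||||q|q|q|q] /= un dm; try by
  case: (@nil_red r_2 n); rewrite -?un.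
- have {}E2 : vend (rcons q r_1 ++ nseq n r_2) false = vend (rcons q r_2 ++ nseq m r_1) true.
    by rewrite -un -dm.
  have [[n0 m0]|[[_]|[_]]] := two_gon_pows (fun e : r_1 = r_2 => ltac:(done)) E2.
  + by move: E2; rewrite n0 m0 !cats0 !vend_rcons => /vend_neq.
  + by rewrite vend_rcons => /tooold;
    rewrite size_cat size_rcons addSn -addnS leq_addr => /(_ isT).
  + by rewrite vend_rcons => /tooold;
    rewrite size_cat size_rcons addSn -addnS leq_addr => /(_ isT).
- have {}E2 : vend (rcons q b_u ++ nseq n r_2) false = vend (rcons q b_d ++ nseq m r_1) true.
    by rewrite -un -dm.
  have [[n0 m0]|[[_]|[_]]] := two_gon_pows (fun e : b_u = b_d => ltac:(done)) E2.
  + by exists q, false; rewrite un dm n0 m0 !cats0.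
  + by rewrite vend_rcons.
  + by rewrite vend_rcons.
- have {}E2 : vend (rcons q b_d ++ nseq n r_2) false = vend (rcons q b_u ++ nseq m r_1) true.
    by rewrite -un -dm.
  have [[n0 m0]|[[_]|[_]]] := two_gon_pows (fun e : b_d = b_u => ltac:(done)) E2.
  + by exists q, true; rewrite un dm n0 m0 !cats0.
  + by rewrite vend_rcons.
  + by rewrite vend_rcons.
Qed.

Section Reduction.
Variable N : T_A -> Prop.
Hypotheses (N_sub : subgroup N) (N_comm : forall a b, N [~ a, b]).
Variable yp : T_A.
Hypotheses (yp_acts : acts segment_table [:: b_p] yp) (N_yp : N yp).

(** ** Red carets *)

Section Red.
Variables (E : seq word) (p : word).
Hypotheses (gp : good p) (cp : col p = Red).
Hypotheses (E1 : rcons p r_1 \in E) (E2 : rcons p r_2 \in E) (Es : rcons p r_s \in E).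

(** After a move in [N] the caret at [p] can be merged. *)
Definition red_reducible (f : T_A) : Prop :=
  exists2 h, N h & canonical_code (h * f) E /\ exists q, maps (val (h * f)) p q false.

Lemma red_reducible_mul h f : N h -> red_reducible (h * f) -> red_reducible f.
Proof.
move=> Nh [g Ng [gE [q gq]]]; exists (g * h); first exact: N_mul.
by rewrite -mulgA; split=> //; exists q.
Qed.

(** The images meet at the midpoint of [q]. As long as one of them is not a half of
    [q], the generator at [q] or its inverse shortens it by one letter and
    moves the configuration to a half of [q]. *)
Lemma red_same_arc n m q f : canonical_code f E ->
  maps (val f) (rcons p r_1) (q ++ r_1 :: nseq n r_2) false ->
  maps (val f) (rcons p r_2) (q ++ r_2 :: nseq m r_1) false ->
  maps (val f) (rcons p r_s) (q ++ [:: r_s]) false -> red_reducible f.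
Proof.
have [k] := ubnP (n + m); elim: k n m q f => // k IH n m q f.
rewrite ltnS => nm fE f1 f2 fs.
have [_ gq _ _ _] := fs; move: gq; rewrite good_cat /= => /and3P[gq qs _].
have cq : col q = Red by move: qs; rewrite follows_col; case: (col q).
case: n nm f1 => [|n] nm f1; last first.
  have [h hK Nh] := arc_in N_sub N_comm gq cq; apply: (red_reducible_mul Nh).
  apply: (IH n m (q ++ [:: r_2])).
  - by rewrite addSn in nm.
  - exact: (canonical_code_move fE hK (isolated_arc q) covers_arc cq E1 (c0 := r_2 ::
    nseq n r_2)) f1.
  - rewrite -catA; have := @maps_acts _ _ ([:: r_1; r_2], [:: r_2;
    r_1], false) f h _ (nseq n r_2) _ hK _ f1.
    by rewrite flipw_false; case: (nseq n r_2) => [|y w]; apply.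
  - rewrite -catA; have := @maps_acts _ _ ([:: r_2], [:: r_2;
    r_2], false) f h _ (nseq m r_1) _ hK _ f2.
    by rewrite flipw_false; case: (nseq m r_1) => [|y w]; apply.
  - by rewrite -catA; exact: (@maps_acts _ _ ([:: r_s], [:: r_2;
    r_s], false) f h _ [::] _ hK _ fs).
case: m nm f2 => [|m] nm f2; last first.
  have [h hK Nh] := arc_in N_sub N_comm gq cq; apply: (red_reducible_mul (N_inv N_sub Nh)).
  move/acts_inv: hK => hK; apply: (IH 0%N m (q ++ [:: r_1])).
  - by rewrite addnS in nm.
  - exact: (canonical_code_move fE hK (isolated_arc_inv q) covers_arc_inv cq E2 (c0 := r_1
    :: nseq m r_1)) f2.
  - by rewrite -catA; exact: (@maps_acts _ _ ([:: r_1], [:: r_1;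
    r_1], false) f h^-1 _ [::] _ hK _ f1).
  - rewrite -catA; have := @maps_acts _ _ ([:: r_2; r_1], [:: r_1;
    r_2], false) f h^-1 _ (nseq m r_1) _ hK _ f2.
    by rewrite flipw_false; case: (nseq m r_1) => [|y w]; apply.
  - by rewrite -catA; exact: (@maps_acts _ _ ([:: r_s], [:: r_1;
    r_s], false) f h^-1 _ [::] _ hK _ fs).
exists 1; first by case: N_sub.
rewrite mul1g; split=> //; exists q; apply: maps_merge => //; rewrite cp => // x.
by rewrite !inE => /or3P[] /eqP ->; rewrite -[rcons q _]cats1.
Qed.

Lemma red_middle : end_pt (rcons p r_1) true = end_pt (rcons p r_2) false /\
  end_pt (rcons p r_s) false = end_pt (rcons p r_1) true.
Proof.
have gr x : x \in children Red -> good (rcons p x) by rewrite good_rcons gp follows_col cp.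
by split; apply/end_ptP; rewrite ?gr// !vend_rcons.
Qed.

(** The images meet where the outer edge of [w] is attached to the circle of [w]. The
    circle generator turns this point into the midpoint of an arc. It is available
    because that outer edge ends in a leaf; and one of the arcs is subdivided, for
    otherwise the circle would have two edges only and [p] would be a loop. *)
Lemma red_junction n m w f : canonical_code f E -> w = [::] \/ leaf (vend w true) ->
  maps (val f) (rcons p r_1) (w ++ b_d :: nseq n r_2) false ->
  maps (val f) (rcons p r_2) (w ++ b_u :: nseq m r_1) false ->
  maps (val f) (rcons p r_s) (w ++ [:: b_p]) false -> red_reducible f.
Proof.
move=> fE lw f1 f2 fs.
have [_ gw _ _ _] := fs; move: gw; rewrite good_cat /= => /and3P[gw ws _].
have cw : col w = Blue by move: ws; rewrite follows_col; case: (col w).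
have iz : isolated_or_fixed circle_table w.
  by case; [case: lw => lw; [apply: Or32|apply: Or33]|apply: Or31].
have iz' : isolated_or_fixed (map swap circle_table) w.
  by case; [case: lw => lw; [apply: Or32|apply: Or33]|apply: Or31].
have [h hK Nh] : acts_in N circle_table w.
  apply: circle_in => //; case: lw => [|lw]; first by left.
  case: (eqVneq w [::]) => [|w0]; first by left.
  by right; exact: leaf_similar.
case: n f1 => [|n] f1.
  case: m f2 => [|m] f2.
    (* the circle of [w] has two edges only *)
    have [mid _] := red_middle; have := @vend_neq p.
    have gr x : x \in children Red -> good (rcons p x) by rewrite good_rcons gp follows_col cp.
    have : end_pt (rcons p r_2) true = end_pt (rcons p r_1) false.
      apply: (@val_injective f); rewrite (maps_end true f2) (maps_end false f1).
      have [_ g2 _ _ _] := f2; have [_ g1 _ _ _] := f1.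
      by apply/end_ptP => //=; rewrite !cats1 !vend_rcons.
    by move/end_ptP; rewrite !gr// => /(_ isT isT); rewrite !vend_rcons /= => ->.
  apply: (red_reducible_mul (N_inv N_sub Nh)); move/acts_inv: hK => hK.
  apply: (@red_same_arc 0 m (w ++ [:: b_d])).
  - exact: (canonical_code_move fE hK iz' covers_circle_inv cw E2 (c0 := r_1 :: nseq m r_1)) f2.
  - by rewrite -catA; exact: (@maps_acts _ _ ([:: b_d], [:: b_d;
    r_1], false) f h^-1 _ [::] _ hK _ f1).
  - rewrite -catA; have := @maps_acts _ _ ([:: b_u; r_1], [:: b_d;
    r_2], false) f h^-1 _ (nseq m r_1) _ hK _ f2.
    by rewrite flipw_false; case: (nseq m r_1) => [|y v]; apply.
  - by rewrite -catA; exact: (@maps_acts _ _ ([:: b_p], [:: b_d;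
    r_s], false) f h^-1 _ [::] _ hK _ fs).
apply: (red_reducible_mul Nh); apply: (@red_same_arc n m (w ++ [:: b_u])).
- exact: (canonical_code_move fE hK iz covers_circle cw E1 (c0 := r_2 :: nseq n r_2)) f1.
- rewrite -catA; have := @maps_acts _ _ ([:: b_d; r_2], [:: b_u;
  r_1], false) f h _ (nseq n r_2) _ hK _ f1.
  by rewrite flipw_false; case: (nseq n r_2) => [|y v]; apply.
- rewrite -catA; have := @maps_acts _ _ ([:: b_u], [:: b_u;
  r_2], false) f h _ (nseq m r_1) _ hK _ f2.
  by rewrite flipw_false; case: (nseq m r_1) => [|y v]; apply.
- by rewrite -catA; exact: (@maps_acts _ _ ([:: b_p], [:: b_u;
  r_s], false) f h _ [::] _ hK _ fs).
Qed.

(** The blue child of [p] ends in a leaf, and so does its image. Its other end is on a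
    circle, which gives the three cases: the midpoint of an arc, the outer vertex of a
    circle, and, for the circle of the whole airplane only, the inner vertex. *)
Lemma red_caret f : canonical_code f E -> red_reducible f.
Proof.
move=> fE; have [_ fm] := fE.
have d3 : rcons p r_s <> rcons p r_1 by move=> /rcons_inj[].
have [mid mid'] := red_middle.
have [v1 [b1 f1]] := fm _ E1; have [v2 [b2 f2]] := fm _ E2; have [vs [b fs]] := fm _ Es.
have b10 := maps_red f1 (col_rcons _ _); have b20 := maps_red f2 (col_rcons _ _).
subst b1 b2; have [_ g1 c1 _ _] := f1; have [_ g2 c2 _ _] := f2; have [_ gs cs _ _] := fs.
have vs0 : vs != [::] := image_neq_nil fE Es E1 d3 fs.
have ps0 : rcons p r_s != [::] by case: (p).
have rf : is_rearrangement (val f^-1) := rearrangementP _.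
have lvs : leaf (vend vs (true (+) b)).
  by apply: (maps_leaf (al := true) rf (val_invK f) (inv_valK f) ps0 fs); rewrite vend_rcons.
have [bF cvs _] := leaf_end gs vs0 lvs; have b0 : b = false by case: (b) bF.
subst b; clear bF; simpl in lvs.
have V1 : vend v2 false = vend v1 true.
  by apply/end_ptP => //; rewrite -[v2 in LHS]/(v2) -(maps_end false f2) -(maps_end true
    f1) mid.
have V2 : vend vs false = vend v1 true.
  by apply/end_ptP => //; rewrite -(maps_end false fs) -(maps_end true f1) mid'.
have [n v1n] := red_tgt g1 (esym (etrans (esym (col_rcons p r_1)) c1)).
have [m v2m] := red_src g2 (esym (etrans (esym (col_rcons p r_2)) c2)).
have vsE := blue_src gs cvs vs0.
rewrite V1 in v2m; rewrite V2 in vsE.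
case: (vend v1 true) v1n v2m vsE V1 V2 => [||||q|q|q|q] /= v1n v2m vsE V1 V2;
  try by rewrite vsE in vs0.
- rewrite v1n cat_rcons in f1; rewrite v2m cat_rcons in f2; rewrite vsE -[rcons q _]cats1 in fs.
  exact: (@red_same_arc n m q f fE f1 f2 fs).
- have q0 : q = [::].
    apply/eqP; apply: contraT => q0; move: lvs; rewrite vsE vend_rcons /= => lq.
    have gq : good q by move: gs; rewrite vsE good_rcons => /andP[].
    by have [] := leaf_end gq q0 lq.
  subst q; have [r rK Nr] := reversal_in N_sub N_comm; apply: (red_reducible_mul Nr).
  have rE : canonical_code (r * f) E.
    apply: (canonical_code_mul fE) => u v b uE fu; have [_ gv _ _ _] := fu.
    have [hr _] := rK; have := hr _ (mem_head _ _) => /= hr1.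
    case: (eqVneq v [::]) => [->|v0]; first by exists [::], true.
    by exists (flipw true v), false; exact: (maps_ext hr1 gv v0).
  apply: (@red_junction n m [::] (r * f) rE); first by left.
  - have := @maps_acts _ _ ([::], [::], true) f r _ v1 _ rK (mem_head _ _) f1.
    by rewrite v1n.
  - have := @maps_acts _ _ ([::], [::], true) f r _ v2 _ rK (mem_head _ _) f2.
    by rewrite v2m.
  - have := @maps_acts _ _ ([::], [::], true) f r _ vs _ rK (mem_head _ _) fs.
    by rewrite vsE.
- rewrite vsE vend_rcons /= in lvs.
  rewrite v1n cat_rcons in f1; rewrite v2m cat_rcons in f2; rewrite vsE -[rcons q _]cats1 in fs.
  exact: (@red_junction n m q f fE (or_intror lvs) f1 f2 fs).
Qed.

End Red.

(** ** Blue carets *)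

Section Blue.
Variables (E : seq word) (p : word).
Hypotheses (gp : good p) (cp : col p = Blue).
Hypothesis pE : {in children Blue, forall x, rcons p x \in E}.

(** The blue edge [v], reversed if [b], is attached to the circle of [w] at the
    vertex where [w y] starts: it is [w y] itself, or, when [w y] has been
    replaced [n] times, the edge next to that vertex. *)
Definition attached (w : word) (y : letter) (v : word) (b : bool) (n : nat) : Prop :=
  if n is n'.+1 then v = w ++ y :: b_m :: nseq n' b_p /\ b = true
  else v = w ++ [:: y] /\ b = false.

(** The circle of [p] has been mapped to that of [w], reversed if [be]; what remains is
    that the two blue children of [p] may be mapped to edges inside the blue
    children of [w], at depths [n] and [m]. *)
Definition circle_state (f : T_A) (w : word) (be : bool) (n m : nat) : Prop :=
  [/\ canonical_code f E,
      maps (val f) (rcons p (flip be b_u)) (w ++ [:: b_u]) false,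
      maps (val f) (rcons p (flip be b_d)) (w ++ [:: b_d]) false,
      exists v b, maps (val f) (rcons p (flip be b_m)) v b /\ attached w b_m v b n &
      exists v b, maps (val f) (rcons p (flip be b_p)) v b /\ attached w b_p v b m].

Definition blue_reducible (f : T_A) : Prop :=
  exists2 h, N h & canonical_code (h * f) E /\ exists q b, maps (val (h * f)) p q b.

Lemma blue_reducible_mul h f : N h -> blue_reducible (h * f) -> blue_reducible f.
Proof.
move=> Nh [g Ng [gE [q gq]]]; exists (g * h); first exact: N_mul.
by rewrite -mulgA; split=> //; exists q.
Qed.

Lemma circle_state_good f w be n m : circle_state f w be n m -> good w /\ col w = Blue.
Proof.
move=> [_ [_ + _ _ _] _ _ _]; rewrite good_cat /= => /and3P[gw ws _].
by split=> //; move: ws; rewrite follows_col; case: (col w).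
Qed.

Lemma flip_child be x : x \in children Blue -> rcons p (flip be x) \in E.
Proof. by move=> xB; apply: pE; move: xB; case: be; case: x. Qed.

(** The segment generator at [w] moves the circle of [w] to that of [w b_p]. *)
Lemma circle_step f w be n m (h : T_A) : acts segment_table w h -> circle_state f w be n.+1 m ->
  circle_state (h * f) (w ++ [:: b_p]) be n m.
Proof.
move=> hK st; have [gw cw] := circle_state_good st.
have [fE fu fd [v [b [fv [vE bE]]]] [v' [b' [fv' av']]]] := st.
subst v b; split.
- exact: (canonical_code_move fE hK (isolated_segment w) covers_segment cw (flip_child be
  (x := b_m) _) (c0 := b_m :: nseq n b_p)) fv.
- by rewrite -catA; exact: (@maps_acts _ _ ([:: b_u], [:: b_p;
  b_u], false) f h _ [::] _ hK _ fu).
- by rewrite -catA; exact: (@maps_acts _ _ ([:: b_d], [:: b_p;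
  b_d], false) f h _ [::] _ hK _ fd).
- have := @maps_acts _ _ ([:: b_m; b_m], [:: b_p; b_m], true) f h _ (nseq n b_p) _ hK _ fv.
  case: n {fv st} => [|n] H.
    by exists (w ++ [:: b_p; b_m]), false; split; [exact: H|rewrite /attached -catA].
  by exists (w ++ [:: b_p, b_m, b_m & nseq n b_p]), true; split;
    [exact: H|rewrite /attached -catA].
- case: m av' {st} => [|m] [v'E b'E]; subst v' b'.
    exists (w ++ [:: b_p; b_p]), false; split; last by rewrite /attached -catA.
    exact: (@maps_acts _ _ ([:: b_p], [:: b_p; b_p], false) f h _ [::] _ hK _ fv').
  exists (w ++ [:: b_p, b_p, b_m & nseq m b_p]), true; split; last by rewrite /attached -catA.
  exact: (@maps_acts _ _ ([:: b_p], [:: b_p; b_p], false) f h _ (b_m :: nseq m b_p) _ hK _ fv').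
Qed.

(** The inverse moves it to the circle of [w b_m], which is traversed backwards. *)
Lemma circle_step_inv f w be m (h : T_A) : acts segment_table w h ->
  circle_state f w be 0 m.+1 ->
  circle_state (h^-1 * f) (w ++ [:: b_m]) (~~ be) m 0.
Proof.
move=> hK st; have [gw cw] := circle_state_good st.
have [fE fu fd [v [b [fv [vE bE]]]] [v' [b' [fv' [v'E b'E]]]]] := st.
subst v b v' b'; move/acts_inv: hK => hK.
have [flu fld flm flp] : [/\ flip (~~ be) b_u = flip be b_d, flip (~~ be) b_d = flip be b_u,
   flip (~~ be) b_m = flip be b_p & flip (~~ be) b_p = flip be b_m] by case: (be).
rewrite /circle_state flu fld flm flp; split.
- exact: (canonical_code_move fE hK (isolated_segment_inv w) covers_segment_inv cw
  (flip_child be (x := b_p) _) (c0 := b_m :: nseq m b_p)) fv'.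
- by rewrite -catA; exact: (@maps_acts _ _ ([:: b_d], [:: b_m;
  b_u], false) f h^-1 _ [::] _ hK _ fd).
- by rewrite -catA; exact: (@maps_acts _ _ ([:: b_u], [:: b_m;
  b_d], false) f h^-1 _ [::] _ hK _ fu).
- have := @maps_acts _ _ ([:: b_p; b_m], [:: b_m; b_m], true) f h^-1 _ (nseq m b_p) _ hK _ fv'.
  case: m {fv' st} => [|m] H.
    by exists (w ++ [:: b_m; b_m]), false; split; [exact: H|rewrite /attached -catA].
  by exists (w ++ [:: b_m, b_m, b_m & nseq m b_p]), true; split;
    [exact: H|rewrite /attached -catA].
- exists (w ++ [:: b_m; b_p]), false; split; last by rewrite /attached -catA.
  exact: (@maps_acts _ _ ([:: b_m], [:: b_m; b_p], false) f h^-1 _ [::] _ hK _ fv).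
Qed.

Lemma circle_reducible f w be n m : circle_state f w be n m -> blue_reducible f.
Proof.
have [k] := ubnP (n + m); elim: k f w be n m => // k IH f w be n m; rewrite ltnS => nm st.
have [gw cw] := circle_state_good st.
have [h hK Nh] := segment_in N_sub N_comm yp_acts N_yp gw cw.
case: n nm st => [|n] nm st; last first.
  by apply: (blue_reducible_mul Nh); apply: (IH _ _ _ n m) (circle_step hK st).
case: m nm st => [|m] nm st; last first.
  apply: (blue_reducible_mul (N_inv N_sub Nh)); apply: (IH _ _ _ m 0%N) (circle_step_inv hK st).
  by rewrite addn0.
have [fE fu fd [v [b [fv [vE bE]]]] [v' [b' [fv' [v'E b'E]]]]] := st.
subst v b v' b'; exists 1; first by case: N_sub.
rewrite mul1g; split=> //; exists w, be; apply: maps_merge; rewrite ?cp// => x.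
rewrite !cats1 in fu fd fv fv'.
by clear st; case: be fu fd fv fv' => fu fd fv fv'; rewrite !inE => /or4P[] /eqP ->.
Qed.

Lemma blue_caret f : canonical_code f E -> blue_reducible f.
Proof.
move=> fE; have [_ fm] := fE.
have [vu [bu fu]] := fm _ (pE (x := b_u) isT); have [vd [bd fd]] := fm _ (pE (x := b_d) isT).
have [vm [bm fvm]] := fm _ (pE (x := b_m) isT); have [vp [bp fvp]] := fm _ (pE (x := b_p) isT).
have bu0 := maps_red fu (col_rcons _ _); have bd0 := maps_red fd (col_rcons _ _).
subst bu bd; have [_ gu cu _ _] := fu; have [_ gd cd _ _] := fd.
have [gcm gm cm _ _] := fvm; have [gcp gp' cp' _ _] := fvp.
rewrite col_rcons /= in cu; rewrite col_rcons /= in cd.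
rewrite col_rcons /= in cm; rewrite col_rcons /= in cp'.
have gc x : x \in children Blue -> good (rcons p x) by rewrite good_rcons gp follows_col cp.
have ends x y al be v w b b' : maps (val f) (rcons p x) v b -> maps (val f) (rcons p y) w b' ->
    vend (rcons p x) al = vend (rcons p y) be -> vend v (al (+) b) = vend w (be (+) b').
  move=> fx fy E1; have [gx gv _ _ _] := fx; have [gy gw _ _ _] := fy.
  by apply/end_ptP => //; rewrite -(maps_end al fx) -(maps_end be fy); congr (val f _);
    apply/end_ptP.
have nm : vm != [::].
  by apply: (image_neq_nil fE (pE (x := b_m) isT) (pE (x := b_p) isT) _ fvm) => /rcons_inj[].
have np : vp != [::].
  by apply: (image_neq_nil fE (pE (x := b_p) isT) (pE (x := b_m) isT) _ fvp) => /rcons_inj[].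
have [w [be [wu wd]]] : exists w (b : bool),
  vu = rcons w (flip b b_u) /\ vd = rcons w (flip b b_d).
  apply: two_gon => //.
    by apply: (ends _ _ true false _ _ _ _ fu fd); rewrite !vend_rcons.
  by apply: (ends _ _ false true _ _ _ _ fu fd); rewrite !vend_rcons.
have Em : vend vm bm = vend vd false.
  by apply: (ends _ _ false false _ _ _ _ fvm fd); rewrite !vend_rcons.
have Ep : vend vp bp = vend vu false.
  by apply: (ends _ _ false false _ _ _ _ fvp fu); rewrite !vend_rcons.
rewrite wd in Em; rewrite wu in Ep.
have att v b y : good v -> col v = Blue -> v != [::] -> y \in [:: b_m; b_p] ->
    vend v b = (if y is b_m then v_x w else v_y w) -> exists n, attached w y v b n.
  move=> gv cv v0 yB; case: b => E1.
    have [n vn] := blue_tgt gv cv v0; exists n.+1; split=> //; rewrite vn E1.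
    by move: yB; rewrite !inE => /orP[] /eqP ->; rewrite /= -!cats1 -!catA.
  exists 0%N; split=> //; rewrite (blue_src gv cv v0) E1.
  by move: yB; rewrite !inE => /orP[] /eqP ->; rewrite cats1.
have [n am] : exists n, attached w (flip be b_m) vm bm n.
  by apply: att => //; rewrite ?Em ?vend_rcons; case: (be).
have [m ap] : exists n, attached w (flip be b_p) vp bp n.
  by apply: att => //; rewrite ?Ep ?vend_rcons; case: (be).
rewrite wu in fu; rewrite wd in fd.
case: be {wu wd Em Ep} fu fd am ap => /= fu fd am ap.
  apply: (@circle_reducible f w true m n); split; rewrite ?cats1 //.
    by exists vp, bp.
  by exists vm, bm.
apply: (@circle_reducible f w false n m); split; rewrite ?cats1 //.
  by exists vm, bm.
by exists vp, bp.
Qed.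

End Blue.

(** ** Generation by commutators and one element *)

(** The image of [f] is everything, and only the empty word is a prefix of all addresses. *)
Lemma maps_nil (f : T_A) v b : maps (val f) [::] v b -> v = [::].
Proof.
move=> fv; have [_ gv cv _ H] := fv; case: v gv cv H fv => // x v gv cv H fv.
have pre y : y \in children Blue -> x = y.
  move=> yB; have gy : good [:: y] by rewrite good_cons yB.
  have [s os sE] := pt_surj (val f^-1 (pt (wcat [:: y] (fill (col [:: y]))))).
  have os' : address (wcat [::] s) by rewrite wcat0.
  have := H s os'; rewrite wcat0 -sE inv_valK.
  move=> /(regular_pt (address_fill gy) (address_move b gv cv os') (regular_fill _ _)).
  by move=> /(congr1 (fun t => t 0%N)) /esym.
by have := pre b_m isT; rewrite (pre b_p isT).
Qed.

(** Induction on the size of a code for [f]; a code containing the empty word leaves only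
    the identity and the reversal. *)
Theorem generation f : N f.
Proof.
have [E] := canonical_code_exists f; have [n] := ubnP (size E).
elim: n E f => // n IH E f; rewrite ltnS => En fE; have [cE fm] := fE.
have mul h : N h -> N (h * f) -> N f.
  by move=> Nh Nhf; rewrite -(mulKg h f); apply: N_mul => //; exact: N_inv.
case: (boolP ([::] \in E)) => [E0|E0].
  have [v [b fv]] := fm _ E0; have v0 := maps_nil fv; subst v.
  have [r [rK _] Nr] := reversal_in N_sub N_comm; have := rK _ (mem_head _ _) => /= rm.
  have [_ _ _ _ H] := fv; have [_ _ _ _ Hr] := rm.
  case: b fv H => fv H.
    have -> : f = r.
      apply: val_inj; apply/funext => a; have [t ot ->] := pt_surj a.
      have ot' : address (wcat [::] t) by rewrite wcat0.
      have Er : val r (pt (wcat [::] t)) = pt (wcat [::] (flipS true t)) := Hr t ot'.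
      by have := H t ot'; rewrite -Er wcat0.
    exact: Nr.
  have -> : f = 1; last by case: N_sub.
  apply: val_inj; apply/funext => a; have [t ot ->] := pt_surj a.
  have ot' : address (wcat [::] t) by rewrite wcat0.
  by have := H t ot'; rewrite flipS_false wcat0.
have [p [gp pE]] := code_caret cE E0.
case cp : (col p) pE => pE.
  have [h Nh [hE [q hq]]] := red_caret gp cp (pE r_1 isT) (pE r_2 isT) (pE r_s isT) fE.
  apply: (mul h Nh); rewrite -cp in pE.
  have [E' [fE' E'E]] := canonical_code_merge hE gp pE hq.
  by apply: IH fE'; exact: leq_trans En.
have [h Nh [hE [q [b hq]]]] := blue_caret gp cp pE fE.
apply: (mul h Nh); rewrite -cp in pE.
have [E' [fE' E'E]] := canonical_code_merge hE gp pE hq.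
by apply: IH fE'; exact: leq_trans En.
Qed.

End Reduction.

Import GRing.Theory.
Local Open Scope classical_set_scope.
Local Open Scope ring_scope.

(** * The total slope at the extremal points *)

(** The largest blue edge ending at each leaf vertex; tips stand for extremal points. *)
Definition tips : set word := [set q | [/\ good q, q != [::],
  leaf (vend q true) & q = blue_tgt_word (vend q true)]].

(** The derivative of [f] at the extremal point of [q], in logarithmic form: [f] sends
    this point to that of [q'] and changes the depth by [d]. *)
Definition slope_at (f : T_A) (q q' : word) (d : int) : Prop :=
  exists n n', maps (val f) (q ++ nseq n b_p) (q' ++ nseq n' b_p) false /\
    d = (n' : int) - (n : int).

Lemma nseqD (n m : nat) (x : letter) : nseq n x ++ nseq m x = nseq (n + m) x.
Proof. by elim: n => //= n ->. Qed.

Lemma tip_col q : tips q -> col q = Blue.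
Proof. by move=> [gq q0 lq _]; have [] := leaf_end gq q0 lq. Qed.

Lemma tail_nseq n : mkseq (tail Blue true) n = nseq n b_p.
Proof. by elim: n => // n IH; rewrite mkseq_tailS IH. Qed.

Lemma tip_pow q n : tips q -> good (q ++ nseq n b_p) /\ vend (q ++ nseq n b_p) true
  = vend q true.
Proof.
move=> tq; have cq := tip_col tq; have [gq _ _ _] := tq.
have [g [v _]] := good_tail_gen true n gq; rewrite cq tail_nseq// in g v; split=> //.
by rewrite -v; congr vend; elim: (n).
Qed.

Lemma tip_of_leaf w : good w -> w != [::] -> leaf (vend w true) ->
  exists q n, tips q /\ w = q ++ nseq n b_p.
Proof.
move=> gw w0 lw; have [_ cw [n wn]] := leaf_end gw w0 lw.
exists (blue_tgt_word (vend w true)), n; split=> //.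
set q := blue_tgt_word _ in wn *; have gq : good q by move: gw; rewrite wn => /good_catl.
have cq : col q = Blue by rewrite /q; case: (vend w true) lw => // v _; rewrite col_rcons.
have vq : vend q true = vend w true.
  have [_ [v _]] := good_tail_gen true n gq; rewrite cq tail_nseq// -wn in v.
  by rewrite -v; congr vend; elim: (n).
by split; rewrite ?vq// /q; case: (vend w true) lw => // v _; case: v.
Qed.

(** Both descriptions hold on a sufficiently small cell, where the image word is
    unique. *)
Lemma slope_uniq f q q1 q2 d1 d2 : tips q -> tips q1 -> tips q2 ->
  slope_at f q q1 d1 -> slope_at f q q2 d2 -> q1 = q2 /\ d1 = d2.
Proof.
move=> tq t1 t2 [n1 [m1 [f1 ->]]] [n2 [m2 [f2 ->]]].
wlog le : n1 n2 m1 m2 q1 q2 t1 t2 f1 f2 / (n1 <= n2)%N => [W|].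
  have [le|/ltnW le] := leqP n1 n2; first exact: W.
  by have [-> ->] := W _ _ _ _ _ _ t2 t1 f2 f1 le.
have g1 : good ((q ++ nseq n1 b_p) ++ nseq (n2 - n1) b_p).
  by rewrite -catA nseqD subnKC//; have [] := tip_pow n2 tq.
have := maps_ext0 f1 g1; rewrite -!catA !nseqD subnKC// => f1'.
have [E _] := maps_uniq f1' f2.
have q12 : q1 = q2.
  have [_ v1] := tip_pow (m1 + (n2 - n1))%N t1; have [_ v2] := tip_pow m2 t2.
  by case: (t1) => _ _ _ ->; case: (t2) => _ _ _ ->; rewrite -v1 -v2 E.
split=> //; rewrite q12 in E; have /(congr1 size) := cat_inj E; rewrite !size_nseq => <-.
by rewrite PoszD -subzn// -addrA addrAC subrr add0r.
Qed.

Lemma slope_exists f q : tips q -> exists q' d, tips q' /\ slope_at f q q' d.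
Proof.
move=> tq; have [k H] := rearrangement_maps (rearrangementP f).
have [g v] := tip_pow k tq; have [||w fw] := H (q ++ nseq k b_p) => //.
  by rewrite size_cat size_nseq leq_addl.
have [gq q0 lq _] := tq; have [_ gw _ _ _] := fw.
have qk0 : q ++ nseq k b_p != [::] by case: (q) q0.
have w0 : w != [::].
  apply/eqP => w0; have := maps_invg fw; rewrite w0 => /maps_nil qk.
  by rewrite qk in qk0.
have lw : leaf (vend w true).
  apply: (maps_leaf (al := true) (rearrangementP f^-1%g) (@val_invK f) (@inv_valK f) qk0 fw).
  by rewrite v.
have [q' [n [tq' wq']]] := tip_of_leaf gw w0 lw.
by exists q', ((n : int) - (k : int)); split=> //; exists k, n; rewrite -wq'.
Qed.

Lemma slope_choice f q : exists qd : word * int, tips q -> tips qd.1 /\ slope_at f q qd.1 qd.2.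
Proof.
have [tq|nq] := pselect (tips q); last by exists (q, 0).
by have [q' [d H]] := slope_exists f tq; exists (q', d).
Qed.

Definition tip_image (f : T_A) (q : word) : word := (projT1 (cid (slope_choice f q))).1.
Definition slope (f : T_A) (q : word) : int := (projT1 (cid (slope_choice f q))).2.

Lemma tip_imageP f q : tips q -> tips (tip_image f q) /\ slope_at f q (tip_image f q)
  (slope f q).
Proof. by rewrite /tip_image /slope; case: cid => qd H /H. Qed.

Lemma slopeE f q q' d : tips q -> tips q' -> slope_at f q q' d ->
  tip_image f q = q' /\ slope f q = d.
Proof. by move=> tq tq' H; have [t1 H1] := tip_imageP f tq; exact: slope_uniq H1 H. Qed.

Lemma slope_at_mul (f g : T_A) q q' q'' d d' : tips q -> tips q' -> tips q'' ->
  slope_at g q q' d -> slope_at f q' q'' d' -> slope_at (f * g)%g q q'' (d' + d).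
Proof.
move=> tq tq' tq'' [n [m [gq ->]]] [n' [m' [fq ->]]].
exists (n + n')%N, (m' + m)%N; split.
  have g1 : good ((q ++ nseq n b_p) ++ nseq n' b_p).
    by rewrite -catA nseqD; have [] := tip_pow (n + n') tq.
  have g2 : good ((q' ++ nseq n' b_p) ++ nseq m b_p).
    by rewrite -catA nseqD; have [] := tip_pow (n' + m) tq'.
  have := maps_ext0 gq g1; have := maps_ext0 fq g2; rewrite -!catA !nseqD (addnC n').
  by move=> fm gm; rewrite -[false]/(false (+) false); exact: maps_mul gm fm.
by rewrite !PoszD opprD [- _ - _]addrC addrACA.
Qed.

Lemma slope_mul (f g : T_A) q : tips q ->
  tip_image (f * g)%g q = tip_image f (tip_image g q) /\
  slope (f * g)%g q = slope f (tip_image g q) + slope g q.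
Proof.
move=> tq; have [t1 s1] := tip_imageP g tq; have [t2 s2] := tip_imageP f t1.
by apply: slopeE => //; exact: slope_at_mul s1 s2.
Qed.

Lemma slope_one q : tips q -> tip_image 1%g q = q /\ slope 1%g q = 0.
Proof.
move=> tq; apply: slopeE => //; exists 0%N, 0%N; rewrite subrr cats0; split=> //.
by apply: maps_id; case: tq.
Qed.

Lemma tip_image_bij f : set_bij tips tips (tip_image f).
Proof.
have inv (g : T_A) q : tips q -> tip_image g^-1%g (tip_image g q) = q.
  by move=> tq; have [<- _] := slope_mul g^-1%g g tq; rewrite mulVg; have [] := slope_one tq.
split=> [q /(tip_imageP f)[]//|q1 q2 /set_mem t1 /set_mem t2 E|q tq].
  by rewrite -(inv f q1 t1) E inv.
exists (tip_image f^-1%g q); first by have [] := tip_imageP f^-1%g tq.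
by rewrite -{1}(invgK f) inv.
Qed.

(** Tips inside a cell on which [f] is canonical go to tips without change of depth. *)
Lemma slope_far f : exists n, forall q, tips q -> (n < size q)%N -> slope f q = 0.
Proof.
have [k H] := rearrangement_maps (rearrangementP f); exists k.+1 => q tq kq.
have [gq q0 lq qE] := tq; case: (vend q true) lq qE kq => // [_ -> //|_ -> //|w _ qE].
rewrite qE size_rcons ltnS in gq * => kw.
have gw : good w by move: gq; rewrite good_rcons => /andP[].
have [v fv] := H w gw (ltnW kw).
have fvs : maps (val f) (rcons w r_s) (rcons v r_s) false.
  by rewrite -!cats1; apply: maps_ext0 => //; rewrite cats1.
have [_ gv _ _ _] := fvs.
have [] // := @slopeE f (rcons w r_s) (rcons v r_s) 0.
- by move: tq; rewrite qE.
- by split; rewrite ?vend_rcons//; case: (v).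
- by exists 0%N, 0%N; rewrite !cats0 subrr.
Qed.

Definition total_slope (f : T_A) : int := \sum_(q \in tips) slope f q.

Definition short_tips n : set word := [set q | tips q /\ (size q <= n)%N].

Lemma short_tips_finite n : finite_set (short_tips n).
Proof.
apply: (@sub_finite_set _ _ [set` flatten [seq words i | i <- iota 0 n.+1]]) => //.
move=> q [[gq _ _ _] qn].
suff : q \in flatten [seq words i | i <- iota 0 n.+1] by [].
apply/flatten_mapP; exists (size q); first by rewrite mem_iota.
by rewrite mem_words gq eqxx.
Qed.

Lemma sum_short (F : word -> int) n : (forall q, tips q -> (n < size q)%N -> F q = 0) ->
  \sum_(q \in tips) F q = \sum_(q \in short_tips n) F q.
Proof.
move=> H; apply/esym; apply: fsbig_widen => [q []//|q /= [tq nq]].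
by apply: H => //; rewrite ltnNge; apply/negP => qn; apply: nq.
Qed.

(** By the chain rule the slope of [f * g] at [q] is that of [f] at the image of [q] plus
    that of [g] at [q], and [g] permutes the tips. The sums are cut to a finite set
    outside of which all three terms vanish. *)
Lemma total_slope_mul (f g : T_A) : total_slope (f * g)%g = total_slope f + total_slope g.
Proof.
have [n Hn] := slope_far (f * g)%g; have [m Hm] := slope_far g; set k := maxn n m.
have kn q : (k < size q)%N -> (n < size q)%N by apply: leq_ltn_trans; exact: leq_maxl.
have km q : (k < size q)%N -> (m < size q)%N by apply: leq_ltn_trans; exact: leq_maxr.
have Hf q : tips q -> (k < size q)%N -> slope f (tip_image g q) = 0.
  move=> tq kq; have [_] := slope_mul f g tq.
  by rewrite Hn ?Hm ?addr0; auto.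
rewrite /total_slope (@reindex_fsbig _ _ _ _ _ (tip_image g) _ _ (slope f) (tip_image_bij g)).
rewrite (@sum_short (slope (f * g)%g) k); last by move=> q tq /kn; exact: Hn.
rewrite (@sum_short (slope g) k); last by move=> q tq /km; exact: Hm.
rewrite (@sum_short (fun q => slope f (tip_image g q)) k)//.
rewrite -fsbig_split; last exact: short_tips_finite.
by apply: eq_fsbigr => q /set_mem[tq _]; have [] := slope_mul f g tq.
Qed.

Lemma total_slope_one : total_slope 1%g = 0.
Proof. by apply: fsbig1 => q /slope_one[]. Qed.

Lemma total_slope_inv f : total_slope f^-1%g = - total_slope f.
Proof.
by apply/eqP; rewrite -addr_eq0 -total_slope_mul mulVg total_slope_one.
Qed.

Lemma total_slope_comm f g : total_slope [~ f, g]%g = 0.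
Proof.
rewrite commgEl conjgE !total_slope_mul !total_slope_inv.
by rewrite [total_slope f + _]addrC addKr addNr.
Qed.

Lemma total_slope_pow f n : total_slope (f ^+ n)%g = total_slope f *+ n.
Proof.
elim: n => [|n IH]; first by rewrite expg0 total_slope_one.
by rewrite expgS total_slope_mul IH mulrS.
Qed.

(** The cells at the tip [b_p] get deeper by one letter. The other tips that are moved lie
    strictly below the domain words of the table. *)
Lemma total_slope_segment_p yp : acts segment_table [:: b_p] yp -> total_slope yp = 1.
Proof.
move=> ypK; have tp : tips [:: b_p] by split.
have sp : slope yp [:: b_p] = 1.
  have [] // := @slopeE yp [:: b_p] [:: b_p] 1 tp tp.
  exists 1%N, 2%N; split=> //.
  by have [H _] := ypK; exact: (H ([:: b_p], [:: b_p; b_p], false)).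
rewrite /total_slope -(fsbig_widen [set [:: b_p]] tips) ?fsbig_set1//.
  by move=> q ->.
have track := acts_tracks ypK isT (isolated_segment _).
move=> q [tq qp]; have [gq q0 lq qE] := tq.
suff [q' [tq' yq]] : exists q', tips q' /\ maps (val yp) q q' false.
  have [] // := @slopeE yp q q' 0 tq tq'.
  by exists 0%N, 0%N; rewrite !cats0 subrr.
case: (vend q true) lq qE => // [_ qE|w _ qE]; last 1 first.
- rewrite qE in gq *; move: (gq); rewrite good_rcons follows_col => /andP[gw ws].
  have cw : col w = Red by case: (col w) ws.
  (* the prefixes of [b_p b_m] are blue, but [w] is red *)
  have wpm : ~~ prefix w ([:: b_p] ++ [:: b_m]).
    by case: w cw {ws gq qE gw} => [|[] [|[] [|x w]]] //.
  have := step_some covers_segment (e := [:: b_p]) erefl gw wpm.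
  case Es : step => [[v b]|] // _; have yw := track _ _ _ gw Es.
  have b0 := maps_red yw cw; subst b.
  have yws : maps (val yp) (rcons w r_s) (rcons v r_s) false.
    by rewrite -!cats1; apply: maps_ext0 => //; rewrite cats1.
  have [_ gv _ _ _] := yws; exists (rcons v r_s); split=> //.
  by split; rewrite ?vend_rcons//; case: (v).
- by exists q; split=> //; rewrite qE; apply: track.
Qed.

(** * The abelianization *)

Lemma total_slope_derived f : derived f -> total_slope f = 0.
Proof.
move=> /(_ [set g | total_slope g = 0]); apply; last exact: total_slope_comm.
split=> [|f1 g1 E1 E2|f1 E1].
- exact: total_slope_one.
- by move: E1 E2 => /= E1 E2; rewrite total_slope_mul E1 E2 addr0.
- by move: E1 => /= E1; rewrite total_slope_inv E1 oppr0.
Qed.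

Notation ab := (abelianization T_A).

Lemma to_ab_mul (f g : T_A) : to_ab (f * g)%g = (to_ab f * to_ab g)%g :> ab.
Proof. exact: to_abM. Qed.

Lemma to_ab_inv (f : T_A) : to_ab f^-1%g = (to_ab f)^-1%g :> ab.
Proof. exact: to_abV. Qed.

Lemma to_ab_pow (f : T_A) n : to_ab (f ^+ n)%g = (to_ab f ^+ n)%g :> ab.
Proof.
elim: n => [|n IH]; first by rewrite !expg0.
by rewrite !expgS to_ab_mul IH.
Qed.

Lemma ab_comm (a b : ab) : (a * b = b * a)%g.
Proof.
elim/ab_ind: a => f; elim/ab_ind: b => g; rewrite -!to_ab_mul; apply/to_abP.
have -> : ((f * g)^-1 * (g * f) = [~ g, f])%g by rewrite commgEl conjgE invgM !mulgA.
exact: derived_comm.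
Qed.

(** [generation], applied to the rearrangements whose class is a quotient of two powers of
    the class of [yp]. *)
Lemma to_ab_generated yp f : acts segment_table [:: b_p] yp ->
  exists n m, (to_ab f * to_ab yp ^+ n = to_ab yp ^+ m :> ab)%g.
Proof.
move=> ypK; set y := to_ab yp; pose N f := exists n m, (to_ab f * y ^+ n = y ^+ m :> ab)%g.
apply: (@generation N _ _ yp ypK).
- split=> [|f1 f2 [n1 [m1 E1]] [n2 [m2 E2]]|f1 [n1 [m1 E1]]].
  + by exists 0%N, 0%N; rewrite mulg1.
  + exists (n1 + n2)%N, (m1 + m2)%N; rewrite !expgnDr -E1 -E2 to_ab_mul -!mulgA.
    by congr (_ * _)%g; rewrite !mulgA [(to_ab f2 * _)%g]ab_comm.
  + by exists m1, n1; rewrite to_ab_inv -E1 mulKg.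
- move=> f1 f2; exists 0%N, 0%N; rewrite mulg1; apply/to_abP; rewrite mulg1.
  by apply: derivedV; exact: derived_comm.
- by exists 0%N, 1%N; rewrite mulg1.
Qed.

Lemma total_slope_eq0 f : total_slope f = 0 -> derived f.
Proof.
have [yp ypK] := exists_segment_p; have [n [m E]] := to_ab_generated f ypK.
rewrite -to_ab_pow -to_ab_mul -to_ab_pow in E; move/to_abP: E => E f0.
have := total_slope_derived E; rewrite !total_slope_mul total_slope_inv.
rewrite !total_slope_mul !total_slope_pow (total_slope_segment_p ypK) f0 add0r.
rewrite !pmulrn !intz => /eqP; rewrite addrC subr_eq0 => /eqP[nm]; rewrite nm in E.
suff : to_ab f = to_ab 1%g :> ab.
  by move=> /esym/to_abP; rewrite invg1 mul1g.
move/to_abP: E; rewrite to_ab_mul => E.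
by apply: (@mulIg _ (to_ab (yp ^+ n)%g)); rewrite E -to_ab_mul mul1g.
Qed.

Lemma total_slope_eq f g : total_slope f = total_slope g <-> to_ab f = to_ab g :> ab.
Proof.
split=> [E|/to_abP/total_slope_derived].
  apply/to_abP; apply: total_slope_eq0.
  by rewrite total_slope_mul total_slope_inv E addNr.
by rewrite total_slope_mul total_slope_inv addrC => /eqP; rewrite subr_eq0 => /eqP.
Qed.

Lemma total_slope_surj (n : int) : exists f, total_slope f = n.
Proof.
have [yp ypK] := exists_segment_p; have Ey := total_slope_segment_p ypK.
case: n => n; first by exists (yp ^+ n)%g; rewrite total_slope_pow Ey pmulrn intz.
exists (yp ^+ n.+1)^-1%g; rewrite total_slope_inv total_slope_pow Ey pmulrn intz.
by rewrite NegzE.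
Qed.

Theorem corollary6p4 :
  infinite_cyclic (abelianization T_A) /\
  infinite_set (left_cosets (@derived T_A)).
Proof.
have /choice[s sE] := total_slope_surj; split.
  exists (fun n => to_ab (s n)).
    exists (fun a => total_slope (repr a)) => [n|].
      by rewrite -[RHS]sE; apply/total_slope_eq; rewrite reprK_ab.
    by elim/ab_ind => f; apply/total_slope_eq; rewrite sE; apply/total_slope_eq;
      rewrite reprK_ab.
  move=> m n; rewrite -to_ab_mul; apply/total_slope_eq.
  by rewrite total_slope_mul !sE.
pose c (n : nat) := [set (s n * h)%g | h in @derived T_A].
have c_inj : injective c.
  move=> m n mn; have : c m (s m) by exists 1%g; [exact: derived1|rewrite mulg1].
  rewrite mn => -[h Dh /(congr1 total_slope)].
  by rewrite total_slope_mul !sE (total_slope_derived Dh) addr0 => -[].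
move=> /(@sub_finite_set _ (range c)) fin; apply: infinite_nat.
rewrite -(eq_finite_set (inj_card_eq (in2W c_inj))); apply: fin.
by move=> _ [n _ <-]; exists (s n).
Qed.
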